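(* Let $(X,\omega,J,\Omega)$ be a Calabi–Yau $n$-fold, and let $L_0,L_1\subset X$ be graded Lagrangian submanifolds, with gradings $\theta_{L_0},\theta_{L_1}$, that intersect cleanly. Let $R_h,R_{h'}$ be connected components of $L_0\cap L_1$ and let $u$ be a strip that connects $R_h$ to $R_{h'}$. Then $$\mu(u)=\tilde\mu(L_0,L_1;R_{h'})-\tilde\mu(L_0,L_1;R_h).$$ If $L_0$ and $L_1$ have constant phase, this implies that $$\mu(u)=2\big(\mathrm{angle}(L_0,L_1;R_{h'})-\mathrm{angle}(L_0,L_1;R_h)\big).$$
   Context: $\Omega$ is a non-vanishing section of the canonical bundle $K_X$ (not required to be parallel). For a Lagrangian subspace $\Lambda\subset T_xX$, $\mathrm{Det}^2(\Lambda)=e^{2i\vartheta}\in S^1$ where $\mathrm{Im}(e^{-i\vartheta}\Omega)|_\Lambda=0$. A grading of a Lagrangian $L$ is a function $\theta_L:L\to\mathbb R$ with $\mathrm{Det}^2(T_xL)=e^{2\pi i\theta_L(x)}$; $L$ has constant phase if $\theta_L$ is constant. Clean intersection: $L_0\cap L_1$ is a submanifold and $T(L_0\cap L_1)=TL_0\cap TL_1$. A strip connecting $R_h$ to $R_{h'}$ is a map $u:\mathbb R\times[0,1]\to X$ with $u(s,0)\in L_0$, $u(s,1)\in L_1$, converging suitably as $s\to\pm\infty$ to points $p=u(-\infty,\cdot)\in R_h$ and $q=u(+\infty,\cdot)\in R_{h'}$ (independent of $t$). Positive definite path from $\Lambda_0$ to $\Lambda_1$ (Lagrangian subspaces of a Hermitian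 symplectic vector space): $t\mapsto U^t\Lambda_0$, where $U$ is unitary, the identity on $\Lambda_0\cap\Lambda_1$, $U\Lambda_0=\Lambda_1$, diagonal in an orthonormal basis of $\Lambda_0$, with the remaining eigenvalues $e^{2\pi i\alpha_j}$, $0<\alpha_j<\frac12$. For $x\in R_h$, $\mathrm{angle}(L_0,L_1;x)=\sum_j\alpha_j$ with $\Lambda_i=T_xL_i$; if $L_0,L_1$ have constant phase this does not depend on $x\in R_h$ and is written $\mathrm{angle}(L_0,L_1;R_h)$. Maslov index $\mu(u)$: the Maslov index of the bundle pair over the compactified strip (a square) given by $u^*TX$ and the Lagrangian subbundle equal to $TL_0$ on the bottom, $TL_1$ on the top, and the positive definite paths from $T_pL_0$ to $T_pL_1$ on the left edge and from $T_qL_0$ to $T_qL_1$ on the right edge. Absolute index: for $x\in R_h$ let $N$ be the orthogonal complement of $T_x(L_0\cap L_1)$ in $T_xL_0+T_xL_1$ (a complex symplectic subspace). Choose a path $\lambda$ of Lagrangian subspaces of $N$ from $T_xL_0\cap N$ to $T_xL_1\cap N$ and a continuous $\theta:[0,1]\to\mathbb R$ with $\theta(0)=\theta_{L_0}(x)$, $\theta(1)=\theta_{L_1}(x)$ and $\mathrm{Det}^2(\tilde\lambda(t))=e^{2\pi i\theta(t)}$, where $\tilde\lambda(t)=\lambda(t)+T_x(L_0\cap L_1)$. Then $$\tilde\mu(L_0,L_1;R_h)=\frac{n-\dim R_h}{2}-\mu(\tilde\lambda,T_xL_0)\in\mathbb Z,$$ where $\mu(\tilde\lambda,T_xL_0)$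 is the Robbin–Salamon Maslov index of the path $\tilde\lambda$ relative to the fixed Lagrangian $T_xL_0$, with the sign convention that $t\mapsto e^{\pi Jt/2}\Lambda$ crosses positively; this is independent of $x\in R_h$. *)

(* Defs.v *)
From HB Require Import structures.
From mathcomp Require Import all_boot all_order all_algebra.
From mathcomp Require Import all_classical all_reals all_analysis.
From mathcomp Require Import complex.

Set Implicit Arguments.
Unset Strict Implicit.
Unset Printing Implicit Defensive.

Import Order.TTheory GRing.Theory Num.Theory.
Import numFieldNormedType.Exports.

Local Open Scope classical_set_scope.
Local Open Scope ring_scope.
Local Open Scope complex_scope.

(** * Linear algebra in C^n

    C^n is the space of real row vectors (x, y) : 'rV[R]_(n + n), standing for
    x + i y.  Matrices act on the right.  A bilinear form is given by its Gram
    matrix, and k vectors of C^n are the rows of an element of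
    'M[R]_(k, n + n). *)

Section LinearAlgebra.
Context {R : realType} {n : nat}.
Implicit Types (V N : {vspace 'rV[R]_(n + n)}) (W : 'M[R]_(n + n)).

Definition expi (a : R) : R[i] := cos a +i* sin a.

(* v *m Jmx is i v. *)
Definition Jmx : 'M[R]_(n + n) := block_mx 0 1%:M (- 1%:M) 0.

Definition cplx_mx k (F : 'M[R]_(k, n + n)) : 'M[R[i]]_(k, n) :=
  \matrix_(i, j) (F i (lshift n j) +i* F i (rshift n j)).

Definition form W (v w : 'rV[R]_(n + n)) : R := (v *m W *m w^T) 0 0.

(* The metric g = omega(., J .) when W is the Gram matrix of omega. *)
Definition metric W (v w : 'rV[R]_(n + n)) : R := form W v (w *m Jmx).

(* The subspace whose elements are the solutions of P; junk (0) if these do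
   not form a subspace. *)
Definition vspace_of k (P : 'rV[R]_k -> Prop) : {vspace 'rV[R]_k} :=
  xget 0%VS [set V : {vspace 'rV[R]_k} | forall v, v \in V <-> P v].

Definition rowspace k (F : 'M[R]_(k, n + n)) : {vspace 'rV[R]_(n + n)} :=
  vspace_of (fun v => (v <= F)%MS).

Definition is_frame k (F : 'M[R]_(k, n + n)) V : Prop :=
  row_free F /\ rowspace F = V.

(* V is a Lagrangian subspace of N.  That N is symplectic is not part of the
   definition. *)
Definition lagrangian W N V : Prop :=
  [/\ (V <= N)%VS, (2 * \dim V = \dim N)%N &
      forall v w, v \in V -> w \in V -> form W v w = 0].

Definition orthocomplement W (K N : {vspace 'rV[R]_(n + n)}) :
    {vspace 'rV[R]_(n + n)} :=
  vspace_of (fun v => v \in N /\ forall k, k \in K -> metric W v k = 0).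

(* Det^2(V) = z with respect to the complex n-form vol. *)
Definition Det2 (vol : 'M[R]_(n, n + n) -> R[i]) V (z : R[i]) : Prop :=
  exists vartheta : R, z = expi (2 * vartheta) /\
    forall F : 'M[R]_(n, n + n), (forall i, row i F \in V) ->
      complex.Im (expi (- vartheta) * vol F) = 0.

(* s is the signature of the restriction to K of the symmetric bilinear form
   B.  The decomposition exists only if this restriction is nondegenerate. *)
Definition nondegenerate_signature k (B : 'rV[R]_k -> 'rV[R]_k -> R)
    (K : {vspace 'rV[R]_k}) (s : int) : Prop :=
  exists Kp Kn : {vspace 'rV[R]_k},
    [/\ (Kp + Kn = K)%VS,
        forall v, v \in Kp -> v != 0 -> 0 < B v v,
        forall v, v \in Kn -> v != 0 -> B v v < 0,
        forall v w, v \in Kp -> w \in Kn -> B v w = 0 &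
        s = (\dim Kp)%:Z - (\dim Kn)%:Z].

(** ** Paths of subspaces, parametrized by [0, 1] *)

Definition continuous_path (lam : R -> {vspace 'rV[R]_(n + n)}) : Prop :=
  exists k (F : R -> 'M[R]_(k, n + n)),
    {within `[0, 1], continuous F} /\
    forall t, t \in `[0, 1] -> is_frame (F t) (lam t).

Definition lagrangian_path W N (lam : R -> {vspace 'rV[R]_(n + n)}) : Prop :=
  continuous_path lam /\
  forall t, t \in `[0, 1] -> lagrangian W N (lam t).

(* The crossing form of the path spanned by the rows of G : R -> 'M_(n, n + n)
   at t, transported to coordinates in the frame G t: for v = a G(t) it is
   omega(v, a G'(t)).  For a Lagrangian path it is symmetric, and its
   restriction to the vectors with a G(t) in V does not depend on the frame.
   It is positive for t |-> e^{Jt} V at t = 0. *)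
Definition crossing_form W (G : R -> 'M[R]_(n, n + n)) (t : R)
    (a b : 'rV[R]_n) : R :=
  form W (a *m G t) (b *m \matrix_(i, j) derive1 (fun r => G r i j) t).

Definition crossing_space (G : R -> 'M[R]_(n, n + n)) V (t : R) :
    {vspace 'rV[R]_n} :=
  vspace_of (fun a => a *m G t \in V).

(* lam is C^1 and all its crossings with V are regular; mu is the sum of the
   signatures of the crossing forms, with weight 1/2 at the end points. *)
Definition regular_index W V (lam : R -> {vspace 'rV[R]_(n + n)}) (mu : R) :
    Prop :=
  exists (G : R -> 'M[R]_(n, n + n)) (crossings : seq R) (sg : R -> int),
    [/\ (forall i j, (forall t, derivable (fun r => G r i j) t 1) /\
           continuous (derive1 (fun r => G r i j))) /\
        (forall t, t \in `[0, 1] -> is_frame (G t) (lam t)),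
        uniq crossings,
        forall t, (t \in crossings) <->
          (t \in `[0, 1]) /\ (lam t :&: V)%VS <> 0%VS,
        forall t, t \in crossings ->
          nondegenerate_signature (crossing_form W G t)
            (crossing_space G V t) (sg t) &
        mu = \sum_(t <- crossings)
               (if (t == 0) || (t == 1) then 2^-1 else 1) * (sg t)%:~R].

Definition lagrangian_homotopy W
    (lam0 lam1 : R -> {vspace 'rV[R]_(n + n)}) : Prop :=
  exists (H : R -> R -> {vspace 'rV[R]_(n + n)})
         (F : R * R -> 'M[R]_(n, n + n)),
    [/\ {within `[0, 1] `*` `[0, 1], continuous F},
        forall r t, r \in `[0, 1] -> t \in `[0, 1] ->
          is_frame (F (r, t)) (H r t) /\ lagrangian W fullv (H r t),
        forall t, t \in `[0, 1] -> H 0 t = lam0 t /\ H 1 t = lam1 t &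
        forall r, r \in `[0, 1] -> H r 0 = lam0 0 /\ H r 1 = lam0 1].

(* The Robbin-Salamon index of a continuous path lam of Lagrangian subspaces
   relative to V: the index of any path with regular crossings that is
   homotopic to lam with fixed end points. *)
Definition RS_index W V (lam : R -> {vspace 'rV[R]_(n + n)}) (mu : R) :
    Prop :=
  exists lam', lagrangian_homotopy W lam lam' /\ regular_index W V lam' mu.

(** ** Positive definite paths *)

(* The frame U^t E, where the unitary U multiplies the j-th row of E by
   e^{2 pi i alpha_j}. *)
Definition rotate (E : 'M[R]_(n, n + n)) (alpha : 'I_n -> R) (t : R) :
    'M[R]_(n, n + n) :=
  \matrix_(j < n) (cos (2 * pi * alpha j * t) *: row j E +
                   sin (2 * pi * alpha j * t) *: (row j E *m Jmx)).

(* t |-> rowspace (rotate E alpha t) is a positive definite path from V0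
   to V1. *)
Definition positive_definite_path W V0 V1
    (E : 'M[R]_(n, n + n)) (alpha : 'I_n -> R) : Prop :=
  [/\ is_frame E V0,
      forall i j, metric W (row i E) (row j E) = (i == j)%:R,
      forall j, 0 <= alpha j < 2^-1,
      (V0 :&: V1)%VS = <<[seq row j E | j <- enum 'I_n & alpha j == 0%R]>>%VS &
      rowspace (rotate E alpha 1) = V1].

End LinearAlgebra.

(** * Calabi-Yau manifolds *)

Section Smooth.
Context {R : realType} {m : nat}.

Definition partial (i : 'I_m) (f : 'rV[R]_m -> R) (z : 'rV[R]_m) : R :=
  derive1 (fun h : R => f (z + h *: delta_mx 0 i)) 0.

(* f is C^k on the open set U. *)
Fixpoint Ck (k : nat) (U : set 'rV[R]_m) (f : 'rV[R]_m -> R) : Prop :=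
  (forall z, U z -> {for z, continuous f}) /\
  if k is k'.+1 then
    forall i,
      (forall z, U z -> derivable (fun h : R => f (z + h *: delta_mx 0 i)) 0 1)
      /\ Ck k' U (partial i f)
  else True.

Definition smooth_on (U : set 'rV[R]_m) (f : 'rV[R]_m -> R) : Prop :=
  forall k, Ck k U f.

(* The differential of f at z is v |-> v *m jac f z. *)
Definition jac k (f : 'rV[R]_m -> 'rV[R]_k) (z : 'rV[R]_m) : 'M[R]_(m, k) :=
  \matrix_(i, j) partial i (fun y => f y 0 j) z.

Record chart (X : topologicalType) := Chart {
  dom : set X;
  fwd : X -> 'rV[R]_m;
  bwd : 'rV[R]_m -> X;
  dom_open : open dom;
  img_open : open (fwd @` dom);
  fwdK : forall x, dom x -> bwd (fwd x) = x;
  fwd_continuous : forall x, dom x -> {for x, continuous fwd};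
  bwd_continuous : forall z, (fwd @` dom) z -> {for z, continuous bwd} }.

Definition transition (X : topologicalType) (c d : chart X) (z : 'rV[R]_m) :=
  fwd d (bwd c z).

Definition smooth_transition (X : topologicalType) (c d : chart X) : Prop :=
  forall j, smooth_on (fwd c @` (dom c `&` dom d))
                      (fun z => transition c d z 0 j).

End Smooth.
Arguments chart R m X : clear implicits.

(* The distinguished chart chart_at x identifies T_x X with C^n, on which J
   is Jmx since the transition maps are holomorphic. *)
Record complex_manifold (R : realType) (n : nat) := ComplexManifold {
  cm_space :> topologicalType;
  cm_hausdorff : hausdorff_space cm_space;
  cm_second_countable : @second_countable cm_space;
  atlas : set (chart R (n + n) cm_space);
  chart_at : cm_space -> chart R (n + n) cm_space;
  chart_at_atlas : forall x, atlas (chart_at x);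
  chart_at_dom : forall x, dom (chart_at x) x;
  transition_smooth : forall c d, atlas c -> atlas d -> smooth_transition c d;
  transition_holomorphic : forall c d x, atlas c -> atlas d ->
    dom c x -> dom d x ->
    Jmx *m jac (transition c d) (fwd c x) =
    jac (transition c d) (fwd c x) *m Jmx }.

(* The matrix of the change of coordinates from T_x X to the chart c. *)
Definition tangent_coord (R : realType) (n : nat) (X : complex_manifold R n)
    (x : X) (c : chart R (n + n) X) : 'M[R]_(n + n) :=
  jac (transition (chart_at x) c) (fwd (chart_at x) x).

Definition omega_in_chart (R : realType) (n : nat) (X : complex_manifold R n)
    (omega : X -> 'M[R]_(n + n)) (c : chart R (n + n) X) (z : 'rV[R]_(n + n)) :
    'M[R]_(n + n) :=
  let T := invmx (tangent_coord (bwd c z) c) in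
  T *m omega (bwd c z) *m T^T.

Definition nform (R : realType) (n : nat) (a : R[i]) (F : 'M[R]_(n, n + n)) :
    R[i] :=
  a * \det (cplx_mx F).

(* The value on the first n coordinate vector fields d/dx_1, ..., d/dx_n
   of the chart c. *)
Definition Omega_in_chart (R : realType) (n : nat) (X : complex_manifold R n)
    (Omega : X -> R[i]) (c : chart R (n + n) X) (z : 'rV[R]_(n + n)) : R[i] :=
  nform (Omega (bwd c z)) (usubmx (invmx (tangent_coord (bwd c z) c))).

(* At x the canonical bundle is the complex line of the forms nform a; Omega x
   is the coefficient a.  Omega is not required to be holomorphic or
   parallel. *)
Record calabi_yau (R : realType) (n : nat) := CalabiYau {
  cy_manifold :> complex_manifold R n;
  omega : cy_manifold -> 'M[R]_(n + n);
  omega_smooth : forall c i j, atlas c ->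
    smooth_on (fwd c @` dom c) (fun z => omega_in_chart omega c z i j);
  omega_alternating : forall x v, form (omega x) v v = 0;
  omega_J : forall x v w,
    form (omega x) (v *m Jmx) (w *m Jmx) = form (omega x) v w;
  omega_positive : forall x v, v != 0 -> 0 < metric (omega x) v v;
  omega_closed : forall c (i j k : 'I_(n + n)) z, atlas c ->
    (fwd c @` dom c) z ->
    let w a b := fun y => omega_in_chart omega c y a b in
    partial i (w j k) z + partial j (w k i) z + partial k (w i j) z = 0;
  Omega : cy_manifold -> R[i];
  Omega_smooth : forall c, atlas c ->
    smooth_on (fwd c @` dom c) (fun z => complex.Re (Omega_in_chart Omega c z))
    /\
    smooth_on (fwd c @` dom c) (fun z => complex.Im (Omega_in_chart Omega c z));
  Omega_nonvanishing : forall x, Omega x != 0 }.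

(** * Graded Lagrangians, strips and indices *)

Section Lagrangians.
Context {R : realType} {n : nat} {X : calabi_yau R n}.
Implicit Types (L S : set X).

Definition submanifold_at S (x : X) (k : nat) : Prop :=
  (k <= n + n)%N /\
  exists c : chart R (n + n) X,
    [/\ dom c x,
        forall d, atlas d -> smooth_transition c d /\ smooth_transition d c &
        forall y, dom c y ->
          (S y <-> forall i : 'I_(n + n), (k <= i)%N -> fwd c y 0 i = 0)].

(* v is the velocity at x of a curve in S. *)
Definition tangent_vector S (x : X) (v : 'rV[R]_(n + n)) : Prop :=
  exists gam : R -> X,
    [/\ gam 0 = x,
        \forall t \near (0 : R), S (gam t) /\ dom (chart_at x) (gam t) &
        forall j, is_derive (0 : R) 1
          (fun t => fwd (chart_at x) (gam t) 0 j) (v 0 j)].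

Definition tangent_space S (x : X) : {vspace 'rV[R]_(n + n)} :=
  vspace_of (tangent_vector S x).

Definition lagrangian_submanifold L : Prop :=
  forall x, L x ->
    submanifold_at L x n /\ lagrangian (omega x) fullv (tangent_space L x).

Definition grading L (theta : X -> R) : Prop :=
  {within L, continuous theta} /\
  forall x, L x ->
    Det2 (nform (Omega x)) (tangent_space L x) (expi (2 * pi * theta x)).

Definition constant_phase L (theta : X -> R) : Prop :=
  forall x y, L x -> L y -> theta x = theta y.

(* The components of the intersection may have different dimensions. *)
Definition clean_intersection L0 L1 : Prop :=
  forall x, (L0 `&` L1) x ->
    (exists k, submanifold_at (L0 `&` L1) x k) /\
    tangent_space (L0 `&` L1) x =
      (tangent_space L0 x :&: tangent_space L1 x)%VS.

Definition component S (Rh : set X) : Prop :=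
  exists2 x, S x & Rh = connected_component S x.

(* The extension of a strip to [-oo, +oo] x [0, 1]. *)
Definition compactify (u : R -> R -> X) (p q : X) (z : \bar R * R) : X :=
  match z.1 with
  | s%:E => u s z.2
  | -oo%E => p
  | +oo%E => q
  end.

Definition closed_strip : set (\bar R * R) := [set: \bar R] `*` `[0, 1].

Definition is_strip L0 L1 (Rh Rh' : set X) (u : R -> R -> X) (p q : X) :
    Prop :=
  [/\ Rh p, Rh' q, {within closed_strip, continuous (compactify u p q)},
      forall s, L0 (u s 0) & forall s, L1 (u s 1)].

Definition angle L0 L1 (Rh : set X) (a : R) : Prop :=
  exists x E alpha,
    [/\ Rh x,
        positive_definite_path (omega x) (tangent_space L0 x)
          (tangent_space L1 x) E alpha &
        a = \sum_j alpha j].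

(* A trivialization of w^* TX: Phi z is a complex linear isomorphism from C^n
   to the tangent space at w z. *)
Definition trivialization (w : \bar R * R -> X)
    (Phi : \bar R * R -> 'M[R]_(n + n)) : Prop :=
  (forall z, closed_strip z -> Phi z \in unitmx /\ Jmx *m Phi z = Phi z *m Jmx)
  /\
  (forall c, atlas c ->
     {within closed_strip `&` w @^-1` dom c,
       continuous (fun z => Phi z *m tangent_coord (w z) c)}).

(* The pull-back by Phi^-1 of the standard n-form of C^n. *)
Definition trivialized_nform (Phi : 'M[R]_(n + n)) (F : 'M[R]_(n, n + n)) :
    R[i] :=
  \det (cplx_mx (F *m invmx Phi)).

(* The Maslov index of the bundle pair over the closed strip given by w^* TX
   and the subspaces bottom, top, left, right over the four edges: the degree
   of Det^2, computed in a trivialization, along the boundary traversed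
   counterclockwise.  The functions f are lifts of Det^2 on the edges. *)
Definition bundle_pair_maslov (w : \bar R * R -> X)
    (bottom top : \bar R -> {vspace 'rV[R]_(n + n)})
    (left right : R -> {vspace 'rV[R]_(n + n)}) (k : int) : Prop :=
  exists (Phi : \bar R * R -> 'M[R]_(n + n))
         (fb ft : \bar R -> R) (fl fr : R -> R),
  [/\ trivialization w Phi,
      [/\ continuous fb, continuous ft, {within `[0, 1], continuous fl} &
          {within `[0, 1], continuous fr}],
      forall s,
        Det2 (trivialized_nform (Phi (s, 0))) (bottom s)
             (expi (2 * pi * fb s)) /\
        Det2 (trivialized_nform (Phi (s, 1))) (top s)
             (expi (2 * pi * ft s)),
      forall t, t \in `[0, 1] ->
        Det2 (trivialized_nform (Phi (-oo%E, t))) (left t)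
             (expi (2 * pi * fl t)) /\
        Det2 (trivialized_nform (Phi (+oo%E, t))) (right t)
             (expi (2 * pi * fr t)) &
      k%:~R = (fb +oo%E - fb -oo%E) + (fr 1 - fr 0)
              - (ft +oo%E - ft -oo%E) - (fl 1 - fl 0)].

Definition strip_maslov L0 L1 (u : R -> R -> X) (p q : X) (k : int) : Prop :=
  let w := compactify u p q in
  exists Ep alphap Eq alphaq,
    [/\ positive_definite_path (omega p) (tangent_space L0 p)
          (tangent_space L1 p) Ep alphap,
        positive_definite_path (omega q) (tangent_space L0 q)
          (tangent_space L1 q) Eq alphaq &
        bundle_pair_maslov w
          (fun s => tangent_space L0 (w (s, 0)))
          (fun s => tangent_space L1 (w (s, 1)))
          (fun t => rowspace (rotate Ep alphap t))
          (fun t => rowspace (rotate Eq alphaq t)) k].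

(* No value satisfies this predicate if N = 0 while theta0 and theta1 differ
   on Rh, since there is then no suitable path lam. *)
Definition absolute_index L0 L1 (theta0 theta1 : X -> R) (Rh : set X)
    (m : R) : Prop :=
  exists x, Rh x /\
  let A := tangent_space L0 x in
  let B := tangent_space L1 x in
  let K := tangent_space (L0 `&` L1) x in
  let N := orthocomplement (omega x) K (A + B)%VS in
  exists (lam : R -> {vspace 'rV[R]_(n + n)}) (theta : R -> R) (mu : R),
    [/\ [/\ lagrangian_path (omega x) N lam, lam 0 = (A :&: N)%VS &
            lam 1 = (B :&: N)%VS],
        [/\ {within `[0, 1], continuous theta}, theta 0 = theta0 x &
            theta 1 = theta1 x],
        forall t, t \in `[0, 1] ->
          Det2 (nform (Omega x)) (lam t + K)%VS (expi (2 * pi * theta t)),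
        RS_index (omega x) A (fun t => lam t + K)%VS mu &
        m = (n%:R - (\dim (tangent_space Rh x))%:R) / 2 - mu].

End Lagrangians.

(* Main.v *)
(* At x in L0 and L1 let D(x) = theta1 - theta0 - 2 sum_j alpha_j, where the
   alpha_j are the angles of a positive definite path from T_x L0 to T_x L1.
   This is an integer, and the theorem follows from three facts.

   The Maslov index of a strip from p to q is D(p) - D(q).  Lift the argument of
   Omega in the trivialization to the whole closed strip; along each edge of the
   strip the given lift of Det^2 differs from the lift read off from Omega by an
   integer, hence by a constant.

   The absolute index is - D(x).  Along a path of Lagrangians from T_x L0, the
   number theta - 2 sum_j alpha_j is locally constant except at the crossings
   with T_x L0, where it jumps by the dimensions of the positive and of the
   negative part of the crossing form.  This computes the index of a path with
   regular crossings; a homotopy is handled by lifting the phase over a square.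

   D is constant on the components of the intersection.  The angles depend
   continuously on a pair of Lagrangians as elements of R / (1/2) Z, so that D
   can only jump if an angle passes from 0 to 1/2, and this does not happen
   while the dimension of the intersection is constant.

   The continuity of the angles is proved without eigenvalues, by counting the
   angles in a window through the dimension of a subspace on which a form that
   depends continuously on the Lagrangians is positive definite. *)

Require Import Defs.
From mathcomp Require Import all_boot all_order all_algebra.
From mathcomp Require Import all_classical all_reals all_analysis.
From mathcomp Require Import complex ring lra zify.

Set Implicit Arguments.
Unset Strict Implicit.
Unset Printing Implicit Defensive.

Import Order.TTheory GRing.Theory Num.Theory.
Import numFieldNormedType.Exports.

Local Open Scope classical_set_scope.
Local Open Scope ring_scope.

(** * Positive definite forms and simultaneous diagonalization *)

Section PosDef.
Context {R : rcfType}.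

(** The obstacle is that angles are eigenvalue data: individually they cannot be followed through
    coincidences, and they wrap around at 1/2, where the rotation through pi is only a sign change
    of a basis vector. So only counts are controlled. Positive definiteness is an open condition,
    hence near a given pair of Lagrangians the number of angles in a window cannot drop; since
    disjoint small windows around the given angles already account for all n of them, each count is
    exact. This fixes the sum of the angles up to n e and up to 1/2 for each angle that has passed
    from 0 to 1/2. The remaining error is removed by arithmetic: D is an integer, so an estimate
    with error below 1 is an equality. The half weights at the end points of a path contribute (n -
    dim)/2 to the Robbin-Salamon index, and the normalization of the absolute index cancels exactly
    this term. *)

Definition posdef n (P : 'M[R]_n) :=
  forall v : 'rV_n, v != 0 -> 0 < (v *m P *m v^T) 0 0.

Lemma trmxD m n (A B : 'M[R]_(m, n)) : (A + B)^T = A^T + B^T.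
Proof. exact: linearD. Qed.

Lemma trmxN m n (A : 'M[R]_(m, n)) : (- A)^T = - A^T.
Proof. exact: linearN. Qed.

Lemma trmxZ m n a (A : 'M[R]_(m, n)) : (a *: A)^T = a *: A^T.
Proof. exact: linearZ. Qed.

Lemma mul_trE m n (u v : 'M[R]_(m, n)) i j :
  (u *m v^T) i j = \sum_k u i k * v j k.
Proof. by rewrite mxE; apply: eq_bigr => k _; rewrite mxE. Qed.

Lemma sqr_norm_gt0 n (v : 'rV[R]_n) : v != 0 -> 0 < (v *m v^T) 0 0.
Proof.
move=> v0; rewrite mul_trE lt_def sumr_ge0 ?andbT; last first.
  by move=> k _; rewrite -expr2 sqr_ge0.
apply: contra v0 => /eqP h; apply/eqP/rowP => k; rewrite mxE.
apply/eqP; rewrite -sqrf_eq0 expr2; apply/eqP.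
by move: k isT; apply: psumr_eq0P h => i _; rewrite -expr2 sqr_ge0.
Qed.

Lemma posdef_congr m n (B : 'M[R]_(m, n)) (P : 'M[R]_n) :
  row_free B -> posdef P -> posdef (B *m P *m B^T).
Proof.
move=> fB hP v v0.
have /hP : v *m B != 0.
  by apply: contra v0 => /eqP h; apply/eqP/(row_free_inj fB); rewrite h mul0mx.
by rewrite trmx_mul !mulmxA.
Qed.

(** Gram-Schmidt by induction: once the first basis vector is normalized and its multiples are
    subtracted from the others, the remaining block is the Schur complement, which is again positive
    definite. *)
Lemma posdef_cholesky n (P : 'M[R]_n) : P^T = P -> posdef P ->
  exists2 Q : 'M[R]_n, Q \in unitmx & Q *m P *m Q^T = 1%:M.
Proof.
elim: n P => [|n IH] P; first by exists 1%:M; rewrite ?unitmx1 ?flatmx0 //; apply/matrixP => -[].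
rewrite -[n.+1]/(1 + n)%N in P *.
rewrite -[P]submxK; move: (ulsubmx P) (ursubmx P) (dlsubmx P) (drsubmx P).
move=> a b b' c; rewrite tr_block_mx => /eq_block_mx[_ _ <- cc] hP.
have a0 : 0 < a 0 0.
  have := hP (row_mx 1%:M 0).
  rewrite mul_row_block tr_row_mx mul_row_col !mul0mx !mul1mx !trmx0 !mulmx0.
  rewrite !addr0 trmx1 mulmx1; apply; apply: contraTneq isT => /eqP.
  by rewrite -row_mx0 => /eqP/eq_row_mx[] /matrixP/(_ 0 0) /eqP; rewrite !mxE oner_eq0.
have aE : a = (a 0 0)%:M by rewrite {1}[a]mx11_scalar.
set s := a 0 0 in a0 aE.
set Q1 : 'M[R]_(1 + n) := block_mx (Num.sqrt s)^-1%:M 0 (- s^-1 *: b^T) 1%:M.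
have sq0 : 0 < Num.sqrt s by rewrite sqrtr_gt0.
have uQ1 : Q1 \in unitmx.
  rewrite unitmxE det_lblock det1 mulr1 det_scalar1 unitfE.
  by rewrite invr_eq0 gt_eqF.
have EQ1 : Q1 *m block_mx a b b^T c *m Q1^T =
    block_mx 1%:M 0 0 (c - s^-1 *: (b^T *m b)).
  rewrite tr_block_mx mulmx_block !mul0mx !addr0 mulmx_block.
  rewrite !trmx0 !mulmx0 !addr0 !trmx1 !mulmx1 !mul1mx aE.
  rewrite tr_scalar_mx !linearZ /= trmxK !mul_mx_scalar !mul_scalar_mx -!scalemxAl.
  have -> : s *: (- s^-1 *: b^T) + b^T = 0.
    by rewrite scalerA mulrN divff ?gt_eqF // scaleN1r addNr.
  rewrite mul0mx !scaler0 add0r; congr block_mx.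
  - apply/matrixP => i j; rewrite !mxE.
    rewrite -[s in _ * (s * _)]sqr_sqrtr ?ltW //; case: eqP => _; last by rewrite !mulr0.
    by rewrite !mulr1n; field; rewrite gt_eqF.
  - rewrite mul_scalar_mx !scalerA mulNr mulVf ?gt_eqF // mulN1r scaleNr.
    by rewrite addNr.
  - by rewrite scalerN scaleNr addrC.
have [||Q2 uQ2 EQ2] := IH (c - s^-1 *: (b^T *m b)).
- by rewrite linearB /= linearZ /= trmx_mul trmxK cc.
- move=> v v0; have := posdef_congr _ hP; move/(_ _ Q1).
  rewrite row_free_unit uQ1 EQ1 => /(_ isT (row_mx 0 v)).
  rewrite mul_row_block tr_row_mx mul_row_col !mul0mx !mulmx0 !add0r trmx0 mulmx0 add0r.
  apply; apply: contra v0 => /eqP; rewrite -row_mx0 => /eq_row_mx[_ ->].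
  by rewrite eqxx.
set D : 'M[R]_(1 + n) := block_mx 1%:M 0 0 Q2.
exists (D *m Q1).
  by rewrite unitmx_mul uQ1 block_diag_mx_unit unitmx1 uQ2.
rewrite trmx_mul mulmxA -(mulmxA D Q1) -(mulmxA D) EQ1 /D.
rewrite tr_block_mx !mulmx_block !trmx0 trmx1 !mulmx0 !mul0mx !mul1mx !addr0 !add0r.
by rewrite mulmx1 !mul0mx EQ2 -scalar_mx_block.
Qed.

(** The reflection in the hyperplane orthogonal to v - e exchanges the first basis vector e and
    v. *)
Lemma householder n (v : 'rV[R]_(1 + n)) : v *m v^T = 1%:M ->
  exists O : 'M[R]_(1 + n), O *m O^T = 1%:M /\ row_mx 1%:M 0 *m O = v.
Proof.
move=> v1; set e : 'rV[R]_(1 + n) := row_mx 1%:M 0.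
have e1 : e *m e^T = 1%:M.
  by rewrite tr_row_mx mul_row_col trmx1 mul1mx mul0mx addr0.
have [ev|ev] := eqVneq v e.
  by exists 1%:M; rewrite trmx1 !mulmx1 ev.
have [u uE] : {u | u = v - e} by exists (v - e).
have u0 : 0 < (u *m u^T) 0 0 by apply: sqr_norm_gt0; rewrite uE subr_eq0.
set t := (e *m v^T) 0 0.
have etE : e *m v^T = t%:M by rewrite {1}[e *m v^T]mx11_scalar.
have teE : v *m e^T = t%:M by rewrite -tr_scalar_mx -etE trmx_mul trmxK.
have uuE : u *m u^T = (2 - 2 * t)%:M.
  rewrite uE linearB /= mulmxBl !mulmxBr v1 e1 etE teE -!raddfB /=.
  by congr (_%:M); ring.
have t1 : 0 < 2 - 2 * t by move: u0; rewrite uuE mxE.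
(* The denominator is the squared norm of u = v - e. *)
set c := 2 / (2 - 2 * t).
exists (1%:M - c *: (u^T *m u)); split.
  have -> : (1%:M - c *: (u^T *m u))^T = 1%:M - c *: (u^T *m u).
    by rewrite linearB /= linearZ /= trmx_mul trmxK trmx1.
  have uu : u^T *m u *m (u^T *m u) = (2 - 2 * t) *: (u^T *m u).
    by rewrite mulmxA -(mulmxA u^T) uuE mul_mx_scalar -scalemxAl.
  rewrite mulmxBl !mulmxBr !mul1mx mulmx1 -scalemxAl -scalemxAr uu.
  rewrite !scalerA -scalerBl -addrA -opprD -scalerDl.
  rewrite (_ : c + _ = 0) ?scale0r ?subr0 // /c; field.
  by rewrite gt_eqF.
rewrite mulmxBr mulmx1 -scalemxAr mulmxA {1}uE linearB /= mulmxBr etE e1 -raddfB /=.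
rewrite mul_scalar_mx scalerA (_ : c * _ = -1) /c; last by field; rewrite gt_eqF.
by rewrite scaleN1r opprK uE addrC subrK.
Qed.

End PosDef.

(** * Real orthogonal diagonalization of symmetric and unitary matrices *)

Section Diagonalization.
Context {R : realType}.

(** The complexified matrix has an eigenvector w; symmetry makes its eigenvalue real, and then the
    real or the imaginary part of w is a real eigenvector. *)
Lemma symmetric_eigen n (N : 'M[R]_n) : (0 < n)%N -> N^T = N ->
  exists z (v : 'rV_n), v != 0 /\ v *m N = z *: v.
Proof.
move=> n0 NT.
have [a /eigenvalueP[w wN w0]] := eigenvalue_closed (map_mx (real_complex R) N) n0.
set p := map_mx (@complex.Re R) w; set q := map_mx (@complex.Im R) w.
have ReS (F : 'I_n -> R[i]) : complex.Re (\sum_k F k) = \sum_k complex.Re (F k).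
  by apply: (big_morph (@complex.Re R)) => // -[? ?] [].
have ImS (F : 'I_n -> R[i]) : complex.Im (\sum_k F k) = \sum_k complex.Im (F k).
  by apply: (big_morph (@complex.Im R)) => // -[? ?] [].
have pN : p *m N = complex.Re a *: p - complex.Im a *: q.
  apply/rowP => j; move/rowP/(_ j)/(congr1 (@complex.Re R)): wN.
  rewrite !mxE ReS => wN; transitivity (complex.Re (a * w 0 j)); last by case: (a) (w 0 j) => ? ? [].
  rewrite -wN; apply: eq_bigr => k _; rewrite !mxE.
  by case: (w 0 k) => x y /=; rewrite mulr0 subr0.
have qN : q *m N = complex.Re a *: q + complex.Im a *: p.
  apply/rowP => j; move/rowP/(_ j)/(congr1 (@complex.Im R)): wN.
  rewrite !mxE ImS => wN; transitivity (complex.Im (a * w 0 j)); last by case: (a) (w 0 j) => ? ? [].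
  rewrite -wN; apply: eq_bigr => k _; rewrite !mxE.
  by case: (w 0 k) => x y /=; rewrite mulr0 add0r.
have pq0 : (p != 0) || (q != 0).
  rewrite -negb_and; apply: contra w0 => /andP[/eqP p0 /eqP q0].
  apply/eqP/rowP => j; move/rowP/(_ j): p0; move/rowP/(_ j): q0; rewrite !mxE.
  by case: (w 0 j) => x y /= -> ->.
(* Symmetry of N, applied to the real part p and the imaginary part q, says that Im a times |p|^2 +
   |q|^2 vanishes. *)
have a0 : complex.Im a = 0.
  have E : p *m N *m q^T = p *m (q *m N)^T by rewrite trmx_mul NT mulmxA.
  move: E; rewrite pN qN trmxD !trmxZ mulmxBl mulmxDr -!scalemxAl -!scalemxAr.
  move/addrI => E.
  have h (x : 'rV[R]_n) : 0 <= (x *m x^T) 0 0.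
    by have [->|/sqr_norm_gt0/ltW//] := eqVneq x 0; rewrite mul0mx mxE.
  have pos : 0 < (p *m p^T) 0 0 + (q *m q^T) 0 0.
    by case/orP: pq0 => /sqr_norm_gt0 ?; [apply: ltr_pwDl|apply: ltr_pwDr].
  move: E pos; move: (p *m p^T) (q *m q^T) => A B /matrixP/(_ 0 0).
  rewrite !mxE => E pos; have : complex.Im a * (A 0 0 + B 0 0) = 0 by rewrite mulrDr -E addNr.
  by move/eqP; rewrite mulf_eq0 (gt_eqF pos) orbF => /eqP.
exists (complex.Re a); rewrite a0 !scale0r subr0 addr0 in pN qN.
by case/orP: pq0 => h0; [exists p | exists q].
Qed.

(** If X is invertible, X^-1 Y is symmetric and an eigenvalue of it is tan t; if X is singular, a
    vector of its kernel gives t = pi / 2. *)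
Lemma common_ray n (X Y : 'M[R]_n) : (0 < n)%N -> X *m Y^T = Y *m X^T ->
  exists (t : R) (a r : 'rV_n), [/\ 0 <= t < pi, a != 0,
    a *m X = cos t *: r & a *m Y = sin t *: r].
Proof.
move=> n0 XY; have [uX|uX] := boolP (X \in unitmx); last first.
  have : kermx X != 0 by rewrite kermx_eq0 row_free_unit.
  case/rowV0Pn => a /sub_kermxP aX a0.
  exists (pi / 2), a, (a *m Y); rewrite cos_pihalf sin_pihalf scale0r scale1r aX; split => //.
  by have := @pi_gt0 R; lra.
have NT : (invmx X *m Y)^T = invmx X *m Y.
  have := congr1 (fun M => invmx X *m M *m (invmx X)^T) XY.
  rewrite trmx_mul !mulmxA mulVmx // mul1mx => ->.
  by rewrite -!mulmxA -trmx_mul mulVmx // trmx1 !mulmx1.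
have [z [v [v0 vN]]] := symmetric_eigen n0 NT.
have c0 : cos (atan z) != 0 by rewrite cos_atan invr_eq0 gt_eqF // sqrtr_gt0 ltr_pwDl // sqr_ge0.
have sE : sin (atan z) = z * cos (atan z) by rewrite -{2}[z]atanK /tan mulfVK.
have e1 : v *m invmx X *m X = v by rewrite mulmxKV.
have e2 : v *m invmx X *m Y = z *: v by rewrite -mulmxA vN.
have v0' : v *m invmx X != 0 by apply: contra v0 => /eqP h; rewrite -e1 h mul0mx.
have [z0|z0] := leP 0 z.
  exists (atan z), (v *m invmx X), ((cos (atan z))^-1 *: v); rewrite e1 e2 sE !scalerA divff // mulfK // scale1r.
  have h := @atan_ltpi2 R z; have := @pi_gt0 R => pi0; split=> //; apply/andP; split; last lra.
  by move: z0; rewrite le_eqVlt => /orP[/eqP<-|]; [rewrite atan0 | move=> /lt_atan; rewrite atan0 => /ltW].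
(* A negative eigenvalue has its arctangent in (-pi/2, 0); the shift by pi brings it into [0, pi) at
   the price of a sign, which r absorbs. *)
exists (atan z + pi), (v *m invmx X), (- (cos (atan z))^-1 *: v).
rewrite cosDpi sinDpi e1 e2 sE !scalerA !mulrNN divff // mulfK // scale1r; split=> //.
have h := @atan_gtNpi2 R z; have := @pi_gt0 R => pi0; apply/andP; split; first lra.
have : atan z < 0 by rewrite -[ltRHS]atan0; exact: lt_atan.
by lra.
Qed.

(** The hypotheses say that X + iY is unitary, and the conclusion is its factorization into real
    orthogonal matrices and a diagonal matrix of phases e^{it}. Each phase can be taken in [0, pi)
    because signs go into the orthogonal factors. One common ray is split off at a time. *)
Lemma simultaneous_diagonalization n (X Y : 'M[R]_n) :
  X *m X^T + Y *m Y^T = 1%:M -> X *m Y^T = Y *m X^T ->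
  exists (U P : 'M[R]_n) (t : 'rV[R]_n),
    [/\ U *m U^T = 1%:M, P *m P^T = 1%:M, forall j, 0 <= t 0 j < pi,
      U *m X *m P^T = diag_mx (map_mx cos t) &
      U *m Y *m P^T = diag_mx (map_mx sin t)].
Proof.
elim: n X Y => [|n IH] X Y.
  move=> _ _; exists 1%:M, 1%:M, 0.
  by split; do ?[by apply/matrixP => -[]]; case.
rewrite -[n.+1]/(1 + n)%N in X Y * => XX XY.
have [t [a [r [t0 a0 aX aY]]]] := @common_ray (1 + n) X Y isT XY.
(* As cos^2 + sin^2 = 1, the vectors a and r have the same norm, so that one factor k normalizes
   both and both extend to orthogonal matrices. *)
have rr : r *m r^T = a *m a^T.
  have := congr1 (fun M => a *m M *m a^T) XX.
  rewrite mulmx1 mulmxDr mulmxDl !mulmxA -!(mulmxA (_ *m _)) -!trmx_mul aX aY !trmxZ.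
  by rewrite -!scalemxAl -!scalemxAr !scalerA -scalerDl -!expr2 cos2Dsin2 scale1r.
have [k k0 kE] : exists2 k : R, k != 0 & (k *: a) *m (k *: a)^T = 1%:M.
  have h := sqr_norm_gt0 a0; exists (Num.sqrt ((a *m a^T) 0 0))^-1.
    by rewrite invr_eq0 gt_eqF // sqrtr_gt0.
  rewrite trmxZ -scalemxAl -scalemxAr scalerA -invfM -expr2 sqr_sqrtr ?ltW //.
  by rewrite {2}[a *m a^T]mx11_scalar scale_scalar_mx mulVf ?gt_eqF.
have [U [UU Ua]] := householder kE.
have [P [PP Pr]] : exists U : 'M[R]_(1 + n), U *m U^T = 1%:M /\ row_mx 1%:M 0 *m U = k *: r.
  by apply: householder; move: kE; rewrite !trmxZ -!scalemxAl -!scalemxAr rr.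
set e : 'rV[R]_(1 + n) := row_mx 1%:M 0 in Ua Pr.
have Pr' : k *: r *m P^T = e by rewrite -Pr -mulmxA PP mulmx1.
have POP (A B : 'M[R]_(1 + n)) : (U *m A *m P^T) *m (U *m B *m P^T)^T = U *m (A *m B^T) *m U^T.
  rewrite !trmx_mul trmxK !mulmxA -(mulmxA _ P^T) (mulmx1C PP) mulmx1.
  by [].
have eX : e *m (U *m X *m P^T) = cos t *: e.
  by rewrite !mulmxA Ua -scalemxAl aX scalerA mulrC -scalerA -scalemxAl Pr'.
have eY : e *m (U *m Y *m P^T) = sin t *: e.
  by rewrite !mulmxA Ua -scalemxAl aY scalerA mulrC -scalerA -scalemxAl Pr'.
have XX1 : (U *m X *m P^T) *m (U *m X *m P^T)^T + (U *m Y *m P^T) *m (U *m Y *m P^T)^T = 1%:M.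
  by rewrite !POP -mulmxDl -mulmxDr XX mulmx1.
have XY1 : (U *m X *m P^T) *m (U *m Y *m P^T)^T = (U *m Y *m P^T) *m (U *m X *m P^T)^T.
  by rewrite !POP XY.
have [X1 EX] : {X1 | X1 = U *m X *m P^T} by eexists.
have [Y1 EY] : {Y1 | Y1 = U *m Y *m P^T} by eexists.
move: eX eY XX1 XY1; rewrite -EX -EY => {POP}.
move: EX EY; rewrite -[X1]submxK -[Y1]submxK.
move: (ulsubmx X1) (ursubmx X1) (dlsubmx X1) (drsubmx X1) => x1 x2 x3 X2.
move: (ulsubmx Y1) (ursubmx Y1) (dlsubmx Y1) (drsubmx Y1) => y1 y2 y3 Y2.
move=> EX EY; rewrite !mul_row_block !mul0mx !mul1mx !addr0 !scale_row_mx.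
rewrite !scaler0 => /eq_row_mx[x1E x2E] /eq_row_mx[y1E y2E] XX1 XY1.
rewrite {}x2E {}y2E !scale_scalar_mx !mulr1 in x1E y1E EX EY XX1 XY1.
rewrite {}x1E {}y1E in EX EY XX1 XY1.
rewrite !tr_block_mx !mulmx_block !trmx0 !mulmx0 !mul0mx !addr0 add_block_mx scalar_mx_block in XX1 XY1.
have [_ _ h1 h2] := eq_block_mx XX1; have [_ _ h3 h4] := eq_block_mx XY1.
rewrite !tr_scalar_mx !mul_mx_scalar in h1 h3.
have c2s2 := cos2Dsin2 t.
(* The entries below the corner solve a homogeneous system whose matrix is a reflection; they vanish
   and leave a block of size n for the induction. *)
have sol (x y : R) : cos t * x + sin t * y = 0 -> sin t * x = cos t * y -> x = 0 /\ y = 0.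
  move=> E1 E2; split.
    transitivity (cos t * (cos t * x + sin t * y) + sin t * (sin t * x - cos t * y)).
      by rewrite -[LHS]mul1r -c2s2; ring.
    by rewrite E1 E2 subrr !mulr0 addr0.
  transitivity (sin t * (cos t * x + sin t * y) - cos t * (sin t * x - cos t * y)).
    by rewrite -[LHS]mul1r -c2s2; ring.
  by rewrite E1 E2 subrr !mulr0 subr0.
have x30 : x3 = 0.
  apply/matrixP => i j; move/matrixP/(_ i j): h1; move/matrixP/(_ i j): h3.
  by rewrite !mxE => E2 E1; have [] := sol _ _ E1 E2.
have y30 : y3 = 0.
  apply/matrixP => i j; move/matrixP/(_ i j): h1; move/matrixP/(_ i j): h3.
  by rewrite !mxE => E2 E1; have [] := sol _ _ E1 E2.
rewrite {}x30 {}y30 !mul0mx !add0r in EX EY h2 h4.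
have [U2 [P2 [t2 [UU2 PP2 t2pi EX2 EY2]]]] := IH _ _ h2 h4.
have blk (V W V' : 'M[R]_n) c : block_mx 1%:M 0 0 V *m block_mx c%:M 0 0 W *m (block_mx 1%:M 0 0 V')^T
   = block_mx (c%:M : 'M[R]_1) 0 0 (V *m W *m V'^T).
  by rewrite tr_block_mx !mulmx_block !(trmx0, trmx1, mulmx0, mul0mx, mulmx1, mul1mx, addr0, add0r).
have blk1 (V : 'M[R]_n) : block_mx 1%:M 0 0 V *m (block_mx 1%:M 0 0 V)^T
   = block_mx (1%:M : 'M[R]_1) 0 0 (V *m V^T).
  by rewrite tr_block_mx !mulmx_block !(trmx0, trmx1, mulmx0, mul0mx, mulmx1, mul1mx, addr0, add0r).
exists (block_mx 1%:M 0 0 U2 *m U), (block_mx 1%:M 0 0 P2 *m P), (row_mx t%:M t2); split.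
- by rewrite trmx_mul mulmxA -(mulmxA _ U) UU mulmx1 blk1 UU2 -scalar_mx_block.
- by rewrite trmx_mul mulmxA -(mulmxA _ P) PP mulmx1 blk1 PP2 -scalar_mx_block.
- by move=> j; rewrite mxE; case: splitP => k' _ //; rewrite ord1 mxE.
- rewrite trmx_mul !mulmxA -(mulmxA _ U X) -(mulmxA _ (U *m X)) -EX blk EX2 map_row_mx diag_mx_row.
  by congr block_mx; apply/matrixP => i j; rewrite !ord1 !mxE.
- rewrite trmx_mul !mulmxA -(mulmxA _ U Y) -(mulmxA _ (U *m Y)) -EY blk EY2 map_row_mx diag_mx_row.
  by congr block_mx; apply/matrixP => i j; rewrite !ord1 !mxE.
Qed.

End Diagonalization.

(** * Lagrangian frames and their angles *)

Section Frames.
Context {R : realType} {n : nat}.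
Local Notation J := (@Jmx R n).

Lemma mulJJ : J *m J = - 1%:M.
Proof.
rewrite /Jmx mulmx_block !(mul0mx, mulmx0, mul1mx, mulmx1, add0r, addr0).
by rewrite -[RHS](submxK _) /ulsubmx /ursubmx /dlsubmx /drsubmx (scalar_mx_block n n) opp_block_mx -/(ulsubmx _) -/(ursubmx _) -/(dlsubmx _) -/(drsubmx _) block_mxKul block_mxKur block_mxKdl block_mxKdr oppr0.
Qed.

Lemma trmxJ : J^T = - J.
Proof.
by rewrite /Jmx tr_block_mx opp_block_mx !trmx0 oppr0 trmx1 opprK linearN /= trmx1.
Qed.

Lemma mulJJT : J *m J^T = 1%:M.
Proof. by rewrite trmxJ mulmxN mulJJ opprK. Qed.

Definition hermitian_form (W : 'M[R]_(n + n)) : Prop :=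
  [/\ W^T = - W, J *m W = W *m J & posdef (W *m J^T)].

Lemma hermitian_formP (W : 'M[R]_(n + n)) :
  (forall v, Defs.form W v v = 0) ->
  (forall v w, Defs.form W (v *m J) (w *m J) = Defs.form W v w) ->
  (forall v, v != 0 -> 0 < metric W v v) -> hermitian_form W.
Proof.
move=> alt WJ pos.
have fE (A : 'M[R]_(n + n)) i j : Defs.form A (delta_mx 0 i) (delta_mx 0 j) = A i j.
  by rewrite /Defs.form -rowE trmx_delta -colE !mxE.
have WT : W^T = - W.
  apply/matrixP => i j; rewrite !mxE -!fE.
  have := alt (delta_mx 0 i + delta_mx 0 j); rewrite /Defs.form trmxD !mulmxDl !mulmxDr.
  rewrite [X in X = _]mxE ![(_ + _ : matrix _ _ _) 0 0]mxE.
  have hi := alt (delta_mx 0 i); have hj := alt (delta_mx 0 j); rewrite /Defs.form in hi hj.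
  by rewrite hi hj add0r addr0 addrC => /eqP; rewrite addr_eq0 => /eqP.
have JWJ : J *m W *m J^T = W.
  apply/matrixP => i j; rewrite -!fE -[in RHS]WJ /Defs.form trmx_mul.
  by rewrite !mulmxA.
split=> //; last first.
  by move=> v /pos; rewrite /metric /Defs.form trmx_mul !mulmxA.
rewrite -{2}JWJ -!mulmxA (_ : J^T *m J = 1%:M) ?mulmx1 //.
by apply: mulmx1C; apply: mulJJT.
Qed.

Definition lagframe (W : 'M[R]_(n + n)) (F : 'M[R]_(n, n + n)) : Prop :=
  row_free F /\ F *m W *m F^T = 0.

(** A Lagrangian subspace V meets JV only in 0: for v in both, the squared norm of v is omega(v, Jv)
    with v and Jv in V. Hence a real basis of V, followed by its image under J, is a basis of
    C^n. *)
Lemma lagframe_unit W F : hermitian_form W -> lagframe W F ->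
  col_mx F (F *m J) \in unitmx.
Proof.
move=> [WT WJ pos] [fF FF]; rewrite -row_free_unit; apply: inj_row_free => v.
rewrite -[v]hsubmxK mul_row_col; move: (lsubmx v) (rsubmx v) => a b E.
have E1 : a *m F *m J = b *m F.
  move/(congr1 (fun M => M *m J)): E; rewrite mul0mx mulmxDl !mulmxA.
  rewrite -[_ *m J *m J]mulmxA mulJJ mulmxN mulmx1 => /eqP.
  by rewrite subr_eq0 => /eqP.
have aF : a *m F = 0.
  apply/eqP; apply: contraT => /pos.
  rewrite (mulmxA _ W) -(mulmxA _ J^T) -trmx_mul E1 trmx_mul !mulmxA.
  by rewrite -(mulmxA a) -(mulmxA a) FF mulmx0 mul0mx mxE ltxx.
have a0 : a = 0 by apply: (row_free_inj fF); rewrite aF mul0mx.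
move: E1; rewrite aF mul0mx => /esym bF.
by rewrite a0 (_ : b = 0) ?row_mx0 //; apply: (row_free_inj fF); rewrite bF mul0mx.
Qed.

(* The rows of G are coord_re F G *m F + i (coord_im F G *m F). *)
Definition coord_re m (F : 'M[R]_(n, n + n)) (G : 'M[R]_(m, n + n)) : 'M[R]_(m, n) :=
  lsubmx (G *m invmx (col_mx F (F *m J))).
Definition coord_im m (F : 'M[R]_(n, n + n)) (G : 'M[R]_(m, n + n)) : 'M[R]_(m, n) :=
  rsubmx (G *m invmx (col_mx F (F *m J))).

Lemma coordE m F (G : 'M[R]_(m, n + n)) : col_mx F (F *m J) \in unitmx ->
  G = coord_re F G *m F + coord_im F G *m F *m J.
Proof. by move=> uF; rewrite -mulmxA -mul_row_col hsubmxK mulmxKV. Qed.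

Lemma coord_uniq m F (A B : 'M[R]_(m, n)) : col_mx F (F *m J) \in unitmx ->
  coord_re F (A *m F + B *m F *m J) = A /\ coord_im F (A *m F + B *m F *m J) = B.
Proof.
move=> uF; rewrite /coord_re /coord_im -mulmxA -mul_row_col mulmxK //.
by rewrite row_mxKl row_mxKr.
Qed.

Lemma coord_mull m p F (A : 'M[R]_(m, p)) (G : 'M[R]_(p, n + n)) :
  coord_re F (A *m G) = A *m coord_re F G /\ coord_im F (A *m G) = A *m coord_im F G.
Proof. by rewrite /coord_re /coord_im -mulmxA mulmx_lsub mulmx_rsub. Qed.

Lemma rotateE (E : 'M[R]_(n, n + n)) alpha t : rotate E alpha t =
  diag_mx (\row_j cos (2 * pi * alpha j * t)) *m E +
  diag_mx (\row_j sin (2 * pi * alpha j * t)) *m E *m J.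
Proof.
apply/row_matrixP => j; rewrite rowK [RHS]linearD /= !row_mul !row_diag_mx.
by rewrite !mxE -!scalemxAl -!rowE.
Qed.

(* A positive definite path from the row space of F to that of G. *)
Definition angles W (F G E : 'M[R]_(n, n + n)) (alpha : 'I_n -> R) : Prop :=
  [/\ exists2 A, A \in unitmx & E = A *m F,
      E *m (W *m J^T) *m E^T = 1%:M,
      forall j, 0 <= alpha j < 2^-1 &
      exists2 B, B \in unitmx & rotate E alpha 1 = B *m G].

Lemma lagframe_mull W F (A : 'M[R]_n) : A \in unitmx -> lagframe W F -> lagframe W (A *m F).
Proof.
move=> uA [fF FF]; split.
  by rewrite /row_free mxrankMfree // -/(row_free A) row_free_unit.
by rewrite trmx_mul !mulmxA -(mulmxA A) -(mulmxA A) FF mulmx0 mul0mx.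
Qed.

Lemma hermitian_sym W : hermitian_form W -> (W *m J^T)^T = W *m J^T.
Proof. by case=> WT WJ _; rewrite trmx_mul trmxK WT mulmxN WJ trmxJ mulmxN. Qed.

Lemma orthonormal_frame W k (F : 'M[R]_(k, n + n)) : hermitian_form W -> row_free F ->
  exists2 A : 'M[R]_k, A \in unitmx & (A *m F) *m (W *m J^T) *m (A *m F)^T = 1%:M.
Proof.
move=> hW fF; have [_ _ pos] := hW.
have [||A uA AE] := @posdef_cholesky _ k (F *m (W *m J^T) *m F^T).
- by rewrite !trmx_mul trmxK -trmx_mul hermitian_sym // !mulmxA.
- exact: posdef_congr.
by exists A => //; rewrite trmx_mul -AE !mulmxA.
Qed.

(** With P the Gram matrix of F, the Hermitian form is (A + iB) P (C + iD)^*; this is the negative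
    of its imaginary part, and [metric_coord] is its real part. *)
Lemma form_coord W F m p (A B : 'M[R]_(m, n)) (C D : 'M[R]_(p, n)) :
  hermitian_form W -> F *m W *m F^T = 0 ->
  (A *m F + B *m F *m J) *m W *m (C *m F + D *m F *m J)^T =
  A *m (F *m (W *m J^T) *m F^T) *m D^T - B *m (F *m (W *m J^T) *m F^T) *m C^T.
Proof.
move=> [WT WJ pos] FF.
have JWJ : J *m W *m J^T = W by rewrite WJ -mulmxA mulJJT mulmx1.
have FF0 (M : 'M[R]_(m, n)) : M *m F *m W *m F^T = 0.
  by rewrite -(mulmxA M) -(mulmxA M) FF mulmx0.
rewrite trmxD !trmx_mul !mulmxDl !mulmxDr !mulmxA.
rewrite -(mulmxA _ J W) -(mulmxA _ (J *m W) J^T) JWJ !FF0 WJ !mul0mx add0r addr0.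
by rewrite trmxJ !(mulmxN, mulNmx) opprK !mulmxA addrC.
Qed.

Lemma metric_coord W F m p (A B : 'M[R]_(m, n)) (C D : 'M[R]_(p, n)) :
  hermitian_form W -> F *m W *m F^T = 0 ->
  (A *m F + B *m F *m J) *m (W *m J^T) *m (C *m F + D *m F *m J)^T =
  A *m (F *m (W *m J^T) *m F^T) *m C^T + B *m (F *m (W *m J^T) *m F^T) *m D^T.
Proof.
move=> hW FF; rewrite mulmxA -(mulmxA _ J^T) -trmx_mul.
have -> : (C *m F + D *m F *m J) *m J = (- D) *m F + C *m F *m J.
  by rewrite mulmxDl -(mulmxA _ J J) mulJJ mulmxN mulmx1 mulNmx addrC.
by rewrite (form_coord _ _ _ _ hW FF) trmxN mulmxN opprK.
Qed.

(** In orthonormal frames the coordinates X + iY of the second Lagrangian relative to the first form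
    a unitary matrix; its phases modulo real orthogonal changes of both frames are the angles. *)
Lemma angles_exist W F G : hermitian_form W -> lagframe W F -> lagframe W G ->
  exists E alpha, angles W F G E alpha.
Proof.
move=> hW lF lG.
have [A uA FF] := orthonormal_frame hW lF.1; have [B uB GG] := orthonormal_frame hW lG.1.
have lF' := lagframe_mull uA lF; have lG' := lagframe_mull uB lG.
have uF := lagframe_unit hW lF'; have GE := coordE (B *m G) uF.
set X := coord_re _ _ in GE; set Y := coord_im _ _ in GE.
have := GG; rewrite GE metric_coord ?lF'.2 // FF !mulmx1 => XX.
have := lG'.2; rewrite GE form_coord ?lF'.2 // FF !mulmx1 => /eqP; rewrite subr_eq0 => /eqP XY.
have [U [P [t [UU PP tpi UX UY]]]] := simultaneous_diagonalization XX XY.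
have uU : U \in unitmx by have [] := mulmx1_unit UU.
have uP : P \in unitmx by have [] := mulmx1_unit PP.
have pi0 := @pi_gt0 R.
(* The range [0, pi) of the phases becomes the range [0, 1/2) required of the angles. *)
exists (P *m (A *m F)), (fun j => t 0 j / (2 * pi)); split.
- by exists (P *m A); rewrite ?mulmxA // unitmx_mul uP.
- move: FF; move: (A *m F) (W *m J^T) => M g FF.
  by rewrite trmx_mul mulmxA -(mulmxA P) -(mulmxA P) FF mulmx1.
- move=> j; have /andP[t0 t1] := tpi j; apply/andP; split.
    by apply: divr_ge0 => //; lra.
  by rewrite ltr_pdivrMr; lra.
- exists (U *m B); first by rewrite unitmx_mul uU.
  rewrite rotateE -[RHS]mulmxA GE mulmxDr !mulmxA.
  have tE (f : R -> R) : diag_mx (\row_j f (2 * pi * (t 0 j / (2 * pi)) * 1)) = diag_mx (map_mx f t).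
    congr diag_mx; apply/rowP => j; rewrite !mxE mulr1 mulrC mulfVK ?mulf_neq0 ?gt_eqF //.
  rewrite !tE -UX -UY -!mulmxA !(mulmxA P^T) (mulmx1C PP) !mul1mx.
  by rewrite !mulmxA.
Qed.

(* In a frame adapted to the angles this form is diagonal, with the entries
   sin (2 pi alpha_j - a) sin (b - 2 pi alpha_j): its positive directions count
   the angles between a and b modulo pi. *)
Definition window_form W F G (a b : R) : 'M[R]_n :=
  (cos a *: coord_im F G - sin a *: coord_re F G) *m (F *m (W *m J^T) *m F^T) *m
  (sin b *: coord_re F G - cos b *: coord_im F G)^T.

Definition window (alpha : 'I_n -> R) (a b : R) : pred 'I_n :=
  [pred j | 0 < sin (2 * pi * alpha j - a) * sin (b - 2 * pi * alpha j)].

Lemma congr_mulmx p q r (A : 'M[R]_(p, q)) (B : 'M[R]_(q, r)) (M : 'M[R]_r) :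
  (A *m B) *m M *m (A *m B)^T = A *m (B *m M *m B^T) *m A^T.
Proof. by rewrite trmx_mul !mulmxA. Qed.

Lemma posdef_diag m (d : 'rV[R]_m) : (forall j, 0 < d 0 j) -> posdef (diag_mx d).
Proof.
move=> dpos v /rV0Pn[k vk]; rewrite mul_trE (bigD1 k) //= mul_mx_diag mxE.
apply: ltr_pwDl; first by rewrite mulrAC -expr2 mulr_gt0 // exprn_even_gt0.
apply: sumr_ge0 => j _; rewrite mxE mulrAC -expr2 mulr_ge0 ?sqr_ge0 //.
exact: ltW.
Qed.

Lemma rowsub_diag m (f : 'I_m -> 'I_n) (d : 'rV[R]_n) : injective f ->
  rowsub f 1%:M *m diag_mx d *m (rowsub f 1%:M)^T = diag_mx (\row_k d 0 (f k)).
Proof.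
move=> fI; rewrite -rowsubE; apply/matrixP => i j.
rewrite mxE (bigD1 (f i)) //= big1 ?addr0; last first.
  by move=> k ki; rewrite !mxE eq_sym (negPf ki) mulr0n mul0r.
by rewrite !mxE eqxx mulr1n [f j == _]eq_sym (inj_eq fI) mulr_natr.
Qed.

Lemma rank_diag (d : 'rV[R]_n) :
  (\rank (diag_mx d) + #|[pred j | d 0%R j == 0%R]| = n)%N.
Proof.
set S := [pred j | d 0 j != 0].
have nE : (#|S| + #|[pred j | d 0%R j == 0%R]| = n)%N.
  rewrite addnC -[RHS](card_ord n) -(cardC [pred j | d 0%R j == 0%R]); congr (_ + _)%N.
apply: etrans nE; congr (_ + _)%N; apply/eqP; rewrite eqn_leq.
set f := fun k : 'I_#|S| => enum_val k.
set S1 : 'M[R]_(_, n) := rowsub f 1%:M.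
have D1 := rowsub_diag d (@enum_val_inj _ S).
apply/andP; split.
  have -> : diag_mx d = S1^T *m (S1 *m diag_mx d).
    rewrite mulmxA; apply/matrixP => i j; rewrite mul_mx_diag !mxE.
    have [<-|ij] := eqVneq i j; rewrite ?mulr1n ?mulr0n.
      have [->|di] := eqVneq (d 0 i) 0; first by rewrite mulr0.
      have iS : i \in S by rewrite inE.
      rewrite (bigD1 (enum_rank_in iS i)) //= big1 => [|k ki]; rewrite !mxE.
        by rewrite /f enum_rankK_in // eqxx mulr1 addr0 mul1r.
      case: eqP => [fk|]; last by rewrite mul0r.
      by case/eqP: ki; apply: enum_val_inj; rewrite enum_rankK_in.
    rewrite big1 ?mul0r // => k _; rewrite !mxE.
    by have [->|] := eqVneq (f k) i; rewrite ?(negPf ij) ?mulr0 ?mul0r.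
  by apply: leq_trans (mxrankM_maxr _ _) _; apply: rank_leq_row.
rewrite -[X in (X <= _)%N](_ : \rank (S1 *m diag_mx d *m S1^T) = _).
  by apply: leq_trans (mxrankM_maxl _ _) _; apply: mxrankM_maxr.
rewrite D1; apply: mxrank_unit; rewrite unitmxE det_diag unitfE.
by apply/prodf_neq0 => k _; rewrite mxE; have := enum_valP k; rewrite inE.
Qed.

(** With more rows than positive entries, some nonzero combination of the rows would vanish in all
    the positive columns, and the form would not be positive on it. *)
Lemma posdef_diag_le m (D : 'rV[R]_n) (C : 'M[R]_(m, n)) :
  posdef (C *m diag_mx D *m C^T) -> (m <= #|[pred j | (0 < D 0%R j)%R]|)%N.
Proof.
move=> pos; set S := [pred j | _]; rewrite leqNgt; apply/negP => lt.
set C' := colsub (fun k : 'I_#|S| => enum_val k) C.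
have : kermx C' != 0.
  rewrite -mxrank_eq0 mxrank_ker subn_eq0 -ltnNge.
  by apply: leq_ltn_trans lt; apply: rank_leq_col.
case/rowV0Pn => c /sub_kermxP cC' c0.
have := pos c c0; rewrite !mulmxA -(mulmxA _ C^T) -trmx_mul.
have : forall j, 0 < D 0 j -> (c *m C) 0 j = 0.
  move=> j Dj; have jS : j \in S by rewrite inE.
  move/rowP/(_ (enum_rank_in jS j)): cC'; rewrite !mxE => h.
  by rewrite -[RHS]h; apply: eq_bigr => k _; rewrite mxE enum_rankK_in.
move: (c *m C) => d dD; rewrite ltNge => /negP; apply.
rewrite mul_trE; apply: sumr_le0 => j _; rewrite mul_mx_diag mxE.
have [/dD ->|Dj] := ltP 0 (D 0 j); first by rewrite mul0r mulr0.
by rewrite mulrAC -expr2; apply: mulr_ge0_le0 => //; apply: sqr_ge0.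
Qed.

Lemma angles_coord W F G E alpha : hermitian_form W -> lagframe W F ->
  angles W F G E alpha -> exists A B,
  [/\ B \in unitmx, A *m (F *m (W *m J^T) *m F^T) *m A^T = 1%:M,
      B *m coord_re F G = diag_mx (\row_j cos (2 * pi * alpha j)) *m A,
      B *m coord_im F G = diag_mx (\row_j sin (2 * pi * alpha j)) *m A &
      rotate E alpha 1 = B *m G].
Proof.
move=> hW lF [[A uA EA] EE _ [B uB EB]]; have uF := lagframe_unit hW lF.
exists A, B; split=> //.
- by rewrite -EE EA trmx_mul !mulmxA.
- rewrite -(coord_mull F B G).1 -EB rotateE EA !mulmxA.
  rewrite (coord_uniq _ _ uF).1; congr (diag_mx _ *m _).
  by apply/rowP => j; rewrite !mxE mulr1.
- rewrite -(coord_mull F B G).2 -EB rotateE EA !mulmxA.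
  rewrite (coord_uniq _ _ uF).2; congr (diag_mx _ *m _).
  by apply/rowP => j; rewrite !mxE mulr1.
Qed.

Lemma window_form_diag W F G E alpha a b : hermitian_form W -> lagframe W F ->
  angles W F G E alpha -> exists2 B, B \in unitmx &
  B *m window_form W F G a b *m B^T =
  diag_mx (\row_j (sin (2 * pi * alpha j - a) * sin (b - 2 * pi * alpha j))).
Proof.
move=> hW lF /(angles_coord hW lF)[A [B [uB AA EX EY _]]]; exists B => //.
rewrite /window_form; move: AA; move: (F *m _ *m _) => P AA.
rewrite !mulmxA -(mulmxA _ _^T) -trmx_mul !(mulmxDr B) !mulmxN -!scalemxAr EX EY.
rewrite !scalemxAl -!mulmxBl trmx_mul !mulmxA -(mulmxA _ A) -(mulmxA _ (A *m P)) AA mulmx1.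
apply/matrixP => i j; rewrite !mxE (bigD1 i) //= big1 ?addr0; last first.
  by move=> k ki; rewrite !mxE eq_sym (negPf ki) !mulr0n !mulr0 subrr mul0r.
rewrite !mxE eqxx !mulr1n [in i == j]eq_sym; case: eqP => [->|_]; last first.
  by rewrite !mulr0n !mulr0 subrr mulr0.
by rewrite !mulr1n !sinB; ring.
Qed.

(** Together with [window_attained] this is the law of inertia: the number of angles in a window is
    the largest dimension of a subspace on which [window_form] is positive definite. The form does
    not mention the angles, so the count is a property of the two Lagrangians. *)
Lemma window_le W F G E alpha a b m (K : 'M[R]_(m, n)) :
  hermitian_form W -> lagframe W F -> angles W F G E alpha ->
  posdef (K *m window_form W F G a b *m K^T) -> (m <= #|window alpha a b|)%N.
Proof.
move=> hW lF ang; have [B uB EB] := window_form_diag a b hW lF ang.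
have -> : K *m window_form W F G a b *m K^T =
   K *m invmx B *m (B *m window_form W F G a b *m B^T) *m (K *m invmx B)^T.
  rewrite trmx_mul !mulmxA mulmxKV // -(mulmxA _ B^T) -trmx_mul mulVmx // trmx1.
  by rewrite mulmx1.
rewrite EB => /posdef_diag_le; rewrite /window.
by congr (_ <= _)%N; apply: eq_card => j; rewrite !inE mxE.
Qed.

Lemma window_attained W F G E alpha a b :
  hermitian_form W -> lagframe W F -> angles W F G E alpha ->
  exists K : 'M[R]_(#|window alpha a b|, n), posdef (K *m window_form W F G a b *m K^T).
Proof.
move=> hW lF ang; have [B uB EB] := window_form_diag a b hW lF ang.
exists (rowsub (fun k : 'I_#|window alpha a b| => enum_val k) B) => v v0.
move: v v0; rewrite rowsubE congr_mulmx EB rowsub_diag; last exact: enum_val_inj.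
by apply: posdef_diag => k; rewrite !mxE; apply: (enum_valP k).
Qed.

(** Up to a change of basis the imaginary part of the coordinates is the diagonal matrix of the
    sin(2 pi alpha_j), and since 2 pi alpha_j < pi its zeros are the zero angles. The corank of the
    imaginary part is the dimension of the intersection. *)
Lemma rank_angles W F G E alpha : hermitian_form W -> lagframe W F ->
  row_free G -> angles W F G E alpha ->
  \rank (F :&: G)%MS = #|[pred j | alpha j == 0%R]| /\
  (\rank (coord_im F G) + #|[pred j | alpha j == 0%R]| = n)%N.
Proof.
move=> hW lF fG ang; have uF := lagframe_unit hW lF.
have rY : (\rank (coord_im F G) + #|[pred j | alpha j == 0%R]| = n)%N.
  have [A [B [uB AA _ EY _]]] := angles_coord hW lF ang; have [_ _ al _] := ang.
  have uA : A \in unitmx by rewrite -mulmxA in AA; have [] := mulmx1_unit AA.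
  have <- : \rank (B *m coord_im F G) = \rank (coord_im F G).
    by rewrite (eqmxMfull _ (_ : row_full B)) // row_full_unit.
  rewrite EY mxrankMfree ?row_free_unit // -[RHS](rank_diag (\row_j sin (2 * pi * alpha j))).
  congr (_ + _)%N; apply: eq_card => j; rewrite !inE mxE.
  have /andP[a0 a1] := al j; have pi0 := @pi_gt0 R.
  have [->|an0] := eqVneq (alpha j) 0; first by rewrite mulr0 sin0 eqxx.
  apply/esym/negbTE; rewrite gt_eqF // sin_gt0_pi //.
  have a0' : 0 < alpha j by rewrite lt_def an0.
  by apply/andP; split; nra.
split=> //; apply/eqP; rewrite -(eqn_add2l (\rank (F + G)%MS)) mxrank_sum_cap.
rewrite (eqP lF.1) (eqP fG) addsmxE.
(* Elimination in the basis formed by F and its image under J: the sum of the two row spaces has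
   dimension n plus the rank of the imaginary part. *)
have -> : col_mx F G = block_mx 1%:M 0 (coord_re F G) 1%:M *m
    (block_mx 1%:M 0 0 (coord_im F G) *m col_mx F (F *m J)).
  rewrite !mul_block_col !(mul0mx, mul1mx, addr0, add0r); congr col_mx.
  by rewrite {1}(coordE G uF) mulmxA.
rewrite eqmxMfull; last by rewrite row_full_unit unitmxE det_lblock !det1 mulr1 unitr1.
rewrite mxrankMfree ?row_free_unit // rank_diag_block_mx mxrank1 -addnA rY.
by [].
Qed.

End Frames.

(** * Phases *)

Section ComplexVolume.
Context {R : realType} {n : nat}.
Local Notation J := (@Jmx R n).

Lemma expiD (a b : R) : expi (a + b) = expi a * expi b.
Proof. by rewrite /expi cosD sinD; apply/eqP; rewrite eq_complex /=; apply/andP; split; apply/eqP; ring. Qed.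

Lemma expi0 : expi (0 : R) = 1.
Proof. by rewrite /expi cos0 sin0. Qed.

Lemma expi_neq0 (a : R) : expi a != 0.
Proof.
apply/eqP => /(congr1 (fun z => complex.Re z ^+ 2 + complex.Im z ^+ 2)) /=.
by rewrite cos2Dsin2 expr0n addr0 => /eqP; rewrite oner_eq0.
Qed.

Lemma polar (z : R[i]) : z != 0 -> exists r psi : R, 0 < r /\ z = r%:C%C * expi psi.
Proof.
case: z => x y; rewrite eq_complex /= negb_and => xy0.
have h : 0 < x ^+ 2 + y ^+ 2.
  by case/orP: xy0 => ?; [apply: ltr_pwDl|apply: ltr_pwDr]; rewrite ?sqr_ge0 // exprn_even_gt0.
set r := Num.sqrt (x ^+ 2 + y ^+ 2).
have r0 : 0 < r by rewrite sqrtr_gt0.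
have r2 : r ^+ 2 = x ^+ 2 + y ^+ 2 by rewrite sqr_sqrtr // ltW.
have xr : -1 <= x / r <= 1.
  by rewrite ler_pdivlMr // ler_pdivrMr // mulN1r mul1r; apply/andP; split; nra.
have sE : Num.sqrt (1 - (x / r) ^+ 2) = `|y| / r.
  have -> : 1 - (x / r) ^+ 2 = (y / r) ^+ 2.
    have -> : y ^+ 2 = r ^+ 2 - x ^+ 2 -> 1 - (x / r) ^+ 2 = (y / r) ^+ 2.
      by move=> yE; rewrite !expr_div_n yE mulrBl divff // expf_neq0 // gt_eqF.
    by [].
    by rewrite r2 addrC addKr.
  by rewrite sqrtr_sqr normrM normfV (gtr0_norm r0).
have [y0|y0] := leP 0 y.
  exists r, (acos (x / r)); split=> //; rewrite /expi acosK // sin_acos // sE ger0_norm //.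
  by apply/eqP; rewrite eq_complex /=; apply/andP; split; apply/eqP; field; rewrite gt_eqF.
exists r, (- acos (x / r)); split=> //; rewrite /expi cosN sinN acosK // sin_acos // sE ltr0_norm //.
by apply/eqP; rewrite eq_complex /=; apply/andP; split; apply/eqP; field; rewrite gt_eqF.
Qed.

Lemma expi2pi (k : int) : expi (2 * pi * k%:~R) = 1 :> R[i].
Proof.
have pos (m : nat) : expi (2 * pi * m%:R) = 1 :> R[i].
  elim: m => [|m IH]; first by rewrite mulr0 expi0.
  rewrite -[m.+1%:R]natr1 mulrDr mulr1 expiD IH mul1r mulr_natl /expi.
  by rewrite cos2pi sin2pi.
case: k => m; first exact: pos.
rewrite NegzE mulrNz mulrN -[LHS]mulr1 -[X in _ * X](pos m.+1) -expiD.
by rewrite addNr expi0.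
Qed.

Lemma expi_eq1 (a : R) : expi a = 1 -> exists k : int, a = 2 * pi * k%:~R.
Proof.
move=> ea; have pi0 := @pi_gt0 R; pose k := Num.floor (a / (2 * pi)).
exists k; set b := a - 2 * pi * k%:~R.
have eb : expi b = 1.
  by rewrite -(expi2pi (- k)) -[RHS]mul1r -ea -expiD mulrNz mulrN.
have bE : b = 2 * pi * (a / (2 * pi) - k%:~R).
  by rewrite /b mulrBr [_ * (a / _)]mulrC divfK // mulf_neq0 // gt_eqF.
have b0 : 0 <= b.
  rewrite bE; apply: mulr_ge0; first lra.
  by rewrite subr_ge0 Num.Theory.floor_le.
have b1 : b < 2 * pi.
  rewrite bE -[ltRHS]mulr1 ltr_pM2l ?mulr_gt0 // ltrBlDr addrC.
  by rewrite -intrD1 Num.Theory.floorD1_gt.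
(* Half angles: cos b = 1 forces sin(b/2) = 0, and b/2 lies in [0, pi). *)
have : cos (b / 2 + b / 2) = 1 by move/(congr1 (@complex.Re R)): eb => /=; rewrite -splitr.
rewrite cosD => c1; have := cos2Dsin2 (b / 2) => c2.
have s0 : sin (b / 2) ^+ 2 = 0 by nra.
have {s0}s0 : sin (b / 2) = 0 by apply/eqP; rewrite -sqrf_eq0 s0.
apply/eqP; rewrite -subr_eq0 -/b; apply: contraT => bn0.
have : 0 < sin (b / 2).
  have bp : 0 < b by rewrite lt_def bn0.
  by apply: sin_gt0_pi; apply/andP; split; lra.
by rewrite s0 ltxx.
Qed.

Lemma expi_inj (a b : R) : expi a = expi b -> exists k : int, a = b + 2 * pi * k%:~R.
Proof.
move=> ab; have [|k kE] := @expi_eq1 (a - b); last by exists k; rewrite -kE addrC subrK.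
by apply: (mulIf (expi_neq0 b)); rewrite -expiD subrK ab mul1r.
Qed.

Lemma cplx_mxD k (F G : 'M[R]_(k, n + n)) : cplx_mx (F + G) = cplx_mx F + cplx_mx G.
Proof. by apply/matrixP => i j; rewrite !mxE. Qed.

Lemma ReS (I : finType) (F : I -> R[i]) : complex.Re (\sum_k F k) = \sum_k complex.Re (F k).
Proof. by apply: (big_morph (@complex.Re R)) => // -[? ?] []. Qed.

Lemma ImS (I : finType) (F : I -> R[i]) : complex.Im (\sum_k F k) = \sum_k complex.Im (F k).
Proof. by apply: (big_morph (@complex.Im R)) => // -[? ?] []. Qed.

Lemma cplx_mx_mull k m (A : 'M[R]_(k, m)) (F : 'M[R]_(m, n + n)) :
  cplx_mx (A *m F) = map_mx (real_complex R) A *m cplx_mx F.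
Proof.
apply/matrixP => i j; rewrite !mxE; apply/eqP; rewrite eq_complex /= ReS ImS.
by apply/andP; split; apply/eqP; apply: eq_bigr => l _; rewrite !mxE /= mul0r ?subr0 ?addr0.
Qed.

Lemma cplx_mxJ k (F : 'M[R]_(k, n + n)) : cplx_mx (F *m J) = 'i%C *: cplx_mx F.
Proof.
rewrite -[F]hsubmxK /Jmx mul_row_block !mulmx0 mulmx1 mulmxN mulmx1 add0r addr0.
move: (lsubmx F) (rsubmx F) => X Y.
apply/matrixP => i j; rewrite [LHS]mxE [RHS]mxE [cplx_mx (row_mx X _) i j]mxE.
rewrite !row_mxEl !row_mxEr mxE.
by apply/eqP; rewrite eq_complex /= !mul0r !mul1r sub0r add0r !eqxx.
Qed.

(** A matrix that commutes with J is determined by its upper half, whose rows are the images of the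
    n complex basis vectors; this is its complex determinant. *)
Definition detC (P : 'M[R]_(n + n)) : R[i] := \det (cplx_mx (usubmx P)).

Lemma cplx_mx_mulr k (F : 'M[R]_(k, n + n)) P : J *m P = P *m J ->
  cplx_mx (F *m P) = cplx_mx F *m cplx_mx (usubmx P).
Proof.
move=> PJ; pose e : 'M[R]_(n, n + n) := row_mx 1%:M 0.
have FE : F = lsubmx F *m e + rsubmx F *m e *m J.
  rewrite -{1}[F]hsubmxK /e /Jmx !mul_mx_row !mulmx1 !mulmx0 mul_row_block.
  by rewrite !(mulmx0, mul0mx, mulmx1, addr0, add_row_mx, add0r).
have eP : e *m P = usubmx P by rewrite -{1}[P]vsubmxK /e mul_row_col mul1mx mul0mx addr0.
have e1 : cplx_mx e = 1%:M.
  apply/matrixP => i j; rewrite [LHS]mxE row_mxEl row_mxEr !mxE.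
  by case: eqP.
rewrite {1}FE mulmxDl -!mulmxA PJ !mulmxA -(mulmxA _ e P) -(mulmxA _ e P) eP.
rewrite cplx_mxD cplx_mxJ !cplx_mx_mull [in RHS]FE cplx_mxD cplx_mxJ !cplx_mx_mull e1.
by rewrite !mulmx1 mulmxDl scalemxAl.
Qed.

Lemma detCM P Q : J *m Q = Q *m J -> detC (P *m Q) = detC P * detC Q.
Proof.
by move=> QJ; rewrite /detC -det_mulmx -cplx_mx_mulr // -{1}[P]vsubmxK mul_col_mx col_mxKu.
Qed.

Lemma detC1 : detC 1%:M = 1.
Proof.
rewrite /detC (_ : cplx_mx _ = 1%:M) ?det1 //; apply/matrixP => i j.
by rewrite !mxE /= !eq_shift; case: eqP.
Qed.

(** A Lagrangian subspace is totally real, so a real basis of it is a complex basis of C^n. *)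
Lemma det_cplx_neq0 W (F : 'M[R]_(n, n + n)) : hermitian_form W -> lagframe W F ->
  \det (cplx_mx F) != 0.
Proof.
move=> hW lF; have uF := lagframe_unit hW lF.
rewrite -unitfE -unitmxE -row_free_unit; apply: inj_row_free => c cF.
pose a := map_mx (@complex.Re R) c; pose b := map_mx (@complex.Im R) c.
have cE : c = map_mx (real_complex R) a + 'i%C *: map_mx (real_complex R) b.
  apply/matrixP => i j; rewrite !mxE; case: (c i j) => x y.
  by apply/eqP; rewrite eq_complex /=; apply/andP; split; apply/eqP; ring.
have : cplx_mx (a *m F + b *m (F *m J)) = 0.
  by rewrite cplx_mxD (cplx_mx_mull a) (cplx_mx_mull b) cplx_mxJ -cF [in RHS]cE mulmxDl -scalemxAl scalemxAr.
have inj k (G : 'M[R]_(k, n + n)) : cplx_mx G = 0 -> G = 0.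
  move=> G0; apply/matrixP => i j; rewrite -[j]splitK mxE.
  by case: (fintype.split j) => l /=; move/matrixP/(_ i l): G0; rewrite !mxE => -[].
move/inj; rewrite -mul_row_col => /(congr1 (mulmx^~ (invmx (col_mx F (F *m J))))).
rewrite mulmxK // mul0mx -row_mx0 => /eq_row_mx[a0 b0].
by rewrite cE a0 b0 !map_mx0 scaler0 addr0.
Qed.

Lemma det_rotate (E : 'M[R]_(n, n + n)) (alpha : 'I_n -> R) t :
  \det (cplx_mx (rotate E alpha t)) =
  expi (2 * pi * (\sum_j alpha j) * t) * \det (cplx_mx E).
Proof.
have -> : cplx_mx (rotate E alpha t) =
    diag_mx (\row_j expi (2 * pi * alpha j * t)) *m cplx_mx E.
  rewrite rotateE cplx_mxD cplx_mxJ !(cplx_mx_mull (diag_mx _)) scalemxAl -mulmxDl; congr (_ *m _).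
  apply/matrixP => i j; rewrite !mxE; case: eqP => _; rewrite ?mulr1n ?mulr0n //.
    by apply/eqP; rewrite eq_complex /=; apply/andP; split; apply/eqP; ring.
  by rewrite mulr0 addr0.
rewrite det_mulmx det_diag; congr (_ * _).
rewrite mulr_sumr mulr_suml (eq_bigr (fun j => expi (2 * pi * alpha j * t))); last first.
  by move=> j _; rewrite mxE.
by apply/esym/(big_morph (@expi R)); [exact: expiD | exact: expi0].
Qed.

(** The vanishing imaginary part forces psi and [vartheta] to agree modulo pi, and doubling removes
    the ambiguity. One frame of nonzero volume thus determines the value of [Det2]. *)
Lemma Det2_polar vol (V : {vspace 'rV[R]_(n + n)}) z F r psi :
  Det2 vol V z -> (forall i, row i F \in V) -> vol F = r%:C%C * expi psi -> 0 < r ->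
  z = expi (2 * psi).
Proof.
move=> [th [-> h]] FV volE r0; have := h F FV; rewrite volE mulrCA -expiD.
rewrite /= mul0r addr0 => /eqP; rewrite mulf_eq0 gt_eqF //= => /eqP s0.
have -> : 2 * psi = 2 * th + 2 * (- th + psi) by ring.
rewrite expiD (_ : expi (2 * (- th + psi)) = 1) ?mulr1 //.
have := cos2Dsin2 (- th + psi); move: (- th + psi) s0 => x s0.
rewrite s0 expr0n addr0 mulr_natl mulr2n /expi cosD sinD s0 -expr2 => ->.
by rewrite !mul0r mulr0 subr0 addr0.
Qed.

Lemma vspace_ofP k (P : 'rV[R]_k -> Prop) :
  (exists V : {vspace 'rV[R]_k}, forall v, v \in V <-> P v) ->
  forall v, v \in vspace_of P <-> P v.
Proof.
move=> [V hV]; rewrite /vspace_of; set S := [set _ | _].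
by have : S (xget 0%VS S) by apply: xgetPex; exists V.
Qed.

Lemma mem_rowspace k (F : 'M[R]_(k, n + n)) v : (v \in rowspace F) = (v <= F)%MS.
Proof.
have : v \in rowspace F <-> (v <= F)%MS; last by move=> h; apply/idP/idP => /h.
apply: (vspace_ofP (P := fun v => (v <= F)%MS)).
exists (limg (linfun (mulmxr F : 'rV_k -> 'rV_(n + n)))) => w; split.
  by move=> /memv_imgP[u _ ->]; rewrite lfunE /= submxMl.
by move=> /submxP[u ->]; apply/memv_imgP; exists u; rewrite ?memvf // lfunE.
Qed.

(** Integrality of the defect D: the rotation from the first Lagrangian to the second multiplies the
    volume of the frame by e^{2 pi i s}, with s the sum of the angles, and [Det2] sees the square of
    this factor. *)
Lemma angles_phase W (a : R[i]) (F G E : 'M[R]_(n, n + n)) alpha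
    (V0 V1 : {vspace 'rV[R]_(n + n)}) (theta0 theta1 : R) :
  hermitian_form W -> a != 0 -> lagframe W F -> angles W F G E alpha ->
  (forall i, row i F \in V0) -> (forall i, row i G \in V1) ->
  Det2 (nform a) V0 (expi (2 * pi * theta0)) ->
  Det2 (nform a) V1 (expi (2 * pi * theta1)) ->
  exists k : int, theta1 - theta0 - 2 * (\sum_j alpha j) = k%:~R.
Proof.
move=> hW a0 lF ang FV GV D0 D1; have [[A uA EA] _ _ [B uB EB]] := ang.
have rowM (V : {vspace 'rV[R]_(n + n)}) (M : 'M[R]_n) (H : 'M[R]_(n, n + n)) :
    (forall i, row i H \in V) -> forall i, row i (M *m H) \in V.
  by move=> HV i; rewrite row_mul mulmx_sum_row memv_suml // => j _; rewrite memvZ.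
have EV : forall i, row i E \in V0 by rewrite EA; apply: rowM.
have RV : forall i, row i (rotate E alpha 1) \in V1 by rewrite EB; apply: rowM.
have lE : lagframe W E by rewrite EA; apply: lagframe_mull.
have [r [psi [r0 vE]]] : exists r psi, 0 < r /\ nform a E = r%:C%C * expi psi.
  by apply: polar; rewrite mulf_neq0 // (det_cplx_neq0 hW lE).
have vR : nform a (rotate E alpha 1) = r%:C%C * expi (psi + 2 * pi * (\sum_j alpha j)).
  by rewrite /nform det_rotate mulrCA -/(nform a E) vE mulr1 mulrCA expiD; congr (_ * _); rewrite mulrC.
have /expi_inj[k kE] := Det2_polar D0 EV vE r0.
have /expi_inj[l lE'] := Det2_polar D1 RV vR r0.
exists (l - k); rewrite intrB; apply: (mulfI (_ : 2 * pi != 0 :> R)).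
  by rewrite mulf_neq0 // gt_eqF // pi_gt0.
by rewrite !mulrBr kE lE'; ring.
Qed.

End ComplexVolume.

(** * Continuity of the angles *)

Section MatrixConvergence.
Context {R : realType} {T : Type} {Fi : set_system T} {FF : Filter Fi}.

(** Convergence is taken entrywise along an arbitrary filter, so that neighbourhoods, their traces
    on a subset and punctured neighbourhoods are treated alike. *)
Definition mxcvg m p (M : T -> 'M[R]_(m, p)) (M0 : 'M[R]_(m, p)) : Prop :=
  forall i j, (fun y => M y i j) @ Fi --> M0 i j.

Lemma cvg_bigsum (I : Type) (r : seq I) (P : pred I) (f : I -> T -> R) (l : I -> R) :
  (forall i, P i -> f i @ Fi --> l i) ->
  (fun y => \sum_(i <- r | P i) f i y) @ Fi --> \sum_(i <- r | P i) l i.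
Proof.
move=> h; elim: r => [|i r IH].
  by rewrite big_nil (_ : (fun=> _) = fun=> 0); [exact: cvg_cst|apply/funext => y; rewrite big_nil].
rewrite big_cons (_ : (fun=> _) = fun y => if P i then f i y + \sum_(j <- r | P j) f j y
  else \sum_(j <- r | P j) f j y); last by apply/funext => y; rewrite big_cons.
by case: ifP => // /h ?; apply: cvgD.
Qed.

Lemma cvg_bigprod (I : Type) (r : seq I) (P : pred I) (f : I -> T -> R) (l : I -> R) :
  (forall i, P i -> f i @ Fi --> l i) ->
  (fun y => \prod_(i <- r | P i) f i y) @ Fi --> \prod_(i <- r | P i) l i.
Proof.
move=> h; elim: r => [|i r IH].
  by rewrite big_nil (_ : (fun=> _) = fun=> 1); [exact: cvg_cst|apply/funext => y; rewrite big_nil].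
rewrite big_cons (_ : (fun=> _) = fun y => if P i then f i y * \prod_(j <- r | P j) f j y
  else \prod_(j <- r | P j) f j y); last by apply/funext => y; rewrite big_cons.
by case: ifP => // /h ?; apply: cvgM.
Qed.

Lemma cvg_near_eq (f g : T -> R) (l : R) : (\forall y \near Fi, f y = g y) ->
  f @ Fi --> l -> g @ Fi --> l.
Proof.
move=> fg fl; apply: cvg_trans fl; apply: near_eq_cvg.
exact: fg.
Qed.

Lemma mxcvg_near m p (M N : T -> 'M[R]_(m, p)) M0 :
  (\forall y \near Fi, M y = N y) -> mxcvg M M0 -> mxcvg N M0.
Proof.
move=> MN MM i j; apply: cvg_near_eq (MM i j).
by apply: filterS MN => y ->.
Qed.

Lemma mxcvg_cst m p (M : 'M[R]_(m, p)) : mxcvg (fun=> M) M.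
Proof. by move=> i j; apply: cvg_cst. Qed.

Lemma mxcvgD m p (M N : T -> 'M[R]_(m, p)) M0 N0 :
  mxcvg M M0 -> mxcvg N N0 -> mxcvg (fun y => M y + N y) (M0 + N0).
Proof.
move=> hM hN i j; rewrite mxE (_ : (fun=> _) = fun y => M y i j + N y i j).
  exact: cvgD (hM i j) (hN i j).
by apply/funext => y; rewrite mxE.
Qed.

Lemma mxcvgZ m p (a : T -> R) (a0 : R) (M : T -> 'M[R]_(m, p)) M0 :
  a @ Fi --> a0 -> mxcvg M M0 -> mxcvg (fun y => a y *: M y) (a0 *: M0).
Proof.
move=> ha hM i j; rewrite mxE (_ : (fun=> _) = fun y => a y * M y i j).
  exact: cvgM ha (hM i j).
by apply/funext => y; rewrite mxE.
Qed.

Lemma mxcvgN m p (M : T -> 'M[R]_(m, p)) M0 :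
  mxcvg M M0 -> mxcvg (fun y => - M y) (- M0).
Proof.
move=> hM i j; rewrite mxE (_ : (fun=> _) = fun y => - M y i j).
  exact: cvgN (hM i j).
by apply/funext => y; rewrite mxE.
Qed.

Lemma mxcvgM m p q (M : T -> 'M[R]_(m, p)) (N : T -> 'M[R]_(p, q)) M0 N0 :
  mxcvg M M0 -> mxcvg N N0 -> mxcvg (fun y => M y *m N y) (M0 *m N0).
Proof.
move=> hM hN i j; rewrite mxE (_ : (fun=> _) = fun y => \sum_k M y i k * N y k j).
  by apply: cvg_bigsum => k _; apply: cvgM (hM i k) (hN k j).
by apply/funext => y; rewrite mxE.
Qed.

Lemma mxcvg_tr m p (M : T -> 'M[R]_(m, p)) M0 :
  mxcvg M M0 -> mxcvg (fun y => (M y)^T) M0^T.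
Proof.
move=> hM i j; rewrite mxE (_ : (fun=> _) = fun y => M y j i); first exact: hM.
by apply/funext => y; rewrite mxE.
Qed.

Lemma mxcvg_col_mx m p q (M : T -> 'M[R]_(m, p)) (N : T -> 'M[R]_(q, p)) M0 N0 :
  mxcvg M M0 -> mxcvg N N0 -> mxcvg (fun y => col_mx (M y) (N y)) (col_mx M0 N0).
Proof.
move=> hM hN i j; rewrite -(splitK i); case: (fintype.split i) => k /=.
  rewrite col_mxEu (_ : (fun=> _) = fun y => M y k j); first exact: hM.
  by apply/funext => y; rewrite col_mxEu.
rewrite col_mxEd (_ : (fun=> _) = fun y => N y k j); first exact: hN.
by apply/funext => y; rewrite col_mxEd.
Qed.

Lemma cvg_det m (M : T -> 'M[R]_m) M0 : mxcvg M M0 ->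
  (fun y => \det (M y)) @ Fi --> \det M0.
Proof.
move=> hM; apply: cvg_bigsum => s _; apply: cvgM; first exact: cvg_cst.
by apply: cvg_bigprod => i _; apply: hM.
Qed.

Lemma mxcvg_inv m (M : T -> 'M[R]_m) M0 : M0 \in unitmx -> mxcvg M M0 ->
  mxcvg (fun y => invmx (M y)) (invmx M0).
Proof.
move=> u0 hM; have d0 : \det M0 != 0 by rewrite -unitfE -unitmxE.
have dM := cvg_det hM.
have uM : \forall y \near Fi, M y \in unitmx.
  move/cvgrPdist_lt: dM => /(_ `|\det M0|); rewrite normr_gt0 => /(_ d0).
  apply: filterS => y h; rewrite unitmxE unitfE; apply: contraTneq h => ->.
  by rewrite subr0 ltxx.
rewrite /invmx u0; apply: (@mxcvg_near _ _ (fun y => (\det (M y))^-1 *: \adj (M y))).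
  by apply: filterS uM => y; rewrite /invmx => ->.
apply: mxcvgZ; first exact: cvgV.
move=> i j; rewrite mxE (_ : (fun=> _) = fun y => cofactor (M y) j i); last first.
  by apply/funext => y; rewrite mxE.
apply: cvgM; first exact: cvg_cst.
apply: cvg_det => k l; rewrite !mxE (_ : (fun=> _) = fun y => M y (lift j k) (lift i l)).
  exact: hM.
by apply/funext => y; rewrite !mxE.
Qed.

(** The quadratic form only sees the symmetric part, which a Cholesky factor of the limit turns into
    a matrix converging to the identity; a small entrywise perturbation of the identity is positive
    definite. *)
Lemma posdef_near m (M : T -> 'M[R]_m) M0 : mxcvg M M0 -> posdef M0 ->
  \forall y \near Fi, posdef (M y).
Proof.
move=> hM pos; pose s (N : 'M[R]_m) := 2^-1 *: (N + N^T).
have quad (N : 'M[R]_m) v : (v *m N *m v^T) 0 0 = (v *m s N *m v^T) 0 0.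
  have -> : v *m s N *m v^T = 2^-1 *: (v *m N *m v^T + (v *m N *m v^T)^T).
    by rewrite /s !trmx_mul trmxK mulmxA -mulmxDl -mulmxDr -scalemxAr -scalemxAl.
  by move: (v *m N *m v^T) => x; rewrite !mxE; lra.
have [||Q uQ QE] := @posdef_cholesky _ m (s M0).
- by rewrite /s trmxZ trmxD trmxK addrC.
- by move=> v v0; rewrite -quad; apply: pos.
pose N y := Q *m s (M y) *m Q^T.
have hN : mxcvg N 1%:M.
  rewrite -QE; apply: mxcvgM; last exact: mxcvg_cst.
  apply: mxcvgM; first exact: mxcvg_cst.
  by apply: mxcvgZ; [exact: cvg_cst | apply: mxcvgD => //; apply: mxcvg_tr].
(* A perturbation with entries below e changes the form by at most m e |u|^2, and m e < 1. *)
pose e : R := (m.+1%:R)^-1.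
have e0 : 0 < e by rewrite invr_gt0.
have : \forall y \near Fi, forall i j, `|N y i j - (1%:M : 'M[R]_m) i j| < e.
  apply: filter_forall => i; apply: filter_forall => j.
  by move/cvgrPdist_lt: (hN i j) => /(_ e e0); apply: filterS => y; rewrite distrC.
apply: filterS => y Ny v v0; rewrite quad.
have uv0 : v *m invmx Q != 0.
  by apply: contra v0 => /eqP h; rewrite -[v](mulmxKV uQ) h mul0mx.
have -> : v *m s (M y) *m v^T = (v *m invmx Q) *m N y *m (v *m invmx Q)^T.
  rewrite /N trmx_mul !mulmxA mulmxKV // -(mulmxA _ Q^T) -trmx_mul mulVmx // trmx1.
  by rewrite mulmx1.
move: (v *m invmx Q) uv0 => u /sqr_norm_gt0.
have -> : u *m N y *m u^T = u *m u^T + u *m (N y - 1%:M) *m u^T.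
  by rewrite mulmxBr mulmx1 mulmxBl addrC subrK.
have subE (A B : 'M[R]_m) i j : (A - B) i j = A i j - B i j by rewrite !mxE.
have {}Ny : forall i j, `|(N y - 1%:M) i j| < e by move=> i j; rewrite subE.
move: (N y - 1%:M) Ny => D De u0.
(* From |xy| <= (x^2 + y^2) / 2; summed over i and j this gives the lower bound - e m |u|^2. *)
have term i j : - (e * (u 0 i ^+ 2 + u 0 j ^+ 2) / 2) <= u 0 i * D i j * u 0 j.
  have := De i j; rewrite ltr_norml => /andP[d1 d2].
  have h1 : 0 <= (u 0 i + u 0 j) ^+ 2 := sqr_ge0 _.
  have h2 : 0 <= (u 0 i - u 0 j) ^+ 2 := sqr_ge0 _.
  by rewrite !sqrrD in h1 h2; nra.
have SE : (u *m u^T) 0 0 = \sum_i u 0 i ^+ 2 by rewrite mul_trE.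
have low : - (e * m%:R * \sum_i u 0 i ^+ 2) <= (u *m D *m u^T) 0 0.
  rewrite mul_trE; apply: (@le_trans _ _ (\sum_j \sum_i - (e * (u 0 i ^+ 2 + u 0 j ^+ 2) / 2))).
    rewrite le_eqVlt; apply/orP; left; apply/eqP.
    under [RHS]eq_bigr => j _.
      rewrite sumrN -mulr_suml -mulr_sumr big_split /= sumr_const card_ord.
      over.
    rewrite sumrN -mulr_suml -mulr_sumr big_split /= sumr_const card_ord sumrMnl.
    have alg (a S k : R) : - (a * k * S) = - (a * (S * k + S * k) / 2) by field.
    by rewrite alg !mulr_natr.
  apply: ler_sum => j _; rewrite mxE mulr_suml; apply: ler_sum => i _; exact: term.
rewrite mxE; apply: lt_le_trans (_ : (u *m u^T) 0 0 - e * m%:R * \sum_i u 0 i ^+ 2 <= _); last first.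
  by rewrite lerD2l.
rewrite -SE subr_gt0 -[ltRHS]mul1r ltr_pM2r // /e mulrC ltr_pdivrMr ?ltr0n //.
by rewrite mul1r ltr_nat.
Qed.

End MatrixConvergence.

(** * Semicontinuity of the window counts *)

Section WindowNear.
Context {R : realType} {n : nat} {T : Type} {Fi : set_system T} {FF : Filter Fi}.
Context (W : T -> 'M[R]_(n + n)) (F G : T -> 'M[R]_(n, n + n)).
Context (W0 : 'M[R]_(n + n)) (F0 G0 : 'M[R]_(n, n + n)).
Hypotheses (cW : mxcvg (Fi := Fi) W W0) (cF : mxcvg (Fi := Fi) F F0) (cG : mxcvg (Fi := Fi) G G0).
Hypotheses (hW0 : hermitian_form W0) (lF0 : lagframe W0 F0).

Lemma coord_cvg :
  mxcvg (Fi := Fi) (fun y => coord_re (F y) (G y)) (coord_re F0 G0) /\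
  mxcvg (Fi := Fi) (fun y => coord_im (F y) (G y)) (coord_im F0 G0).
Proof.
have uF := lagframe_unit hW0 lF0.
have h : mxcvg (Fi := Fi) (fun y => G y *m invmx (col_mx (F y) (F y *m Jmx)))
    (G0 *m invmx (col_mx F0 (F0 *m Jmx))).
  apply: mxcvgM => //; apply: mxcvg_inv => //; apply: mxcvg_col_mx => //.
  by apply: mxcvgM => //; apply: mxcvg_cst.
split=> i j; rewrite !mxE.
  rewrite (_ : (fun=> _) = fun y => (G y *m invmx (col_mx (F y) (F y *m Jmx))) i (lshift n j)).
    by move: (h i (lshift n j)); rewrite [X in _ --> X]mxE.
  by apply/funext => y; rewrite [LHS]mxE.
rewrite (_ : (fun=> _) = fun y => (G y *m invmx (col_mx (F y) (F y *m Jmx))) i (rshift n j)).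
  by move: (h i (rshift n j)); rewrite [X in _ --> X]mxE.
by apply/funext => y; rewrite [LHS]mxE.
Qed.

Lemma gram_cvg : mxcvg (Fi := Fi) (fun y => F y *m (W y *m Jmx^T) *m (F y)^T)
  (F0 *m (W0 *m Jmx^T) *m F0^T).
Proof.
apply: mxcvgM; last exact: mxcvg_tr.
by apply: mxcvgM => //; apply: mxcvgM => //; apply: mxcvg_cst.
Qed.

Lemma window_form_cvg a b : mxcvg (Fi := Fi) (fun y => window_form (W y) (F y) (G y) a b)
  (window_form W0 F0 G0 a b).
Proof.
have [cX cY] := coord_cvg.
have cstZ (c : R) (M : T -> 'M[R]_n) M0 : mxcvg (Fi := Fi) M M0 -> mxcvg (Fi := Fi) (fun y => c *: M y) (c *: M0).
  by move=> ?; apply: mxcvgZ => //; apply: cvg_cst.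
apply: mxcvgM; first apply: mxcvgM; last apply: mxcvg_tr.
- by apply: mxcvgD; [|apply: mxcvgN]; apply: cstZ.
- exact: gram_cvg.
- by apply: mxcvgD; [|apply: mxcvgN]; apply: cstZ.
Qed.

(** A subspace on which the limit form is positive definite keeps this property for all nearby
    forms, so the count cannot drop. *)
Lemma window_near E0 alpha0 a b : angles W0 F0 G0 E0 alpha0 ->
  \forall y \near Fi, hermitian_form (W y) -> lagframe (W y) (F y) ->
    forall E alpha, angles (W y) (F y) (G y) E alpha ->
    (#|window alpha0 a b| <= #|window alpha a b|)%N.
Proof.
move=> ang0; have [K pK] := window_attained a b hW0 lF0 ang0.
have : \forall y \near Fi, posdef (K *m window_form (W y) (F y) (G y) a b *m K^T).
  apply: posdef_near pK; apply: mxcvgM; last exact: mxcvg_cst.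
  by apply: mxcvgM; [exact: mxcvg_cst | exact: window_form_cvg].
by apply: filterS => y pKy hW lF E alpha ang; exact: (window_le hW lF ang pKy).
Qed.

End WindowNear.

(** * Angles clustered around given values *)

Section Cluster.
Context {R : realType} {n : nat}.
Implicit Types alpha : 'I_n -> R.

(** For x and v in [0, 1/2) this is distance less than e in the circle R / (1/2) Z. *)
Definition angle_close (e v x : R) := (`|x - v| < e) || (2^-1 - e < `|x - v|).

(* Distinct values of alpha are at distance at least 2 e in R / (1/2) Z. *)
Definition well_separated (e : R) alpha : Prop :=
  [/\ 0 < e, 4 * e <= 1, forall j, alpha j != 0 -> 2 * e <= alpha j,
      forall j, alpha j + 2 * e <= 2^-1 &
      forall i j, alpha i != alpha j -> 2 * e <= `|alpha i - alpha j|].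

(** With x = alpha_j - v the product is sin 2 pi (x + e) times sin 2 pi (e - x), which is not
    positive when e <= |x| <= 1/2 - e. *)
Lemma window_close (e v : R) alpha j : 0 < e -> 4 * e <= 1 ->
  0 <= v < 2^-1 -> 0 <= alpha j < 2^-1 ->
  j \in window alpha (2 * pi * (v - e)) (2 * pi * (v + e)) -> angle_close e v (alpha j).
Proof.
move=> e0 e4 /andP[v0 v1] /andP[a0 a1]; rewrite inE /=.
have pi0 := @pi_gt0 R.
have -> : 2 * pi * alpha j - 2 * pi * (v - e) = 2 * pi * (alpha j - v + e) by ring.
have -> : 2 * pi * (v + e) - 2 * pi * alpha j = 2 * pi * (e - (alpha j - v)) by ring.
set x := alpha j - v; rewrite /angle_close; apply: contraTT.
rewrite negb_or -!leNgt -/x => /andP[]; move: x => x h1 h2.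
have s0 (y : R) : 0 <= y <= 2^-1 -> 0 <= sin (2 * pi * y).
  move=> /andP[y0 y1]; apply: sin_ge0_pi; apply/andP; split; nra.
have [x0|x0] := leP 0 x.
  rewrite ger0_norm // in h1 h2.
  rewrite -[e - x]opprB mulrN sinN mulrN oppr_le0.
  by apply: mulr_ge0; apply: s0; apply/andP; split; lra.
rewrite ltr0_norm // in h1 h2.
rewrite -[x + e]opprK mulrN sinN mulNr oppr_le0.
by apply: mulr_ge0; apply: s0; apply/andP; split; lra.
Qed.

Lemma self_window (e v : R) alpha j : 0 < e -> 4 * e <= 1 -> alpha j = v ->
  j \in window alpha (2 * pi * (v - e)) (2 * pi * (v + e)).
Proof.
move=> e0 e4 av; rewrite inE /= av; have pi0 := @pi_gt0 R.
have -> : 2 * pi * v - 2 * pi * (v - e) = 2 * pi * e by ring.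
have -> : 2 * pi * (v + e) - 2 * pi * v = 2 * pi * e by ring.
by rewrite -expr2 exprn_gt0 // sin_gt0_pi //; apply/andP; split; nra.
Qed.

(** Both families have n members: the values of g form, up to order, a sublist of those of f of the
    same length, hence the whole list. *)
Lemma sum_eq_counts (f g : 'I_n -> R) :
  (forall i, (#|[pred j | g j == g i]| <= #|[pred j | f j == g i]|)%N) ->
  [/\ \sum_j f j = \sum_j g j,
      forall v, #|[pred j | f j == v]| = #|[pred j | g j == v]| &
      forall j, exists i, f j = g i].
Proof.
move=> h.
have cE (k : 'I_n -> R) v : count_mem v (codom k) = #|[pred j | k j == v]|.
  by rewrite /codom /image_mem count_map cardE size_filter enumT; apply: eq_count.
have pfg : perm_eq (codom g) (codom f).
  have [|s ss gs] := (count_subseqP (codom g) (codom f)).1.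
    move=> v; have [/codomP[i ->]|vg] := boolP (v \in codom g); first by rewrite !cE h.
    by rewrite (count_memPn vg).
  have/eqP <- // : s == codom f.
  rewrite -(size_subseq_leqif ss).2; apply/eqP.
  by rewrite -(perm_size gs) !size_codom.
split.
- transitivity (\sum_(x <- codom f) x); first by rewrite big_map big_enum.
  by rewrite -(perm_big _ pfg) big_map big_enum.
- by move=> v; rewrite -!cE (permP pfg).
- by move=> j; apply/codomP; rewrite (perm_mem pfg) codom_f.
Qed.

(** A nonzero v keeps distance 2 e from both ends of [0, 1/2], so closeness wraps around only at v =
    0. *)
Lemma angle_closeE (e v x : R) : 0 < e -> 0 <= x < 2^-1 -> 0 <= v ->
  v + 2 * e <= 2^-1 -> (v != 0 -> 2 * e <= v) -> angle_close e v x ->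
  v = 0 /\ (x < e \/ 2^-1 - e < x) \/ [/\ 2 * e <= v, v - e < x & x < v + e].
Proof.
move=> e0 /andP[x0 x1] v0 v1 v2; rewrite /angle_close.
have [->|/v2 {}v2] := eqVneq v 0.
  by rewrite subr0 ger0_norm // => /orP[] ?; left; split=> //; [left|right].
move=> c; right; have : `|x - v| < e by case/orP: c => //; case: ger0P => ? ?; lra.
by rewrite ltr_norml => /andP[? ?]; split; lra.
Qed.

(** Lower bounds for the sizes of the clusters suffice: the clusters are disjoint and already use up
    all n angles. Moving each angle to the centre of its cluster costs at most e, except that an
    angle near 1/2 moves to 0 and costs about 1/2, which the correction term records. *)
Lemma angles_cluster (e : R) alpha0 alpha : well_separated e alpha0 ->
  (forall j, 0 <= alpha0 j < 2^-1) -> (forall j, 0 <= alpha j < 2^-1) ->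
  (forall i, (#|[pred j | alpha0 j == alpha0 i]| <=
              #|[pred j | angle_close e (alpha0 i) (alpha j)]|)%N) ->
  `|\sum_j alpha j - \sum_j alpha0 j - 2^-1 * #|[pred j | (2^-1 - e < alpha j)%R]|%:R| <= n%:R * e /\
  #|[pred j | (alpha j < e)%R || (2^-1 - e < alpha j)%R]| = #|[pred j | alpha0 j == 0%R]|.
Proof.
move=> [e0 e4 s1 s2 s3] b0 b h.
have uniq i i' j : angle_close e (alpha0 i) (alpha j) -> angle_close e (alpha0 i') (alpha j) ->
    alpha0 i = alpha0 i'.
  have cE k := angle_closeE e0 (b j) (proj1 (andP (b0 k))) (s2 k) (s1 k).
  move=> /cE c /cE c'; apply/eqP; apply: contraT => ne; have := s3 _ _ ne.
  have := s2 i; have := s2 i'; case: c => [[v0 c]|[c1 c2 c3]]; case: c' => [[v0' c']|[c1' c2' c3']].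
  - by move: ne; rewrite v0 v0' eqxx.
  - by move=> ? ? _; case: c => c; lra.
  - by move=> ? ? _; case: c' => c'; lra.
  - by move=> _ _; case: ger0P => ? ?; lra.
(* The centre of the cluster of the j-th angle. The default -1 differs from every value of [alpha0],
   so that it adds to none of the counts; the counting then shows that it does not occur. *)
pose f j := if [pick i | angle_close e (alpha0 i) (alpha j)] is Some i then alpha0 i else - 1.
have fE i j : (f j == alpha0 i) = angle_close e (alpha0 i) (alpha j).
  rewrite /f; case: pickP => [i' ci'|ni].
    apply/eqP/idP => [<-//|ci]; exact: uniq ci' ci.
  by rewrite ni; apply/eqP => E; have /andP[] := b0 i; rewrite -E; lra.
have [|fS fC fA] := @sum_eq_counts f alpha0.
  move=> i; rewrite (_ : #|[pred j | f j == _]| = #|[pred j | angle_close e (alpha0 i) (alpha j)]|) //.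
  by apply: eq_card => j; rewrite !inE fE.
have fJ j : f j = 0 /\ (alpha j < e \/ 2^-1 - e < alpha j) \/
    [/\ 2 * e <= f j, f j - e < alpha j, alpha j < f j + e & f j + 2 * e <= 2^-1].
  have [i E] := fA j; have := fE i j; rewrite E eqxx => /esym.
  case/(angle_closeE e0 (b j) (proj1 (andP (b0 i))) (s2 i) (s1 i)) => [|[? ? ?]]; first by left.
  by right; split.
split; last first.
  rewrite -(fC 0); apply: eq_card => j; rewrite !inE.
  case: (fJ j) => [[-> [->|->]]|[? ? ? ?]]; rewrite ?eqxx ?orbT //.
  have -> : (f j == 0) = false by rewrite gt_eqF //; lra.
  by apply/negbTE; rewrite negb_or -!leNgt; apply/andP; split; lra.
have -> : #|[pred j | (2^-1 - e < alpha j)%R]|%:R = \sum_j (2^-1 - e < alpha j)%R%:R :> R.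
  rewrite -sum1_card natr_sum big_mkcond /=; apply: eq_bigr => j _.
  by rewrite inE; case: ifP.
rewrite -fS mulr_sumr -!sumrB; apply: le_trans (ler_norm_sum _ _ _) _.
have -> : n%:R * e = \sum_(j < n) e by rewrite sumr_const card_ord mulr_natl.
apply: ler_sum => j _; have /andP[b1 b2] := b j; rewrite ler_norml.
have big : ~~ (2^-1 - e < alpha j) -> (2^-1 - e < alpha j)%R%:R = 0 :> R by move/negbTE ->.
case: (fJ j) => [[-> [c|c]]|[? ? ? ?]].
- by rewrite big; [apply/andP; split; lra|rewrite -leNgt; lra].
- by rewrite c /=; apply/andP; split; lra.
- by rewrite big; [apply/andP; split; lra|rewrite -leNgt; lra].
Qed.

End Cluster.

Lemma well_separated_exists {R : realType} {n : nat} (alpha : 'I_n -> R) (m : R) :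
  (forall j, 0 <= alpha j < 2^-1) -> 0 < m -> exists2 e, well_separated e alpha & e < m.
Proof.
move=> b m0.
have lt (c : R) : 0 < c -> \forall e \near 0^'+, 4 * e < c.
  move=> c0; near=> e; have : e < c / 4 by near: e; apply: nbhs_right_lt; rewrite divr_gt0.
  by lra.
have [e [e0 h]] : exists e : R, 0 < e /\ [/\ 4 * e < 4 * m, 4 * e < 1,
    forall j, alpha j != 0 -> 4 * e < alpha j, forall j, 4 * e < 2^-1 - alpha j &
    forall i j, alpha i != alpha j -> 4 * e < `|alpha i - alpha j|].
  apply: (@filter_ex _ (0^'+ : set_system R)); near=> e; split.
    by near: e; apply: nbhs_right_gt.
  split; near: e.
  - by apply: lt; lra.
  - exact: lt.
  - apply: filter_forall => j; have [->|a0] := eqVneq (alpha j) 0; first exact: filterE.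
    have : 0 < alpha j by rewrite lt_def a0; have /andP[] := b j.
    by move=> /lt; apply: filterS.
  - by apply: filter_forall => j; apply: lt; have /andP[] := b j; lra.
  - apply: filter_forall => i; apply: filter_forall => j.
    have [->|a0] := eqVneq (alpha i) (alpha j); first exact: filterE.
    by have /lt : 0 < `|alpha i - alpha j| by [rewrite normr_gt0 subr_eq0]; apply: filterS.
case: h => h1 h2 h3 h4 h5; exists e; last lra; split=> //; first lra.
- by move=> j /h3; lra.
- by move=> j; have := h4 j; lra.
- by move=> i j /h5; lra.
Unshelve. all: by end_near. Qed.

Lemma small_int {R : realType} (m : int) : -1 < m%:~R :> R -> m%:~R < 1 :> R -> m = 0.
Proof.
rewrite ltrNl -mulrNz !ltrz1 => h1 h2; lia.
Qed.

Section IndexNear.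
Context {R : realType} {n : nat} {T : Type} {Fi : set_system T} {FF : Filter Fi}.
Context (W : T -> 'M[R]_(n + n)) (F G : T -> 'M[R]_(n, n + n)).
Context (W0 : 'M[R]_(n + n)) (F0 G0 E0 : 'M[R]_(n, n + n)) (alpha0 : 'I_n -> R).
Hypotheses (cW : mxcvg (Fi := Fi) W W0) (cF : mxcvg (Fi := Fi) F F0) (cG : mxcvg (Fi := Fi) G G0).
Hypotheses (hW0 : hermitian_form W0) (lF0 : lagframe W0 F0).
Hypothesis ang0 : angles W0 F0 G0 E0 alpha0.
Context (theta : T -> R) (theta0 : R).
Hypothesis ctheta : theta @ Fi --> theta0.
Hypothesis phase0 : exists k : int, theta0 - 2 * (\sum_j alpha0 j) = k%:~R.

(* Only the angles that approach 1/2 make the sum of the angles jump, because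
   1/2 and 0 give the same subspace. *)
Lemma index_near (e : R) : well_separated e alpha0 -> 4 * (n%:R * e) < 1 ->
  \forall y \near Fi, hermitian_form (W y) -> lagframe (W y) (F y) ->
    forall E alpha, angles (W y) (F y) (G y) E alpha ->
    (exists k : int, theta y - 2 * (\sum_j alpha j) = k%:~R) ->
    theta y - 2 * (\sum_j alpha j) =
      theta0 - 2 * (\sum_j alpha0 j) - #|[pred j | (2^-1 - e < alpha j)%R]|%:R /\
    #|[pred j | (alpha j < e)%R || (2^-1 - e < alpha j)%R]| = #|[pred j | alpha0 j == 0%R]|.
Proof.
move=> sep ne; have [e0 e4 _ _ _] := sep; have [_ _ b0 _] := ang0.
have h : \forall y \near Fi, forall i, hermitian_form (W y) -> lagframe (W y) (F y) ->
    forall E alpha, angles (W y) (F y) (G y) E alpha ->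
    (#|window alpha0 (2 * pi * (alpha0 i - e)) (2 * pi * (alpha0 i + e))| <=
     #|window alpha (2 * pi * (alpha0 i - e)) (2 * pi * (alpha0 i + e))|)%N.
  by apply: filter_forall => i; apply: window_near ang0.
have h2 : \forall y \near Fi, `|theta0 - theta y| < 2^-1.
  by move/cvgrPdist_lt: ctheta; apply; lra.
apply: filterS2 h h2 => y h h2 hW lF E alpha ang [k kE].
have [_ _ b _] := ang.
have [] := angles_cluster sep b0 b _.
  move=> i; set w := window alpha0 (2 * pi * (alpha0 i - e)) (2 * pi * (alpha0 i + e)).
  have l1 : (#|[pred j | alpha0 j == alpha0 i]| <= #|w|)%N.
    apply: subset_leq_card; apply/fintype.subsetP => j; rewrite inE => /eqP.
    exact: self_window.
  apply: leq_trans l1 _; apply: leq_trans (h i hW lF E alpha ang) _.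
  apply: subset_leq_card; apply/fintype.subsetP => j.
  by move/(window_close e0 e4 (b0 i) (b j)).
move=> c1 c2; split => //; have [l lE] := phase0; rewrite kE lE.
set N := #|_| in c1 *.
move: c1; rewrite ler_norml => /andP[c1 c1']; move: h2; rewrite ltr_norml => /andP[c3 c3'].
(* The phase moves by less than 1/2 and twice the sum of the angles by at most 2 n e < 1/2, apart
   from the N wrapped angles; an integer of absolute value below 1 is 0. *)
have d1 : k%:~R - l%:~R + N%:R < 1 :> R by rewrite -kE -lE; lra.
have d2 : -1 < k%:~R - l%:~R + N%:R :> R by rewrite -kE -lE; lra.
have E1 : k%:~R - l%:~R + N%:R = (k - l + N%:Z)%:~R :> R by rewrite intrD intrB.
rewrite E1 in d1 d2; have := small_int d2 d1 => E2.
have -> : l%:~R - N%:R = (l - N%:Z)%:~R :> R by rewrite intrB.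
by congr (_%:~R); lia.
Qed.

End IndexNear.

(** * Charts and tangent spaces *)

Section Differentiability.
Context {R : realType} {m : nat}.
Implicit Types (z y : 'rV[R]_m) (f : 'rV[R]_m -> R).

Lemma nbhs_box z (A : set 'rV[R]_m) : nbhs z A ->
  exists2 d : R, 0 < d & forall y, (forall j, `|y 0 j - z 0 j| < d) -> A y.
Proof.
move=> /nbhs_ballP[d d0 h]; exists d => // y yz; apply: h; split=> // i j.
by rewrite ord1 /ball /= distrC.
Qed.

Lemma cvg_rV (T : Type) (Fi : set_system T) (FF : Filter Fi) (g : T -> 'rV[R]_m) z :
  (forall j, (fun t => g t 0 j) @ Fi --> z 0 j) -> g @ Fi --> z.
Proof.
move=> h; apply/cvg_ballP => e e0.
have : \forall t \near Fi, forall j, `|z 0 j - g t 0 j| < e.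
  by apply: filter_forall => j; move/cvgrPdist_lt: (h j) => /(_ e e0).
by apply: filterS => t ht; split=> // i j; rewrite ord1; apply: ht.
Qed.

Definition mixed y z (k : nat) : 'rV[R]_m := \row_j (if (j < k)%N then y 0 j else z 0 j).

Lemma mixedS y z (k : 'I_m) :
  mixed y z k.+1 = mixed y z k + (y 0 k - z 0 k) *: delta_mx 0 k.
Proof.
apply/rowP => j; rewrite !mxE ltnS leq_eqVlt eqxx /=.
have [->|jk] := eqVneq j k; first by rewrite eqxx ltnn mulr1 addrC subrK.
by rewrite (_ : (j == k :> nat) = false) ?orFb ?mulr0 ?addr0 //; apply: negbTE.
Qed.

(* The mean value theorem along one coordinate axis at a time. *)
Lemma caratheodory (U : set 'rV[R]_m) f z : open U -> U z -> Ck 1 U f ->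
  exists c : 'rV[R]_m -> 'I_m -> R,
    (forall j (e : R), 0 < e -> exists2 d : R, 0 < d & forall y,
       (forall k, `|y 0 k - z 0 k| < d) -> `|partial j f z - c y j| < e) /\
    forall y, f y - f z = \sum_j (y 0 j - z 0 j) * c y j.
Proof.
move=> oU Uz [_ /= dC].
(* The difference quotient along the j-th edge of the path from z to y; on a degenerate edge its
   factor is 0, and the limit value is inserted to keep the estimate. *)
pose c y (j : 'I_m) := if y 0 j - z 0 j == 0 then partial j f z
  else (f (mixed y z j.+1) - f (mixed y z j)) / (y 0 j - z 0 j).
exists c; split; last first.
  move=> y; have -> : f y = f (mixed y z m) by congr f; apply/rowP => j; rewrite mxE ltn_ord.
  have {2}-> : z = mixed y z 0 by apply/rowP => j; rewrite mxE.
  rewrite -(telescope_sumr (fun k => f (mixed y z k))) // big_mkord; apply: eq_bigr => j _.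
  rewrite /c; case: eqP => [yz|/eqP yz].
    by rewrite mixedS yz scale0r addr0 subrr mul0r.
  by rewrite mulrC divfK.
move=> j e e0.
have [dj [cj _]] := dC j.
have [d1 d10 hU] := nbhs_box (open_nbhs_nbhs (conj oU Uz)).
have [d2 d20 hd] := nbhs_box (cj z Uz _ (nbhsx_ballx _ _ e0)).
exists (Num.min d1 d2) => [|y yd]; first by rewrite lt_min d10.
rewrite /c; case: eqP => [_|/eqP D0]; first by rewrite subrr normr0.
set D := y 0 j - z 0 j in D0 *; set q := fun s : R => mixed y z j + (s * D) *: delta_mx 0 j.
have qin (s : R) : 0 <= s <= 1 -> forall k, `|q s 0 k - z 0 k| < Num.min d1 d2.
  move=> /andP[s0 s1] k; rewrite /q !mxE eqxx /=; have [->|kj] := eqVneq k j.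
    rewrite ltnn mulr1 addrC addKr normrM ger0_norm //.
    by apply: le_lt_trans (yd j); rewrite ler_piMl.
  by rewrite mulr0 addr0; case: ifP => _; rewrite ?yd // subrr normr0 lt_min d10.
have qU (s : R) : 0 <= s <= 1 -> U (q s).
  by move=> /qin h; apply: hU => k; apply: lt_le_trans (h k) _; rewrite ge_min lexx.
have dq (s : R) : 0 <= s <= 1 -> is_derive s 1 (f \o q) (partial j f (q s) * D).
  move=> s01; have -> : f \o q = (fun h => f (q s + h *: delta_mx 0 j)) \o (fun t => (t - s) * D).
    apply/funext => t /=; congr f; rewrite /q -addrA -scalerDl; congr (_ + _ *: _); ring.
  apply: is_derive1_comp.
    rewrite subrr mul0r; apply: DeriveDef; first exact: dj (qU _ s01).
    by rewrite /partial derive1E.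
  have -> : (fun t => (t - s) * D) = (D *: (id - cst s)) :> (R -> R).
    by apply/funext => t /=; rewrite [RHS]mulrC.
  by apply: is_derive_eq; rewrite subr0 [_ *: _]mulr1.
have [|||t t01] := @MVT _ (f \o q) (fun s => partial j f (q s) * D) 0 1 _ _ _ => //.
- by move=> s; rewrite in_itv /= => /andP[s0 s1]; apply: dq; rewrite !ltW.
- apply: derivable_within_continuous => s; rewrite in_itv /= => s01.
  by have [] := dq s s01.
move: t01; rewrite in_itv /= => /andP[t0 t1].
have -> : f (q 1) = f (mixed y z j.+1) by rewrite /q mul1r -mixedS.
have -> : f (q 0) = f (mixed y z j) by rewrite /q mul0r scale0r addr0.
rewrite subr0 mulr1 => ->; rewrite mulfK //.
apply: hd => k; have : 0 <= t <= 1 by rewrite !ltW.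
by move=> /qin h; apply: lt_le_trans (h k) _; rewrite ge_min lexx orbT.
Qed.

(** The curve is differentiable at 0 only. The factors of [caratheodory] write the increment of f as
    a sum of products, so that no division by an increment of g occurs. *)
Lemma chain_curve (U : set 'rV[R]_m) f (g : R -> 'rV[R]_m) (v : 'rV[R]_m) :
  open U -> U (g 0) -> Ck 1 U f ->
  (forall j, is_derive (0 : R) 1 (fun t => g t 0 j) (v 0 j)) ->
  is_derive (0 : R) 1 (f \o g) (\sum_j v 0 j * partial j f (g 0)).
Proof.
move=> oU Ug fC dg; have [c [cc fE]] := caratheodory oU Ug fC.
have gc j : (fun t => g t 0 j) @ 0 --> g 0 0 j.
  have [dj _] := dg j.
  by apply/differentiable_continuous/derivable1_diffP.
suff L : (fun h => h^-1 *: ((f \o g) (h *: 1 + 0) - (f \o g) 0)) @ 0^' -->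
    \sum_j v 0 j * partial j f (g 0).
  by apply: DeriveDef; [apply: cvgP L | apply: cvg_lim L].
have -> : (fun h => h^-1 *: ((f \o g) (h *: 1 + 0) - (f \o g) 0)) =
    fun h => \sum_j (h^-1 *: (g (h *: 1 + 0) 0 j - g 0 0 j)) * c (g h) j.
  apply/funext => h /=; rewrite fE [LHS]mulr_sumr; apply: eq_bigr => j _.
  by rewrite !addr0 ![_ *: 1]mulr1 mulrA.
apply: cvg_bigsum => j _; apply: cvgM.
  by have [dj <-] := dg j; apply: dj.
apply/cvgrPdist_lt => e e0; have [d d0 hd] := cc j e e0.
have : \forall t \near 0, forall k, `|g 0 0 k - g t 0 k| < d.
  apply: (@filter_forall R 'I_m (fun k t => `|g 0 0 k - g t 0 k| < d) (nbhs (0 : R))) => k.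
  by move/cvgrPdist_lt: (gc k); apply.
move=> /nbhs_dnbhs; apply: filterS => t ht; apply: hd => k.
by rewrite distrC.
Qed.

End Differentiability.

(** * Curves and transition maps in charts *)

Section Charts.
Context {R : realType} {m : nat} {Y : topologicalType}.
Implicit Types (c d e : chart R m Y) (x : Y) (v w : 'rV[R]_m).

Lemma near_img c x : dom c x ->
  \forall z \near fwd c x, (fwd c @` dom c) z /\ fwd c (bwd c z) = z.
Proof.
move=> cx; have : nbhs (fwd c x) (fwd c @` dom c).
  by apply: open_nbhs_nbhs; split; [exact: img_open | exists x].
by apply: filterS => z [y cy <-]; rewrite fwdK //; split=> //; exists y.
Qed.

Lemma open_overlap c d : open (fwd c @` (dom c `&` dom d)).
Proof.
rewrite openE => _ [x [cx dx] <-]; have imx : (fwd c @` dom c) (fwd c x) by exists x.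
have : \forall z \near fwd c x, dom d (bwd c z).
  apply: (bwd_continuous imx); rewrite fwdK //; apply: open_nbhs_nbhs; split => //.
  exact: dom_open.
move: (near_img cx); apply: filterS2 => z [[y cy <-] _]; rewrite fwdK // => dy.
by exists y.
Qed.

Lemma smooth_jac_cvg c d x : smooth_transition c d -> dom c x -> dom d x ->
  mxcvg (Fi := nbhs x) (fun y => jac (transition c d) (fwd c y))
    (jac (transition c d) (fwd c x)).
Proof.
move=> scd cx dx i j; have [_ /(_ i)[_ [h _]]] := scd j 1%N.
have {}h := h (fwd c x) (ex_intro2 _ _ x (conj cx dx) erefl).
rewrite mxE (_ : (fun y => _) = partial i (fun z => transition c d z 0 j) \o fwd c).
  by apply: continuous_comp; [exact: fwd_continuous | exact: h].
by apply/funext => y; rewrite mxE.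
Qed.

Lemma is_derive_near (f g : R -> R) (a : R) : {near (0 : R), f =1 g} ->
  is_derive (0 : R) 1 f a -> is_derive (0 : R) 1 g a.
Proof. by move=> fg df; apply: near_eq_is_derive df; rewrite ?oner_eq0. Qed.

Lemma chain_chart c d (g : R -> Y) v : smooth_transition c d ->
  dom c (g 0) -> dom d (g 0) -> (\forall t \near (0 : R), dom c (g t)) ->
  (forall j, is_derive (0 : R) 1 (fun t => fwd c (g t) 0 j) (v 0 j)) ->
  forall j, is_derive (0 : R) 1 (fun t => fwd d (g t) 0 j)
    ((v *m jac (transition c d) (fwd c (g 0))) 0 j).
Proof.
move=> scd cx dx gc dg j.
have Ug : (fwd c @` (dom c `&` dom d)) (fwd c (g 0)) by exists (g 0).
have := @chain_curve _ _ _ (fun z => transition c d z 0 j) (fun t => fwd c (g t)) v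
  (@open_overlap c d) Ug (scd j 1%N) dg.
rewrite (_ : \sum_k _ = (v *m jac (transition c d) (fwd c (g 0))) 0 j); last first.
  by rewrite mxE; apply: eq_bigr => k _; rewrite mxE.
apply: is_derive_near; apply: filterS gc => t ct /=.
by rewrite /transition fwdK.
Qed.

Definition line c x w (t : R) : Y := bwd c (fwd c x + t *: w).

Lemma line0 c x w : dom c x -> line c x w 0 = x.
Proof. by move=> cx; rewrite /line scale0r addr0 fwdK. Qed.

Lemma affine_cvg (z w : 'rV[R]_m) : (fun t : R => z + t *: w) @ (0 : R) --> z.
Proof.
apply: cvg_rV => j; rewrite (_ : (fun t => _) = fun t => z 0 j + t * w 0 j); last first.
  by apply/funext => t; rewrite !mxE.
rewrite -[X in _ --> X]addr0 -[X in _ + X](mul0r (w 0 j)).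
by apply: cvgD; [exact: cvg_cst | apply: cvgM; [exact: cvg_id | exact: cvg_cst]].
Qed.

Lemma line_near c x w : dom c x -> \forall t \near (0 : R),
  dom c (line c x w t) /\ fwd c (line c x w t) = fwd c x + t *: w.
Proof.
move=> cx; have : \forall t \near (0 : R), (fwd c @` dom c) (fwd c x + t *: w) /\
    fwd c (bwd c (fwd c x + t *: w)) = fwd c x + t *: w := @affine_cvg _ w _ (near_img cx).
apply: filterS => t [[y cy E] h].
by rewrite /line; split => //; rewrite -E fwdK.
Qed.

Lemma line_derive c x w : dom c x ->
  forall j, is_derive (0 : R) 1 (fun t => fwd c (line c x w t) 0 j) (w 0 j).
Proof.
move=> cx j; apply: (@is_derive_near (fun t => fwd c x 0 j + t * w 0 j)).
  by apply: filterS (line_near w cx) => t [_ ->]; rewrite !mxE.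
rewrite (_ : (fun t => _) = cst (fwd c x 0 j) + w 0 j *: id :> (R -> R)); last first.
  by apply/funext => t /=; rewrite [X in _ = _ + X]mulrC.
have h : is_derive (0 : R) 1 (cst (fwd c x 0 j) + w 0 j *: id : R -> R) (0 + w 0 j *: 1).
  by apply: is_deriveD; apply: is_deriveZ.
by move: h; rewrite add0r [w 0 j *: 1]mulr1.
Qed.

Lemma jac_transitionE c d x i j : dom c x ->
  jac (transition c d) (fwd c x) i j =
  derive1 (fun t => fwd d (line c x (delta_mx 0 i) t) 0 j) 0.
Proof. by move=> cx; rewrite mxE. Qed.

(** The chain rule is reduced to the one for curves by following the coordinate lines of c through d
    into e. *)
Lemma jac_comp c d e x : smooth_transition c d -> smooth_transition d e ->
  dom c x -> dom d x -> dom e x ->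
  jac (transition c e) (fwd c x) =
  jac (transition c d) (fwd c x) *m jac (transition d e) (fwd d x).
Proof.
move=> scd sde cx dx ex; apply/matrixP => i k.
set w : 'rV[R]_m := delta_mx 0 i; have l0 := line0 w cx.
have dl : \forall t \near (0 : R), dom d (line c x w t).
  have imx : (fwd c @` dom c) (fwd c x) by exists x.
  have h1 : \forall z \near fwd c x, dom d (bwd c z).
    apply: (bwd_continuous imx); rewrite fwdK //; apply: open_nbhs_nbhs; split => //.
    exact: dom_open.
  exact: (@affine_cvg _ w _ h1).
have cl : \forall t \near (0 : R), dom c (line c x w t).
  by apply: filterS (line_near w cx) => t [].
have D1 := chain_chart scd _ _ cl (line_derive w cx).
rewrite !l0 in D1; have {}D1 := D1 cx dx.
have D2 := chain_chart sde _ _ dl D1.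
rewrite !l0 in D2; have {}D2 := D2 dx ex.
rewrite jac_transitionE // derive1E; have [_ ->] := D2 k.
by rewrite -rowE -row_mul mxE.
Qed.

Lemma jac_refl c x : dom c x -> jac (transition c c) (fwd c x) = 1%:M.
Proof.
move=> cx; apply/matrixP => i j; rewrite jac_transitionE // derive1E.
by have [_ ->] := line_derive (delta_mx 0 i) cx j; rewrite !mxE eqxx eq_sym.
Qed.

Lemma jac_unit c d x : smooth_transition c d -> smooth_transition d c ->
  dom c x -> dom d x ->
  jac (transition c d) (fwd c x) *m jac (transition d c) (fwd d x) = 1%:M.
Proof. by move=> scd sdc cx dx; rewrite -jac_comp // jac_refl. Qed.

End Charts.

(** * Subspaces as row spaces *)

Section Subspaces.
Context {R : realType} {m : nat}.
Implicit Types V : {vspace 'rV[R]_m}.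

(** A dictionary between abstract subspaces and matrices, where ranks are computed. The rows may be
    dependent. *)
Definition spans k (F : 'M[R]_(k, m)) V : Prop := forall v, v \in V <-> (v <= F)%MS.

Lemma spans_exists k (F : 'M[R]_(k, m)) : exists V, spans F V.
Proof.
exists (limg (linfun (mulmxr F : 'rV_k -> 'rV_m))) => w; split.
  by move=> /memv_imgP[u _ ->]; rewrite lfunE /= submxMl.
by move=> /submxP[u ->]; apply/memv_imgP; exists u; rewrite ?memvf // lfunE.
Qed.

Lemma spans_uniq k (F : 'M[R]_(k, m)) V V' : spans F V -> spans F V' -> V = V'.
Proof. by move=> h h'; apply/vspaceP => v; apply/idP/idP => [/h/h'|/h'/h]. Qed.

Lemma spans_rank k l (F : 'M[R]_(k, m)) (G : 'M[R]_(l, m)) V :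
  spans F V -> spans G V -> \rank F = \rank G.
Proof.
move=> h h'; apply/eqP; rewrite eqn_leq; apply/andP; split; apply: mxrankS.
  by apply/rV_subP => v /h/h'.
by apply/rV_subP => v /h'/h.
Qed.

Lemma spans_dim k (F : 'M[R]_(k, m)) V : spans F V -> \dim V = \rank F.
Proof.
move=> h; pose B := row_base F.
have hB : spans B V by move=> v; rewrite h /B eq_row_base.
have [V' hV'] := spans_exists B; rewrite -(spans_uniq hV' hB) {h hB}.
pose f := linfun (mulmxr B : 'rV_(\rank F) -> 'rV_m).
have -> : V' = limg f.
  apply/vspaceP => v; apply/idP/idP.
    by move=> /hV' /submxP[u ->]; apply/memv_imgP; exists u; rewrite ?memvf // lfunE.
  by move=> /memv_imgP[u _ ->]; apply/hV'; rewrite lfunE /= submxMl.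
rewrite limg_dim_eq ?dimvf /dim /= ?mul1n //; apply/eqP; rewrite -subv0; apply/subvP => u.
rewrite memv_cap => /andP[_]; rewrite memv_ker lfunE /= memv0 => /eqP uB.
by apply/eqP/(row_free_inj (row_base_free F)); rewrite uB mul0mx.
Qed.

Lemma spans_cap k l (F : 'M[R]_(k, m)) (G : 'M[R]_(l, m)) V V' :
  spans F V -> spans G V' -> spans (F :&: G)%MS (V :&: V')%VS.
Proof.
move=> h h' v; rewrite memv_cap sub_capmx; split=> /andP[a b]; apply/andP.
  by split; [apply/h|apply/h'].
by split; [apply/h|apply/h'].
Qed.

Lemma spans_row k (F : 'M[R]_(k, m)) V : spans F V -> forall i, row i F \in V.
Proof. by move=> h i; apply/h; apply: row_sub. Qed.

End Subspaces.

(** * Tangent spaces through slice charts *)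

Section Tangent.
Context {R : realType} {n : nat} {X : calabi_yau R n}.
Implicit Types (S : set X) (c d : chart R (n + n) X).

Definition compatible c : Prop :=
  forall d, atlas d -> smooth_transition c d /\ smooth_transition d c.

Definition slice c S (k : nat) : Prop :=
  forall y, dom c y -> (S y <-> forall i : 'I_(n + n), (k <= i)%N -> fwd c y 0 i = 0).

Lemma tangent_vectorP S S' x k c : dom c x -> compatible c -> slice c S k ->
  S' `<=` S -> S x ->
  (forall w : 'rV[R]_(n + n), (forall i : 'I_(n + n), (k <= i)%N -> w 0 i = 0) ->
     \forall t \near (0 : R), S' (line c x w t)) ->
  forall v, tangent_vector S' x v <->
    exists2 w : 'rV[R]_(n + n), (forall i : 'I_(n + n), (k <= i)%N -> w 0 i = 0) &
      v = w *m jac (transition c (chart_at x)) (fwd c x).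
Proof.
move=> cx cc sl S'S Sx hl v; set a := chart_at x.
have aa : atlas a by apply: chart_at_atlas.
have ax : dom a x by apply: chart_at_dom.
have [sca sac] := cc a aa; split; last first.
  move=> [w w0 ->]; exists (line c x w); have l0 := line0 w cx; split => //.
    have al : \forall t \near (0 : R), dom a (line c x w t).
      have imx : (fwd c @` dom c) (fwd c x) by exists x.
      have h1 : \forall z \near fwd c x, dom a (bwd c z).
        apply: (bwd_continuous imx); rewrite fwdK //; apply: open_nbhs_nbhs; split => //.
        exact: dom_open.
      exact: (@affine_cvg _ _ _ w _ h1).
    by apply: filterS2 (hl w w0) al.
  have cl : \forall t \near (0 : R), dom c (line c x w t).
    by apply: filterS (line_near w cx) => t [].
  have D1 := chain_chart sca _ _ cl (line_derive w cx).
  by rewrite !l0 in D1; apply: D1.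
move=> [g [g0 gS dg]].
have ga : (fun t => fwd a (g t)) @ (0 : R) --> fwd a x.
  apply: cvg_rV => j; have [dj _] := dg j; rewrite -g0.
  by apply/differentiable_continuous/derivable1_diffP.
have gc : \forall t \near (0 : R), dom c (g t).
  have imx : (fwd a @` dom a) (fwd a x) by exists x.
  have h1 : \forall z \near fwd a x, dom c (bwd a z).
    apply: (bwd_continuous imx); rewrite fwdK //; apply: open_nbhs_nbhs; split => //.
    exact: dom_open.
  have h2 : \forall t \near (0 : R), dom c (bwd a (fwd a (g t))) := ga _ h1.
  by apply: filterS2 gS h2 => t [_ at_]; rewrite fwdK.
have gda : \forall t \near (0 : R), dom a (g t) by apply: filterS gS => t [].
have D1 : forall j, is_derive (0 : R) 1 (fun t => fwd c (g t) 0 j)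
    ((v *m jac (transition a c) (fwd a x)) 0 j).
  by have := chain_chart sac _ _ gda dg; rewrite g0; apply.
exists (v *m jac (transition a c) (fwd a x)).
  move=> i ki; have [_ <-] := D1 i.
  have : is_derive (0 : R) 1 (fun t => fwd c (g t) 0 i) 0.
    apply: (@is_derive_near _ (cst 0)).
    by apply: filterS2 gS gc => t [/S'S St _] ct; rewrite (((sl _ ct).1 St) i ki).
  by case.
by rewrite -mulmxA jac_unit // mulmx1.
Qed.

(** The first k coordinate vectors of the slice chart, expressed in the chart that defines T_x X. *)
Definition slice_frame c k (x : X) : 'M[R]_(k, n + n) :=
  pid_mx k *m jac (transition c (chart_at x)) (fwd c x).

Lemma tangent_spaceP S S' x k c : (k <= n + n)%N -> dom c x -> compatible c -> slice c S k ->
  S' `<=` S -> S x ->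
  (forall w : 'rV[R]_(n + n), (forall i : 'I_(n + n), (k <= i)%N -> w 0 i = 0) ->
     \forall t \near (0 : R), S' (line c x w t)) ->
  spans (slice_frame c k x) (tangent_space S' x).
Proof.
move=> kn cx cc sl S'S Sx hl; have h := tangent_vectorP cx cc sl S'S Sx hl.
have E v : tangent_vector S' x v <-> (v <= slice_frame c k x)%MS.
  rewrite h; split.
    move=> [w w0 ->]; have -> : w = w *m pid_mx k *m (pid_mx k : 'M[R]_(k, n + n)).
      rewrite -mulmxA pid_mx_id //; apply/rowP => j; rewrite mxE (bigD1 j) //= big1 ?addr0.
        by rewrite mxE eqxx /=; case: ltnP => [_|/w0 ->]; rewrite ?mulr1 ?mul0r.
      by move=> i ij; rewrite mxE (_ : (i == j :> nat) = false) ?mulr0 //; apply: negbTE.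
    by rewrite -mulmxA submxMl.
  move=> /submxP[b ->]; exists (b *m pid_mx k); last by rewrite mulmxA.
  move=> i ki; rewrite mxE big1 // => l _; rewrite mxE.
  by rewrite (_ : (l == i :> nat) = false) ?mulr0 // ltn_eqF // (leq_trans (ltn_ord l)).
have [V hV] := spans_exists (slice_frame c k x).
move=> v; rewrite -E; apply: vspace_ofP; exists V => w; rewrite E; exact: hV.
Qed.

Lemma slice_line S x k c (w : 'rV[R]_(n + n)) : dom c x -> slice c S k -> S x ->
  (forall i : 'I_(n + n), (k <= i)%N -> w 0 i = 0) ->
  \forall t \near (0 : R), S (line c x w t).
Proof.
move=> cx sl Sx w0; apply: filterS (line_near w cx) => t [ct E]; apply/(sl _ ct) => i ki.
by rewrite E !mxE w0 // mulr0 addr0; apply: ((sl x cx).1 Sx).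
Qed.

Lemma slice_frame_free c k x : (k <= n + n)%N -> dom c x -> compatible c ->
  row_free (slice_frame c k x).
Proof.
move=> kn cx cc; have [s1 s2] := cc _ (chart_at_atlas x).
have := jac_unit s1 s2 cx (chart_at_dom x) => /mulmx1_unit[u _].
by rewrite /row_free /slice_frame mxrankMfree ?row_free_unit // rank_pid_mx.
Qed.

Lemma tangent_coord_unit (x : X) d : atlas d -> dom d x ->
  tangent_coord x d \in unitmx /\
  Jmx *m tangent_coord x d = tangent_coord x d *m Jmx.
Proof.
move=> ad dx; have aa := chart_at_atlas x; have ax := chart_at_dom x.
split; last exact: transition_holomorphic.
have := jac_unit (transition_smooth aa ad) (transition_smooth ad aa) ax dx.
by case/mulmx1_unit.
Qed.

(** The choice of [chart_at] need not depend continuously on the point. Frames at nearby points are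
    therefore compared in one fixed chart d, where this formula shows that they vary
    continuously. *)
Lemma slice_frame_coord c d k x : atlas d -> compatible c -> dom c x -> dom d x ->
  slice_frame c k x *m tangent_coord x d =
  pid_mx k *m jac (transition c d) (fwd c x).
Proof.
move=> ad cc cx dx; have aa := chart_at_atlas x; have ax := chart_at_dom x.
rewrite /slice_frame /tangent_coord -mulmxA -jac_comp //; first by have [] := cc _ aa.
exact: transition_smooth.
Qed.

Definition omega_at d (y : X) : 'M[R]_(n + n) :=
  invmx (tangent_coord y d) *m omega y *m (invmx (tangent_coord y d))^T.

Lemma omega_at_cvg d x : atlas d -> dom d x ->
  mxcvg (Fi := nbhs x) (omega_at d) (omega_at d x).
Proof.
move=> ad dx i j.
have E y : dom d y -> omega_in_chart (@omega R n X) d (fwd d y) i j = omega_at d y i j.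
  by move=> dy; rewrite /omega_in_chart fwdK.
have [h _] := @omega_smooth _ _ X d i j ad 0%N.
have {}h := h (fwd d x) (ex_intro2 _ _ x dx erefl).
apply: (cvg_near_eq (f := (fun z => omega_in_chart (@omega R n X) d z i j) \o fwd d)).
  have : nbhs x (dom d) by apply: open_nbhs_nbhs; split => //; exact: dom_open.
  by apply: filterS => y dy /=; rewrite E.
by rewrite -E //; apply: continuous_comp; [exact: fwd_continuous | exact: h].
Qed.

Lemma omega_hermitian (x : X) : hermitian_form (omega x).
Proof.
apply: hermitian_formP; [exact: omega_alternating | exact: omega_J | exact: omega_positive].
Qed.

Lemma hermitian_congr (W T : 'M[R]_(n + n)) : T \in unitmx -> Jmx *m T = T *m Jmx ->
  hermitian_form W -> hermitian_form (T *m W *m T^T).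
Proof.
move=> uT TJ [WT WJ pos].
have TJ' : T^T *m Jmx^T = Jmx^T *m T^T by rewrite -!trmx_mul TJ.
split.
- by rewrite !trmx_mul trmxK WT mulNmx mulmxN mulmxA.
- rewrite !mulmxA TJ -(mulmxA T) WJ mulmxA -!mulmxA; congr (_ *m (_ *m _)).
  by move: TJ'; rewrite trmxJ mulmxN mulNmx => /oppr_inj.
- rewrite -mulmxA TJ' mulmxA -(mulmxA T); apply: posdef_congr => //.
  by rewrite row_free_unit.
Qed.

Lemma invmx_comm (T : 'M[R]_(n + n)) : T \in unitmx -> Jmx *m T = T *m Jmx ->
  Jmx *m invmx T = invmx T *m Jmx.
Proof.
move=> uT TJ; apply: (row_free_inj (A := T)); first by rewrite row_free_unit.
by rewrite -!mulmxA mulVmx // TJ mulmxA mulVmx // mul1mx mulmx1.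
Qed.

Lemma omega_at_hermitian d x : atlas d -> dom d x -> hermitian_form (omega_at d x).
Proof.
move=> ad dx; have [uT TJ] := tangent_coord_unit ad dx.
apply: hermitian_congr; [by rewrite unitmx_inv | exact: invmx_comm | exact: omega_hermitian].
Qed.

End Tangent.

(** * Lifting the argument *)

Lemma connected_locally_constant (T : topologicalType) (Y : Type) (A : set T) (f : T -> Y) :
  connected A -> (forall x, A x -> \forall y \near x, A y -> f y = f x) ->
  forall x y, A x -> A y -> f x = f y.
Proof.
move=> cA loc x y Ax Ay.
have : [set y | A y /\ f y = f x] = A.
  apply: cA; first by exists x.
    exists (interior [set y | A y -> f y = f x]); first exact: open_interior.
    apply/seteqP; split=> z [Az].
      move=> fz; split=> //; apply: filterS (loc z Az) => w h /h ->; exact: fz.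
    by move=> /interior_subset h; split => //; apply: h.
  exists (~` (interior [set y | A y -> f y <> f x])).
    by apply: open_closedC; apply: open_interior.
  apply/seteqP; split=> z [Az].
    by move=> fz; split=> // /interior_subset /(_ Az).
  move=> nz; split=> //; apply: contrapT => fz; apply: nz.
  by apply: filterS (loc z Az) => w h /h ->.
by move/seteqP => [_ /(_ y Ay)[_ ->]].
Qed.

Lemma within_cvgP (T U : topologicalType) (A : set T) (f : T -> U) :
  {within A, continuous f} <-> forall x, A x -> f @ within A (nbhs x) --> f x.
Proof. by split=> [/subspace_continuousP | h]; [|apply/subspace_continuousP]. Qed.

Section Lift.
Context {R : realType}.

Lemma int_valued_constant (f : R -> R) (a b : R) : a <= b ->
  {within `[a, b], continuous f} -> (forall x, x \in `[a, b] -> exists k : int, f x = k%:~R) ->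
  f a = f b.
Proof.
move=> ab /within_cvgP cf fi.
have aI : `[a, b]%classic a by rewrite /= in_itv /= lexx.
have bI : `[a, b]%classic b by rewrite /= in_itv /= lexx ab.
apply: (connected_locally_constant (@segment_connected R a b)) => // x xI.
have /cvgrPdist_lt/(_ 1 ltr01) := cf x xI.
rewrite near_withinE; apply: filterS => y h yI; have := h yI.
have [k ->] := fi y yI; have [l ->] := fi x xI; rewrite -intrB ltr_norml => /andP[h1 h2].
by have := small_int h1 h2 => /eqP; rewrite subr_eq0 => /eqP ->.
Qed.

(** For z = p + iq and z' = p' + iq' the fraction is the quotient of the imaginary and real parts of
    conj(z) z'. As the real part is positive, its arctangent is the angle from z to z'. *)
Lemma rotate_step (p q p' q' r t : R) : 0 < r -> p = r * cos t -> q = r * sin t ->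
  0 < p * p' + q * q' ->
  let a := atan ((p * q' - q * p') / (p * p' + q * q')) in
  exists r', [/\ 0 < r', p' = r' * cos (t + a) & q' = r' * sin (t + a)].
Proof.
move=> r0 pE qE; set D := p * p' + q * q'; set C := p * q' - q * p' => D0 a.
have ca : 0 < cos a by rewrite cos_atan invr_gt0 sqrtr_gt0 ltr_pwDl // sqr_ge0.
have sa : sin a = C / D * cos a by rewrite -[C / D]atanK /tan -/a mulfVK ?gt_eqF.
exists (D / cos a / r); split; first by rewrite !divr_gt0.
  rewrite cosD sa; transitivity ((D * (r * cos t) - C * (r * sin t)) / r ^+ 2); last first.
    by field; rewrite !gt_eqF.
  rewrite -pE -qE; have -> : r ^+ 2 = p ^+ 2 + q ^+ 2.
    by rewrite pE qE !exprMn -mulrDr cos2Dsin2 mulr1.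
  have pq : p ^+ 2 + q ^+ 2 != 0.
    by rewrite pE qE !exprMn -mulrDr cos2Dsin2 mulr1 expf_neq0 // gt_eqF.
  by rewrite /D /C; field.
rewrite sinD sa; transitivity ((D * (r * sin t) + C * (r * cos t)) / r ^+ 2); last first.
  by field; rewrite !gt_eqF.
rewrite -pE -qE; have -> : r ^+ 2 = p ^+ 2 + q ^+ 2.
  by rewrite pE qE !exprMn -mulrDr cos2Dsin2 mulr1.
have pq : p ^+ 2 + q ^+ 2 != 0.
  by rewrite pE qE !exprMn -mulrDr cos2Dsin2 mulr1 expf_neq0 // gt_eqF.
by rewrite /D /C; field.
Qed.

Variables (a1 b1 a2 b2 : R).
Hypotheses (ab1 : a1 <= b1) (ab2 : a2 <= b2).
Let K : set (R * R) := `[a1, b1] `*` `[a2, b2].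
Variables (p q : R * R -> R).
Hypotheses (cp : {within K, continuous p}) (cq : {within K, continuous q}).
Hypothesis pq0 : forall z, K z -> 0 < p z ^+ 2 + q z ^+ 2.

Let shrink (s : R) (z : R * R) : R * R := (a1 + s * (z.1 - a1), a2 + s * (z.2 - a2)).

Let shrinkK s z : 0 <= s <= 1 -> K z -> K (shrink s z).
Proof.
move=> /andP[s0 s1] [/=]; rewrite !in_itv /= => /andP[h1 h2] /andP[h3 h4].
by split; rewrite /= in_itv /=; apply/andP; split; nra.
Qed.

Let shrink_cvg (f : R * R -> R) s z : 0 <= s <= 1 -> K z -> {within K, continuous f} ->
  (fun z => f (shrink s z)) @ within K (nbhs z) --> f (shrink s z).
Proof.
move=> s01 Kz /within_cvgP cf.
have h : (fun z => shrink s z) @ nbhs z --> shrink s z.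
  apply: (@cvg_pair _ _ _ _ (nbhs (a1 + s * (z.1 - a1))) (nbhs (a2 + s * (z.2 - a2)))).
    apply: cvgD; [exact: cvg_cst | apply: cvgM; [exact: cvg_cst|]].
    by apply: cvgB; [exact: cvg_fst | exact: cvg_cst].
  apply: cvgD; [exact: cvg_cst | apply: cvgM; [exact: cvg_cst|]].
  by apply: cvgB; [exact: cvg_snd | exact: cvg_cst].
move=> B nB; have := cf _ (shrinkK s01 Kz) B nB; rewrite /= /within /= => nB'.
have : \forall y \near z, K (shrink s y) -> B (f (shrink s y)) := h _ nB'.
by apply: filterS => y hy Ky; apply: hy; apply: shrinkK.
Qed.

Let uniform : exists2 d : R, 0 < d & forall z w, K z -> K w -> ball z d w ->
  0 < p z * p w + q z * q w.
Proof.
have cK : compact K by apply: compact_setX; apply: segment_compact.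
have /compact_near_coveringP ncK := cK.
have : \forall d \near (0 : R)^'+, K `<=` [set z | forall w, K z -> K w -> ball z d w ->
    0 < p z * p w + q z * q w].
  apply: ncK => x Kx.
  (* This and [P2] say that the value at y has an argument within pi/4 of that at x; two such values
     are then less than pi/2 apart. *)
  have P1 : \forall y \near x, K y -> 0 < p x * p y + q x * q y - (p x * q y - q x * p y).
    have /within_cvgP/(_ x Kx) hp := cp; have /within_cvgP/(_ x Kx) hq := cq.
    have : (fun y => p x * p y + q x * q y - (p x * q y - q x * p y)) @ within K (nbhs x) -->
        p x * p x + q x * q x - (p x * q x - q x * p x).
      apply: cvgB; [apply: cvgD|apply: cvgB]; by apply: cvgM => //; apply: cvg_cst.
    move/cvgr_gt => /(_ 0); rewrite -!expr2 [q x * _]mulrC subrr subr0 => /(_ (pq0 Kx)).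
    by rewrite near_withinE.
  have P2 : \forall y \near x, K y -> 0 < p x * p y + q x * q y + (p x * q y - q x * p y).
    have /within_cvgP/(_ x Kx) hp := cp; have /within_cvgP/(_ x Kx) hq := cq.
    have : (fun y => p x * p y + q x * q y + (p x * q y - q x * p y)) @ within K (nbhs x) -->
        p x * p x + q x * q x + (p x * q x - q x * p x).
      apply: cvgD; [apply: cvgD|apply: cvgB]; by apply: cvgM => //; apply: cvg_cst.
    move/cvgr_gt => /(_ 0); rewrite -!expr2 [q x * _]mulrC subrr addr0 => /(_ (pq0 Kx)).
    by rewrite near_withinE.
  have /nbhs_ballP[r r0 hr] : nbhs x [set y | K y -> 0 < p x * p y + q x * q y - (p x * q y - q x * p y) /\
      0 < p x * p y + q x * q y + (p x * q y - q x * p y)].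
    by apply: filterS2 P1 P2 => y h1 h2 Ky; split; [apply: h1 | apply: h2].
  have {}r0 : 0 < r by [].
  exists (ball x (r / 2), [set d : R | d < r / 2]).
    split; first by apply: nbhsx_ballx; rewrite divr_gt0.
    by apply: nbhs_right_lt; rewrite divr_gt0.
  move=> [z d] [/= xz dr] w Kz Kw zw.
  have xz' : ball x r z by apply: le_ball xz; rewrite ler_pdivrMr //; lra.
  have xw : ball x r w.
    rewrite [r]splitr; apply: ball_triangle xz _; apply: le_ball zw; exact: ltW.
  have [z1 z2] := hr _ xz' Kz; have [w1 w2] := hr _ xw Kw.
  (* For plane vectors, |x|^2 (z . w) = (x . z)(x . w) + (x ^ z)(x ^ w), which is half the sum of
     the two positive products supplied next. *)
  rewrite -(pmulr_rgt0 _ (pq0 Kx)).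
  have := mulr_gt0 z1 w1; have := mulr_gt0 z2 w2; nra.
move=> h; have [d [d0 hd]] : exists d : R, 0 < d /\ K `<=` [set z | forall w, K z -> K w -> ball z d w ->
    0 < p z * p w + q z * q w].
  by apply: (@filter_ex _ (0^'+ : set_system R)); apply: filterI h; apply: nbhs_right_gt.
by exists d => // z w Kz Kw; apply: hd.
Qed.

(* A continuous nonvanishing function on a rectangle is a telescoping product of
   ratios along the segment from a corner; by uniform continuity the ratios stay
   in the right half-plane, where atan gives the argument. *)
Lemma rectangle_lift : exists g : R * R -> R, {within K, continuous g} /\
  forall z, K z -> exists r, [/\ 0 < r, p z = r * cos (g z) & q z = r * sin (g z)].
Proof.
have [d d0 hd] := uniform.
(* The segment from the corner to any point of the rectangle is cut into N + 1 pieces, each shorter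
   than the uniform distance d in both coordinates. *)
have [N hN] : exists N : nat, b1 - a1 < d * N.+1%:R /\ b2 - a2 < d * N.+1%:R.
  pose M := Num.max (b1 - a1) (b2 - a2).
  have hM := Num.Theory.truncnS_gt (M / d); exists (Num.trunc (M / d)).
  have : M < d * (Num.trunc (M / d)).+1%:R by rewrite mulrC -ltr_pdivrMr.
  by rewrite gt_max => /andP[].
pose s (i : nat) : R := i%:R / N.+1%:R.
have s01 i : (i <= N.+1)%N -> 0 <= s i <= 1.
  by move=> iN; rewrite divr_ge0 //= ler_pdivrMr ?ltr0n // mul1r ler_nat.
pose c i z := shrink (s i) z.
have K0 : K (a1, a2) by split; rewrite /= in_itv /= lexx.
have dot i z : (i < N.+1)%N -> K z -> 0 < p (c i z) * p (c i.+1 z) + q (c i z) * q (c i.+1 z).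
  move=> iN Kz; apply: hd; [by apply: shrinkK => //; apply: s01; apply: ltnW | by apply: shrinkK => //; apply: s01|].
  have ds : s i.+1 = s i + N.+1%:R^-1 by rewrite /s -natr1 mulrDl mul1r.
  have bound (a b x : R) : a <= x <= b -> b - a < d * N.+1%:R ->
      `|a + s i * (x - a) - (a + s i.+1 * (x - a))| < d.
    move=> /andP[ax xb] h; rewrite ds.
    have -> : a + s i * (x - a) - (a + (s i + N.+1%:R^-1) * (x - a)) = - ((x - a) / N.+1%:R) by ring.
    rewrite normrN ger0_norm ?divr_ge0 ?subr_ge0 // ltr_pdivrMr ?ltr0n //.
    by apply: le_lt_trans h; rewrite lerD2r.
  by case: Kz => /=; rewrite !in_itv /= => h1 h2; case: hN => n1 n2; split; [exact: (bound _ _ _ h1 n1)|exact: (bound _ _ _ h2 n2)].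
have [r0 [t0 [r00 E0]]] : exists r0 t0, 0 < r0 /\ (p (a1, a2) = r0 * cos t0 /\ q (a1, a2) = r0 * sin t0).
  have [|r [t [r0 E]]] := @polar R (p (a1, a2) +i* q (a1, a2))%C.
    rewrite eq_complex /=; apply: contraTN (pq0 K0) => /andP[/eqP -> /eqP ->].
    by rewrite expr0n /= addr0 ltxx.
  exists r, t; split => //; move/eqP: E; rewrite eq_complex /= !mul0r subr0 addr0.
  by move=> /andP[/eqP -> /eqP ->].
pose a i z := atan ((p (c i z) * q (c i.+1 z) - q (c i z) * p (c i.+1 z)) /
                    (p (c i z) * p (c i.+1 z) + q (c i z) * q (c i.+1 z))).
pose g k z := t0 + \sum_(i < k) a i z.
exists (g N.+1); split.
  apply/within_cvgP => z Kz; apply: cvgD; first exact: cvg_cst.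
  apply: cvg_bigsum => i _.
  have cc (f : R * R -> R) (k : nat) : (k <= N.+1)%N -> {within K, continuous f} ->
      (fun z => f (c k z)) @ within K (nbhs z) --> f (c k z).
    by move=> kN; apply: shrink_cvg => //; apply: s01.
  have iN := ltn_ord i; have iN' := ltnW iN.
  apply: (@continuous_cvg _ _ _ _ _ _ (@atan R)); first exact: continuous_atan.
  apply: cvgM; first by apply: cvgB; apply: cvgM; apply: cc.
  apply: cvgV; first by rewrite gt_eqF // dot.
  by apply: cvgD; apply: cvgM; apply: cc.
move=> z Kz.
have step k : (k <= N.+1)%N -> exists r, [/\ 0 < r, p (c k z) = r * cos (g k z) & q (c k z) = r * sin (g k z)].
  elim: k => [_|k IH kN].
    have -> : c 0 z = (a1, a2) by rewrite /c /shrink /s !mul0r !addr0.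
    by exists r0; rewrite /g big_ord0 addr0; case: E0.
  have [r [rp pE qE]] := IH (ltnW kN).
  have [r' h] := rotate_step rp pE qE (dot k z kN Kz).
  by exists r'; rewrite /g big_ord_recr /= addrA.
have := step N.+1 (leqnn _); rewrite (_ : c N.+1 z = z) //.
rewrite /c /shrink /s divff ?pnatr_eq0 // !mul1r ![_ + (_ - _)]addrC !subrK.
by case: (z).
Qed.

End Lift.

(** * The Robbin-Salamon index *)

Section RegularIndex.
Context {R : realType} {n : nat}.
Implicit Types (W : 'M[R]_(n + n)) (A : {vspace 'rV[R]_(n + n)}).

Lemma spans_basis m (V : {vspace 'rV[R]_m}) :
  exists B : 'M[R]_(\dim V, m), row_free B /\ spans B V.
Proof.
pose B := \matrix_(i < \dim V) tnth (vbasis V) i.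
have hB : spans B V.
  move=> v; split=> [vV|/submxP[u ->]].
    rewrite (coord_vbasis vV); apply: summx_sub => i _; apply: scalemx_sub.
    by have -> : (vbasis V)`_i = row i B; [rewrite rowK (tnth_nth 0) | apply: row_sub].
  rewrite mulmx_sum_row memv_suml // => i _; rewrite memvZ // rowK.
  by apply: vbasis_mem; apply: mem_tnth.
by exists B; split=> //; rewrite /row_free -(spans_dim hB).
Qed.

Lemma is_frame_spans k (F : 'M[R]_(k, n + n)) V : is_frame F V -> row_free F /\ spans F V.
Proof. by move=> [fF <-]; split => // v; rewrite mem_rowspace. Qed.

Lemma lagrangian_lagframe W (F : 'M[R]_(n, n + n)) N V : row_free F -> spans F V ->
  lagrangian W N V -> lagframe W F.
Proof.
move=> fF sF [_ _ h]; split=> //; apply/matrixP => i j; rewrite [RHS]mxE.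
have := h _ _ (spans_row sF i) (spans_row sF j); rewrite /Defs.form => <-.
rewrite -row_mul [LHS]mxE [RHS]mxE; apply: eq_bigr => k _.
by rewrite [row i _ _ _]mxE !mxE.
Qed.

(** Where the imaginary part B Y vanishes, the vectors lie in the isotropic row space of F0, so only
    the imaginary part of the derivative contributes to the crossing form. *)
Lemma crossing_formE W (F0 : 'M[R]_(n, n + n)) (G : R -> 'M[R]_(n, n + n)) t m (B : 'M[R]_(m, n)) (c : 'rV_m) :
  hermitian_form W -> lagframe W F0 -> B *m coord_im F0 (G t) = 0 ->
  let G' := \matrix_(i, j) derive1 (fun r => G r i j) t in
  crossing_form W G t (c *m B) (c *m B) =
  (c *m (B *m coord_re F0 (G t) *m (F0 *m (W *m Jmx^T) *m F0^T) *m (B *m coord_im F0 G')^T) *m c^T) 0 0.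
Proof.
move=> hW lF BY G'; have uF := lagframe_unit hW lF.
rewrite /crossing_form /Defs.form -/G'; congr (_ 0 0).
have -> : c *m B *m G t = (c *m B *m coord_re F0 (G t)) *m F0 + 0 *m F0 *m Jmx.
  rewrite {1}(coordE (G t) uF) mulmxDr !mulmxA -(mulmxA c B (coord_im _ _)) BY mulmx0 !mul0mx.
  by [].
have -> : c *m B *m G' = (c *m B *m coord_re F0 G') *m F0 + (c *m B *m coord_im F0 G') *m F0 *m Jmx.
  by rewrite {1}(coordE G' uF) mulmxDr !mulmxA.
rewrite (form_coord _ _ _ _ hW lF.2) !mul0mx subr0 -(mulmxA c B (coord_im _ _)).
by rewrite (trmx_mul c) !mulmxA.
Qed.

Lemma trmx_sandwich p q r (A : 'M[R]_(p, q)) (B : 'M[R]_(r, q)) (M : 'M[R]_q) :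
  (A *m M *m B^T)^T = B *m M^T *m A^T.
Proof. by rewrite !trmx_mul trmxK mulmxA. Qed.

Section Crossing.
Variables (W : 'M[R]_(n + n)) (F0 : 'M[R]_(n, n + n)) (G : R -> 'M[R]_(n, n + n)) (t0 : R).
Hypotheses (hW : hermitian_form W) (lF : lagframe W F0).
Hypothesis dG : forall i j, derivable (fun r => G r i j) t0 1.

Let P := F0 *m (W *m Jmx^T) *m F0^T.
Let G' := \matrix_(i, j) derive1 (fun r => G r i j) t0.
Let X t := coord_re F0 (G t).
Let Y t := coord_im F0 (G t).

Lemma derivable_mxcvg : mxcvg (Fi := nbhs t0) G (G t0).
Proof.
by move=> i j; apply/differentiable_continuous/derivable1_diffP.
Qed.

Let quotient_cvg : mxcvg (Fi := t0^') (fun t => (t - t0)^-1 *: (G t - G t0)) G'.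
Proof.
move=> i j; rewrite mxE derive1E.
have sh : (fun t => t - t0) @ t0^' --> (0 : R)^'.
  have c0 : (fun t => t - t0) @ t0 --> (0 : R).
    by rewrite -[X in _ --> X](subrr t0); apply: cvgB; [exact: cvg_id | exact: cvg_cst].
  move=> S S0; have S1 : \forall h \near (0 : R), h != 0 -> S h := S0.
  have S2 : \forall t \near t0, t - t0 != 0 -> S (t - t0) := c0 _ S1.
  suff : \forall t \near t0, t != t0 -> S (t - t0) by [].
  by apply: filterS S2 => t h tt0; apply: h; rewrite subr_eq0.
have := cvg_comp _ _ sh (@dG i j); apply: cvg_trans.
apply: near_eq_cvg; apply: filterE => t /=.
by rewrite !mxE [_%:A]mulr1 subrK.
Qed.

(* To first order in t - t0 the window form near 0 is the crossing form. *)
Lemma crossing_count (sigma : R) m (B : 'M[R]_(m, n)) e :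
  sigma ^+ 2 = 1 -> 0 < e -> 4 * e <= 1 -> B *m Y t0 = 0 ->
  (forall c : 'rV_m, c != 0 -> 0 < sigma * crossing_form W G t0 (c *m B) (c *m B)) ->
  \forall t \near t0^', forall E alpha, angles W F0 (G t) E alpha ->
    (0 < sigma * (t - t0) -> (m <= #|[pred j | (alpha j < e)%R]|)%N) /\
    (sigma * (t - t0) < 0 -> (m <= #|[pred j | (2^-1 - e < alpha j)%R]|)%N).
Proof.
move=> s2 e0 e4 BY pos; have pi0 := @pi_gt0 R; have uF := lagframe_unit hW lF.
(* The window from 0 to b detects angles in (0, e), the window from -b to 0 angles in (1/2 - e,
   1/2). The sign [sigma] treats the positive and the negative part of the crossing form
   together. *)
pose b := 2 * pi * e.
have sb : 0 < sin b by apply: sin_gt0_pi; rewrite /b; apply/andP; split; nra.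
pose Y' := coord_im F0 G'.
(* Since B Y(t0) = 0, the left factor of the window form is an increment; its difference quotient
   has a limit, while the form itself degenerates at t0. *)
have cU : mxcvg (Fi := t0^') (fun t => (t - t0)^-1 *: (B *m Y t)) (B *m Y').
  have lin (M : 'M[R]_(n, n + n)) : coord_im F0 M = M *m rsubmx (invmx (col_mx F0 (F0 *m Jmx))).
    by rewrite /coord_im mulmx_rsub.
  apply: (@mxcvg_near _ _ _ _ _ _
    (fun t => B *m (((t - t0)^-1 *: (G t - G t0)) *m rsubmx (invmx (col_mx F0 (F0 *m Jmx)))))).
    apply: filterE => t; rewrite -scalemxAl mulmxBl -!lin -scalemxAr mulmxBr.
    by rewrite -/(Y t) -/(Y t0) BY subr0.
  rewrite /Y' lin; apply: mxcvgM; first exact: mxcvg_cst.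
  by apply: mxcvgM; [exact: quotient_cvg | exact: mxcvg_cst].
have [cX0 cY0] := @coord_cvg R n R (nbhs t0) _ (fun=> F0) G W F0 (G t0)
  (@mxcvg_cst R R (nbhs t0) _ _ _ F0) derivable_mxcvg hW lF.
have cX : mxcvg (Fi := t0^') X (X t0).
  by move=> i j; apply: cvg_trans (cX0 i j); apply: cvg_app; apply: nbhs_dnbhs.
have cY : mxcvg (Fi := t0^') Y (Y t0).
  by move=> i j; apply: cvg_trans (cY0 i j); apply: cvg_app; apply: nbhs_dnbhs.
have cstZ p (k : R) (M : R -> 'M[R]_(p, n)) M0 : mxcvg (Fi := t0^') M M0 ->
    mxcvg (Fi := t0^') (fun y => k *: M y) (k *: M0).
  by move=> ?; apply: mxcvgZ => //; apply: cvg_cst.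
have lim (u v : R) : mxcvg (Fi := t0^')
    (fun t => (sigma *: ((t - t0)^-1 *: (B *m Y t))) *m P *m (B *m (u *: X t - v *: Y t))^T)
    (sigma *: (B *m Y') *m P *m (B *m (u *: X t0 - v *: Y t0))^T).
  apply: mxcvgM; first by apply: mxcvgM; [apply: cstZ | exact: mxcvg_cst].
  apply: mxcvg_tr; apply: mxcvgM; first exact: mxcvg_cst.
  by apply: mxcvgD; [|apply: mxcvgN]; apply: cstZ.
(* The term with B Y(t0) drops out, and what remains is sin b > 0 times the crossing form on the
   rows of B, up to transposition and the sign. *)
have posL v : posdef (sigma *: (B *m Y') *m P *m (B *m (sin b *: X t0 - v *: Y t0))^T).
  move=> c c0; rewrite mulmxBr -!scalemxAr BY scaler0 subr0 trmxZ -scalemxAr -!scalemxAl.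
  rewrite -!scalemxAr -!scalemxAl mxE [(_ *: (c *m _ *m _)) 0 0]mxE mulr_gt0 //.
  have := pos c c0; rewrite (crossing_formE c hW lF BY) -/G' -/Y' -/P -/(X t0).
  congr (0 < _ * _).
  have PT : P^T = P by rewrite /P !trmx_mul trmxK -trmx_mul hermitian_sym // !mulmxA.
  have -> : c *m (B *m Y' *m P *m (B *m X t0)^T) *m c^T =
      (c *m (B *m X t0 *m P *m (B *m Y')^T) *m c^T)^T.
    by rewrite [RHS]trmx_sandwich trmx_sandwich PT.
  by rewrite [RHS]mxE.
have near1 (v : R) := posdef_near (lim (sin b) v) (posL v).
have w1 (t : R) : B *m window_form W F0 (G t) 0 b *m B^T = 
    (B *m Y t) *m P *m (B *m (sin b *: X t - cos b *: Y t))^T.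
  by rewrite /window_form cos0 sin0 scale1r scale0r subr0 (trmx_mul B) !mulmxA.
have w2 (t : R) : B *m window_form W F0 (G t) (- b) 0 *m B^T =
    - (B *m Y t *m P *m (B *m (sin b *: X t + cos b *: Y t))^T)^T.
  have PT : P^T = P by rewrite /P !trmx_mul trmxK -trmx_mul hermitian_sym // !mulmxA.
  rewrite /window_form cos0 sin0 scale1r scale0r sub0r cosN sinN scaleNr opprK !trmxN !mulmxN mulNmx.
  rewrite trmx_sandwich PT (trmx_mul B) (addrC (sin b *: _)) (mulmxDr B).
  by rewrite -mulmxDr !mulmxA.
have posZ m' (k : R) (M : 'M[R]_m') : 0 < k -> posdef (k *: M) -> posdef M.
  by move=> k0 h v v0; have := h v v0; rewrite -scalemxAr -scalemxAl mxE pmulr_rgt0.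
have posT m' (M : 'M[R]_m') : posdef M -> posdef M^T.
  move=> h v v0; have := h v v0; have -> : v *m M^T *m v^T = (v *m M *m v^T)^T.
    by rewrite trmx_sandwich.
  by rewrite [X in _ -> 0 < X]mxE.
have inv_gt0 (x : R) : 0 < sigma * x -> 0 < sigma * x^-1.
  move=> h; have x0 : x != 0 by apply: contraTneq h => ->; rewrite mulr0 ltxx.
  have -> : sigma * x^-1 = sigma * x * x^-1 ^+ 2 by rewrite expr2 mulrA mulfK.
  by rewrite mulr_gt0 // exprn_even_gt0 //= invr_eq0.
apply: filterS2 (near1 _ (cos b)) (near1 _ (- cos b)) => t p1 p2 E alpha ang.
have [_ _ al _] := ang; split=> st.
  have : posdef (B *m window_form W F0 (G t) 0 b *m B^T).
    apply: (posZ _ _ _ (inv_gt0 _ st)); rewrite w1; move: p1.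
    by rewrite scalerA -!scalemxAl.
  move=> /(window_le hW lF ang) /leq_trans; apply; apply: subset_leq_card.
  apply/fintype.subsetP => j; rewrite !inE /= subr0 => h; have /andP[a0 a1] := al j.
  rewrite ltNge; apply: contraTN h => ea; rewrite -leNgt.
  have s1 : 0 <= sin (2 * pi * alpha j) by apply: sin_ge0_pi; apply/andP; split; nra.
  have s3 : 0 <= sin (2 * pi * alpha j - b) by apply: sin_ge0_pi; rewrite /b; apply/andP; split; nra.
  by rewrite -opprB sinN mulrN oppr_le0 mulr_ge0.
have : posdef (B *m window_form W F0 (G t) (- b) 0 *m B^T).
  rewrite w2 -trmxN; apply: posT; apply: (posZ _ (sigma * - (t - t0)^-1)).
    by rewrite -invrN inv_gt0 // mulrN oppr_gt0.
  move: p2; rewrite mulrN scaleNr scalerN opprK scaleNr opprK.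
  by rewrite scalerA -!scalemxAl.
move=> /(window_le hW lF ang) /leq_trans; apply; apply: subset_leq_card.
apply/fintype.subsetP => j; rewrite !inE /= opprK sub0r sinN mulrN oppr_gt0 => h.
have /andP[a0 a1] := al j.
rewrite ltNge; apply: contraTN h => ea; rewrite -leNgt.
have s1 : 0 <= sin (2 * pi * alpha j) by apply: sin_ge0_pi; apply/andP; split; nra.
have s3 : 0 <= sin (2 * pi * alpha j + b) by apply: sin_ge0_pi; rewrite /b; apply/andP; split; nra.
exact: mulr_ge0.
Qed.

End Crossing.

(** Two systems of angles of the same pair have the same window counts, so their sums differ by at
    most n e for every small e, once it is excluded that angles of one system lie near 1/2. *)
Lemma angles_sum_uniq W (F G : 'M[R]_(n, n + n)) E alpha E' alpha' :
  hermitian_form W -> lagframe W F -> row_free G ->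
  angles W F G E alpha -> angles W F G E' alpha' -> \sum_j alpha j = \sum_j alpha' j.
Proof.
move=> hW lF fG ang ang'; have [_ _ b _] := ang; have [_ _ b' _] := ang'.
have [r1 _] := rank_angles hW lF fG ang; have [r1' _] := rank_angles hW lF fG ang'.
apply/esym/eqP; rewrite -subr_eq0 -normr_le0; apply/ler_addgt0Pl => d d0.
have dn : 0 < d / n.+1%:R by rewrite divr_gt0.
have [e sep ed] := well_separated_exists b dn; have [e0 e4 _ _ _] := sep.
have [] := angles_cluster sep b b' _.
  move=> i; set w := window alpha (2 * pi * (alpha i - e)) (2 * pi * (alpha i + e)).
  have l1 : (#|[pred j | alpha j == alpha i]| <= #|w|)%N.
    by apply: subset_leq_card; apply/fintype.subsetP => j; rewrite inE => /eqP; apply: self_window.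
  have [K pK] := window_attained (2 * pi * (alpha i - e)) (2 * pi * (alpha i + e)) hW lF ang.
  apply: leq_trans l1 _; apply: leq_trans (window_le hW lF ang' pK) _.
  apply: subset_leq_card; apply/fintype.subsetP => j.
  by move/(window_close e0 e4 (b i) (b' j)).
rewrite -r1 r1' => h1 h2.
(* The number of zero angles is the dimension of the intersection for both systems, so the zeros
   alone fill the cluster at 0 and leave no room near 1/2. *)
have N0 : #|[pred j | (2^-1 - e < alpha' j)%R]| = 0%N.
  apply: eq_card0 => j; rewrite !inE; apply/negbTE/negP => aj.
  have sub : [pred j | alpha' j == 0%R] \subset [pred j | (alpha' j < e)%R || (2^-1 - e < alpha' j)%R].
    by apply/fintype.subsetP => k; rewrite !inE => /eqP ->; rewrite e0.
  have := subset_cardP (esym h2) sub j; rewrite !inE aj orbT => /eqP h.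
  by move: aj; rewrite h; lra.
move: h1; rewrite N0 mulr0 subr0 => /le_trans; apply; rewrite addr0.
apply: le_trans (_ : n%:R * (d / n.+1%:R) <= _); first by rewrite ler_wpM2l // ltW.
rewrite mulrA ler_pdivrMr ?ltr0n // mulrC.
by apply: ler_wpM2l; rewrite ?ler_nat // ltW.
Qed.

Lemma crossing_space_spans W A (F0 : 'M[R]_(n, n + n)) (G : R -> 'M[R]_(n, n + n)) t :
  hermitian_form W -> lagframe W F0 -> spans F0 A ->
  spans (kermx (coord_im F0 (G t))) (crossing_space G A t).
Proof.
move=> hW lF sF; have uF := lagframe_unit hW lF.
have E (a : 'rV[R]_n) : a *m G t \in A <-> (a <= kermx (coord_im F0 (G t)))%MS.
  rewrite sF sub_kermx; split=> [/submxP[b bE]|/eqP aY].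
    rewrite -(coord_mull F0 a (G t)).2 bE.
    by have [_] := coord_uniq b 0 uF; rewrite !mul0mx addr0 => ->.
  rewrite {1}(coordE (G t) uF) mulmxDr !mulmxA aY !mul0mx addr0.
  exact: submxMl.
have [V hV] := spans_exists (kermx (coord_im F0 (G t))).
move=> a; rewrite -E; apply: vspace_ofP; exists V => w; rewrite E; exact: hV.
Qed.

Lemma signature_dims m (B : 'rV[R]_m -> 'rV[R]_m -> R) (K : {vspace 'rV[R]_m}) s :
  nondegenerate_signature B K s -> exists Kp Kn : {vspace 'rV[R]_m},
  [/\ (\dim Kp + \dim Kn = \dim K)%N, s = (\dim Kp)%:Z - (\dim Kn)%:Z,
      (Kp <= K)%VS /\ (Kn <= K)%VS, forall v, v \in Kp -> v != 0 -> 0 < B v v &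
      forall v, v \in Kn -> v != 0 -> B v v < 0].
Proof.
move=> [Kp [Kn [KE hp hn _ sE]]]; exists Kp, Kn; split=> //; last first.
  by rewrite -KE addvSl addvSr.
rewrite -KE dimv_disjoint_sum //; apply/eqP; rewrite -subv0; apply/subvP => v.
rewrite memv_cap memv0 => /andP[vp vn]; apply: contraT => v0.
by have := lt_trans (hp v vp v0) (hn v vn v0); rewrite ltxx.
Qed.

Lemma near_seq (T : eqType) (U : Type) (Fi : set_system U) (FF : Filter Fi) (s : seq T)
    (Q : T -> U -> Prop) : (forall c, c \in s -> \forall u \near Fi, Q c u) ->
  \forall u \near Fi, forall c, c \in s -> Q c u.
Proof.
elim: s => [|c s IH] h; first exact: filterE.
have h1 := h c (mem_head c s); have h2 : \forall u \near Fi, forall c, c \in s -> Q c u.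
  by apply: IH => d ds; apply: h; rewrite inE ds orbT.
by apply: filterS2 h1 h2 => u q1 q2 d; rewrite inE => /orP[/eqP ->|/q2].
Qed.

Lemma sum_delta (T : eqType) (s : seq T) (t : T) (f : T -> R) : uniq s ->
  \sum_(c <- s) (c == t)%:R * f c = (t \in s)%:R * f t.
Proof.
elim: s => [|c s IH]; first by rewrite big_nil mul0r.
move=> /= /andP[cs us]; rewrite big_cons IH // inE eq_sym.
have [tc|_] /= := eqVneq t c; last by rewrite mul0r add0r.
by rewrite tc (negPf cs) mul0r addr0.
Qed.

(** * The index of a path with regular crossings *)

Section Formula.
Variables (W : 'M[R]_(n + n)) (A : {vspace 'rV[R]_(n + n)}) (F0 : 'M[R]_(n, n + n)).
Variables (lam : R -> {vspace 'rV[R]_(n + n)}) (a : R[i]) (theta : R -> R).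
Variables (G : R -> 'M[R]_(n, n + n)) (crossings : seq R) (sg : R -> int).
Hypotheses (hW : hermitian_form W) (lF : lagframe W F0) (sF : spans F0 A) (a0 : a != 0).
Hypothesis lag : forall t, t \in `[0, 1] -> lagrangian W fullv (lam t).
Hypothesis lam0 : lam 0 = A.
Hypothesis ctheta : {within `[0, 1], continuous theta}.
Hypothesis det2 : forall t, t \in `[0, 1] -> Det2 (nform a) (lam t) (expi (2 * pi * theta t)).
Hypothesis dG : forall i j t, derivable (fun r => G r i j) t 1.
Hypothesis frG : forall t, t \in `[0, 1] -> is_frame (G t) (lam t).
Hypothesis ucr : uniq crossings.
Hypothesis crP : forall t, (t \in crossings) <-> (t \in `[0, 1]) /\ (lam t :&: A)%VS <> 0%VS.
Hypothesis sgP : forall t, t \in crossings ->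
  nondegenerate_signature (crossing_form W G t) (crossing_space G A t) (sg t).

Let in0 : (0 : R) \in `[0, 1]. Proof. by rewrite in_itv /= lexx ler01. Qed.
Let in1 : (1 : R) \in `[0, 1]. Proof. by rewrite in_itv /= lexx ler01. Qed.

Let lG t : t \in `[0, 1] -> lagframe W (G t) /\ spans (G t) (lam t).
Proof.
move=> t01; have [fG sG] := is_frame_spans (frG t01); split=> //.
exact: lagrangian_lagframe fG sG (lag t01).
Qed.

Let rank_zero t E alpha : t \in `[0, 1] -> angles W F0 (G t) E alpha ->
  [/\ \dim (crossing_space G A t) = #|[pred j | alpha j == 0%R]|,
      (t \notin crossings -> #|[pred j | alpha j == 0%R]| = 0%N) &
      (t = 0 -> #|[pred j | alpha j == 0%R]| = n)].
Proof.
move=> t01 ang; have [[fG GG] sG] := lG t01.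
have [r1 r2] := rank_angles hW lF fG ang; split.
- rewrite (spans_dim (crossing_space_spans G t hW lF sF)) mxrank_ker.
  by rewrite -{1}r2 addKn.
- move=> tc; rewrite -r1 -(spans_dim (spans_cap sF sG)).
  have : ~ (lam t :&: A)%VS <> 0%VS by move=> h; case/negP: tc; apply/crP.
  by rewrite capvC => /contrapT ->; rewrite dimv0.
- move=> tE; rewrite -r1 -(spans_dim (spans_cap sF sG)) tE lam0 capvv.
  by rewrite (spans_dim sF); exact/eqP/lF.1.
Qed.

Let phase t E alpha : t \in `[0, 1] -> angles W F0 (G t) E alpha ->
  exists k : int, theta t - theta 0 - 2 * (\sum_j alpha j) = k%:~R.
Proof.
move=> t01 ang; have [_ sG] := lG t01.
apply: (angles_phase hW a0 lF ang (V0 := lam 0) (V1 := lam t)).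
- by rewrite lam0; apply: spans_row.
- exact: spans_row.
- exact: det2.
- exact: det2.
Qed.

(** Here p and q are the dimensions of the positive and negative parts of the crossing form. A
    positive direction gives an angle that leaves 0 upwards after t0 and came from below 1/2 before
    t0; a negative direction does the opposite. Only the angles near 1/2 lower D, hence by q after
    and by p before t0. *)
Lemma local_jump (al : R -> 'I_n -> R) :
  (forall t, t \in `[0, 1] -> exists E, angles W F0 (G t) E (al t)) ->
  let D t := theta t - theta 0 - 2 * (\sum_j al t j) in
  forall t0, t0 \in `[0, 1] -> exists p q : nat,
  [/\ (p + q = #|[pred j | al t0 j == 0%R]|)%N,
      t0 \in crossings -> sg t0 = p%:Z - q%:Z &
      \forall t \near t0, t \in `[0, 1] ->
        (t0 < t -> D t = D t0 - q%:R) /\ (t < t0 -> D t = D t0 - p%:R)].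
Proof.
move=> alP D t0 t01; have [E0 ang0] := alP t0 t01; have [_ _ b0 _] := ang0.
have n1 : 0 < (4 * n.+1%:R)^-1 :> R by rewrite invr_gt0 mulr_gt0.
have [e sep en] := well_separated_exists b0 n1; have [e0 e4 _ _ _] := sep.
have ne : 4 * (n%:R * e) < 1.
  have h : e * (4 * n.+1%:R) < 1 by rewrite -ltr_pdivlMr ?mulr_gt0 // div1r.
  have : n%:R * e <= n.+1%:R * e by rewrite ler_wpM2r ?ler_nat // ltW.
  lra.
have cG : mxcvg (Fi := within `[0, 1] (nbhs t0)) G (G t0).
  move=> i j; have := @derivable_mxcvg G t0 (fun i j => @dG i j t0) i j.
  by apply: cvg_trans; apply: cvg_app; apply: cvg_within.
have cth : (fun t => theta t - theta 0) @ within `[0, 1] (nbhs t0) --> theta t0 - theta 0.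
  by apply: cvgB; [exact: (within_cvgP _ _).1 ctheta t0 t01 | exact: cvg_cst].
have near1 := @index_near R n R (within `[0, 1] (nbhs t0)) _ (fun=> W) (fun=> F0) G W F0 (G t0) E0 (al t0)
  (@mxcvg_cst R R (within `[0, 1] (nbhs t0)) _ _ _ W) (@mxcvg_cst R R (within `[0, 1] (nbhs t0)) _ _ _ F0)
  cG hW lF ang0 (fun t => theta t - theta 0) (theta t0 - theta 0) cth (phase t01 ang0) e sep ne.
have main (p q : nat) : (p + q = #|[pred j | al t0 j == 0%R]|)%N ->
    (\forall t \near t0^', forall E alpha, angles W F0 (G t) E alpha ->
      (t0 < t -> (p <= #|[pred j | (alpha j < e)%R]|)%N /\ (q <= #|[pred j | (2^-1 - e < alpha j)%R]|)%N) /\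
      (t < t0 -> (q <= #|[pred j | (alpha j < e)%R]|)%N /\ (p <= #|[pred j | (2^-1 - e < alpha j)%R]|)%N)) ->
    \forall t \near t0, t \in `[0, 1] ->
        (t0 < t -> D t = D t0 - q%:R) /\ (t < t0 -> D t = D t0 - p%:R).
  move=> pq near2.
  do 6?[move: near1 => /(_ _) near1].
  rewrite near_withinE in near1; rewrite near_withinE in near2.
  apply: filterS2 near1 near2 => t h1 h2 t1.
  have [E ang] := alP t t1; have [_ _ b _] := ang.
  have [DE cE] := h1 t1 hW lF E (al t) ang (phase t1 ang).
  (* The cluster at 0 has exactly p + q members, so the two lower bounds given by the crossing form
     must both be equalities. *)
  have dis : (#|[pred j | (al t j < e)%R]| + #|[pred j | (2^-1 - e < al t j)%R]| = p + q)%N.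
    rewrite pq -cE -cardUI [X in (_ + X)%N](_ : _ = 0%N) ?addn0.
      by apply: eq_card => j; rewrite !inE.
    apply: eq_card0 => j; rewrite !inE; apply/negbTE/negP => /andP[]; lra.
  split=> tt; rewrite /D DE; congr (_ - _%:R).
    have [|/(_ tt)[] h3 h4 _] := h2 _ E (al t) ang; first by rewrite gt_eqF.
    by apply/eqP; rewrite eqn_leq h4 andbT -(leq_add2l p) -dis leq_add2r.
  have [|_ /(_ tt)[] h3 h4] := h2 _ E (al t) ang; first by rewrite lt_eqF.
  by apply/eqP; rewrite eqn_leq h4 andbT -(leq_add2r q) -dis addnC leq_add2r.
have [tc|tc] := boolP (t0 \in crossings); last first.
  exists 0%N, 0%N; have [_ /(_ tc) z _] := rank_zero t01 ang0; split=> //.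
  by apply: main => //; apply: filterE => t E alpha _; split.
have [Kp [Kn [dK sE [pK nK] hp hn]]] := signature_dims (sgP tc).
have [dimK _ _] := rank_zero t01 ang0; have sK := crossing_space_spans G t0 hW lF sF.
exists (\dim Kp), (\dim Kn); split=> //; first by rewrite dK dimK.
have [Bp [fBp sBp]] := spans_basis Kp; have [Bn [fBn sBn]] := spans_basis Kn.
have ker k (B : 'M[R]_(k, n)) (V : {vspace 'rV[R]_n}) : spans B V -> (V <= crossing_space G A t0)%VS ->
    B *m coord_im F0 (G t0) = 0.
  move=> sB /subvP VK; apply/eqP; rewrite -sub_kermx; apply/row_subP => i.
  by apply/sK/VK/sB; apply: row_sub.
have nz k (B : 'M[R]_(k, n)) (c : 'rV[R]_k) : row_free B -> c != 0 -> c *m B != 0.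
  by move=> fB; apply: contra => /eqP h; apply/eqP/(row_free_inj fB); rewrite h mul0mx.
apply: main; first by rewrite dK dimK.
have cp := @crossing_count W F0 G t0 hW lF (fun i j => @dG i j t0) 1 _ Bp e.
have cn := @crossing_count W F0 G t0 hW lF (fun i j => @dG i j t0) (- 1) _ Bn e.
rewrite expr1n in cp; rewrite sqrrN expr1n in cn.
have {}cp := cp erefl e0 e4 (ker _ _ _ sBp pK); have {}cn := cn erefl e0 e4 (ker _ _ _ sBn nK).
apply: filterS2 (cp _) (cn _).
- move=> t h1 h2 E alpha ang; have [h3 h4] := h1 E alpha ang; have [h5 h6] := h2 E alpha ang.
  by split=> tt; split; [apply: h3|apply: h6|apply: h5|apply: h4]; lra.
- by move=> c c0; rewrite mul1r; apply: hp; [apply/sBp; apply: submxMl | apply: nz].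
- by move=> c c0; rewrite mulN1r oppr_gt0; apply: hn; [apply/sBn; apply: submxMl | apply: nz].
Qed.

(** Summing the jumps of D, which vanishes at 0, gives the signatures with full weight except at the
    ends, where only one side is seen. The half weights leave P + Q over 2 at each end, and P + Q is
    the dimension of the intersection there: n at 0. *)
Lemma regular_index_formula E alpha : angles W F0 (G 1) E alpha ->
  \sum_(t <- crossings) (if (t == 0) || (t == 1) then 2^-1 else 1) * (sg t)%:~R =
  theta 1 - theta 0 - 2 * (\sum_j alpha j) +
    (n%:R - (\dim (A :&: lam 1))%:R) / 2.
Proof.
move=> ang1; have [[fG1 GG1] sG1] := lG in1.
have /choice[al alP] : forall t : R, exists al, t \in `[0, 1] -> exists E, angles W F0 (G t) E al.
  move=> t; have [t01|] := boolP (t \in `[0, 1]); last by exists (fun=> 0).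
  by have [Et [al ang]] := angles_exist hW lF (lG t01).1; exists al => _; exists Et.
pose D t := theta t - theta 0 - 2 * (\sum_j al t j).
have -> : theta 1 - theta 0 - 2 * (\sum_j alpha j) = D 1.
  by have [E' ang'] := alP _ in1; rewrite /D (angles_sum_uniq hW lF fG1 ang1 ang').
have /choice[pq pqP] : forall t : R, exists pq : nat * nat, t \in `[0, 1] ->
  [/\ (pq.1 + pq.2 = #|[pred j | al t j == 0%R]|)%N, t \in crossings -> sg t = pq.1%:Z - pq.2%:Z &
      \forall s \near t, s \in `[0, 1] ->
        (t < s -> D s = D t - pq.2%:R) /\ (s < t -> D s = D t - pq.1%:R)].
  move=> t; have [t01|] := boolP (t \in `[0, 1]); last by exists (0%N, 0%N).
  by have [p [q h]] := local_jump alP t01; exists (p, q).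
pose P (t : R) : R := (pq t).1%:R; pose Q (t : R) : R := (pq t).2%:R.
have PQ0 (t : R) : t \in `[0, 1] -> t \notin crossings -> P t = 0 /\ Q t = 0.
  move=> t01 tc; have [Et ang] := alP t t01; have [_ /(_ tc) z _] := rank_zero t01 ang.
  have [h _ _] := pqP t t01; rewrite z in h; rewrite /P /Q.
  by move/eqP: h; rewrite addn_eq0 => /andP[/eqP -> /eqP ->].
have cr01 t : t \in crossings -> t \in `[0, 1] by move/crP => [].
(* A value at one point is spread over the list of crossings, so that sums over crossings can be
   compared term by term. *)
have inP (f : R -> R) (t : R) : t \in `[0, 1] -> (t \notin crossings -> f t = 0) ->
    f t = \sum_(c <- crossings) (c == t)%:R * f c.
  by move=> t01; rewrite sum_delta //; have [_ _|_ /(_ isT) ->] := boolP (t \in crossings); rewrite ?mul1r ?mulr0.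
(* D rises by P on arrival at a crossing and drops by Q on departure; the weak and the strict
   inequality place the two corrections at exactly these sides, which makes this function locally
   constant. *)
pose Psi t := D t + \sum_(c <- crossings) (c < t)%R%:R * Q c - \sum_(c <- crossings) (c <= t)%R%:R * P c.
have loc (t : R) : t \in `[0, 1] -> \forall s \near t, s \in `[0, 1] -> Psi s = Psi t.
  move=> t01; have [_ _ jump] := pqP t t01.
  have stable : \forall s \near t, forall c, c \in crossings ->
      c != t -> (c < s) = (c < t) /\ (c <= s) = (c <= t).
    apply: (@near_seq R R (nbhs t) _ crossings (fun c s => c != t -> (c < s) = (c < t) /\ (c <= s) = (c <= t))) => c _.
    have [ct|tc|->] := ltgtP c t; last by apply: filterE => s.
      near=> s => _; have cs : c < s by near: s; exact: lt_nbhsr.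
      by rewrite cs (ltW cs).
    near=> s => _; have cs : s < c by near: s; exact: lt_nbhsl.
    by rewrite ltNge (ltW cs) leNgt cs.
  apply: filterS2 jump stable => s js st s01; rewrite /Psi.
  have -> : \sum_(c <- crossings) (c < s)%R%:R * Q c =
      \sum_(c <- crossings) (c < t)%R%:R * Q c + (t < s)%R%:R * Q t.
    rewrite [X in _ + X](inP (fun c => (c < s)%R%:R * Q c)) // => [|/(PQ0 _ t01)[_ ->]]; last by rewrite mulr0.
    rewrite -big_split /=; apply: eq_big_seq => c cc.
    have [->|ct] := eqVneq c t; first by rewrite ltxx mul0r add0r mul1r.
    by have [-> _] := st c cc ct; rewrite mul0r addr0.
  have -> : \sum_(c <- crossings) (c <= s)%R%:R * P c =
      \sum_(c <- crossings) (c <= t)%R%:R * P c - (s < t)%R%:R * P t.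
    rewrite [X in _ - X](inP (fun c => (s < c)%R%:R * P c)) // => [|/(PQ0 _ t01)[-> _]]; last by rewrite mulr0.
    rewrite -sumrB /=; apply: eq_big_seq => c cc.
    have [->|ct] := eqVneq c t; last by have [_ ->] := st c cc ct; rewrite mul0r subr0.
    by rewrite lexx leNgt; case: (s < t); rewrite /= ?mul1r ?mul0r ?subrr ?subr0.
  have [j1 j2] := js s01; rewrite -/(P t) -/(Q t) in j1 j2.
  by have [st'|ts|->] := ltgtP s t; rewrite ?(j1 ts) ?(j2 st') /=; ring.
have Psi01 : Psi 0 = Psi 1.
  apply: (connected_locally_constant (@segment_connected R 0 1)) in0 in1 => t t01.
  exact: loc.
have D0 : D 0 = 0.
  have [E' ang'] := alP _ in0; have [_ _ /(_ erefl) full] := rank_zero in0 ang'.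
  rewrite /D subrr sub0r big1 ?mulr0 ?oppr0 // => j _.
  have : [pred j | al 0 j == 0%R] =i predT.
    by apply/subset_cardP; [rewrite full card_ord | apply/fintype.subsetP].
  by move=> /(_ j); rewrite !inE => /eqP.
have S0 : \sum_(c <- crossings) (c < 0)%R%:R * Q c = 0.
  by rewrite big1_seq // => c /andP[_ /cr01]; rewrite in_itv /= => /andP[c0 _]; rewrite ltNge c0 mul0r.
have S1 : \sum_(c <- crossings) (c <= 0)%R%:R * P c = P 0.
  rewrite [RHS](inP P 0) // => [|/(PQ0 _ in0)[]] //.
  apply: eq_big_seq => c /cr01; rewrite in_itv /= => /andP[c0 _].
  by rewrite eq_le c0 andbT.
have S2 : \sum_(c <- crossings) (c < 1)%R%:R * Q c = \sum_(c <- crossings) Q c - Q 1.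
  rewrite [X in _ - X](inP Q 1) // => [|/(PQ0 _ in1)[]] //; rewrite -sumrB.
  apply: eq_big_seq => c /cr01; rewrite in_itv /= => /andP[_ c1].
  by rewrite lt_neqAle c1 andbT; case: eqP; rewrite /= ?mul1r ?mul0r ?subrr ?subr0.
have S3 : \sum_(c <- crossings) (c <= 1)%R%:R * P c = \sum_(c <- crossings) P c.
  by apply: eq_big_seq => c /cr01; rewrite in_itv /= => /andP[_ ->]; rewrite mul1r.
have sgE c : c \in crossings -> (sg c)%:~R = P c - Q c.
  by move=> cc; have [_ /(_ cc) -> _] := pqP c (cr01 c cc); rewrite rmorphB.
have kE (t : R) : t \in `[0, 1] -> P t + Q t = (\dim (A :&: lam t))%:R.
  move=> t01; have [Et ang] := alP t t01; have [h _ _] := pqP t t01.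
  rewrite /P /Q -natrD h; have [[fG GG] sG] := lG t01.
  by have [r _] := rank_angles hW lF fG ang; rewrite -r (spans_dim (spans_cap sF sG)).
have k0 := kE _ in0; have k1 := kE _ in1; rewrite lam0 capvv (spans_dim sF) (eqP lF.1) in k0.
have -> : \sum_(t <- crossings) (if (t == 0) || (t == 1) then 2^-1 else 1) * (sg t)%:~R =
  \sum_(c <- crossings) P c - \sum_(c <- crossings) Q c - 2^-1 * (P 0 - Q 0) - 2^-1 * (P 1 - Q 1).
  have inD (t : R) : t \in `[0, 1] -> P t - Q t = \sum_(c <- crossings) (c == t)%:R * (P c - Q c).
    by move=> t01; apply: (inP (fun c => P c - Q c)) => // /(PQ0 _ t01)[-> ->]; rewrite subrr.
  rewrite (inD 0) // (inD 1) // !mulr_sumr -!sumrB.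
  apply: eq_big_seq => c /sgE ->; have [->|c0] := eqVneq c 0.
    by rewrite eq_sym oner_eq0 /=; field.
  by have [->|c1] := eqVneq c 1; rewrite /=; field.
move: Psi01; rewrite /Psi D0 S0 S1 S2 S3 -k0 -k1 => h; lra.
Unshelve. all: by end_near.
Qed.

End Formula.
End RegularIndex.

(** * Continuity of complex determinants *)

Section ComplexConvergence.
Context {R : realType} {n : nat} {T : Type} {Fi : set_system T} {FF : Filter Fi}.

Definition ccvg (f : T -> R[i]) (z : R[i]) : Prop :=
  (fun y => complex.Re (f y)) @ Fi --> complex.Re z /\
  (fun y => complex.Im (f y)) @ Fi --> complex.Im z.

Lemma ccvg_cst (z : R[i]) : ccvg (fun=> z) z.
Proof. by split; apply: cvg_cst. Qed.

Lemma ccvgD f g (z w : R[i]) : ccvg f z -> ccvg g w -> ccvg (fun y => f y + g y) (z + w).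
Proof.
move=> [f1 f2] [g1 g2]; split.
  have -> : (fun y => complex.Re (f y + g y)) = fun y => complex.Re (f y) + complex.Re (g y).
    by apply/funext => y; case: (f y) (g y) => ? ? [].
  by have -> : complex.Re (z + w) = complex.Re z + complex.Re w; [case: (z) (w) => ? ? [] | apply: cvgD].
have -> : (fun y => complex.Im (f y + g y)) = fun y => complex.Im (f y) + complex.Im (g y).
  by apply/funext => y; case: (f y) (g y) => ? ? [].
by have -> : complex.Im (z + w) = complex.Im z + complex.Im w; [case: (z) (w) => ? ? [] | apply: cvgD].
Qed.

Lemma ccvgM f g (z w : R[i]) : ccvg f z -> ccvg g w -> ccvg (fun y => f y * g y) (z * w).
Proof.
move=> [f1 f2] [g1 g2]; split.
  have E (a b : R[i]) : complex.Re (a * b) = complex.Re a * complex.Re b - complex.Im a * complex.Im b.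
    by case: a b => ? ? [].
  rewrite E; under eq_fun do rewrite E.
  by apply: cvgB; apply: cvgM.
have E (a b : R[i]) : complex.Im (a * b) = complex.Re a * complex.Im b + complex.Im a * complex.Re b.
  by case: a b => ? ? [].
rewrite E; under eq_fun do rewrite E.
by apply: cvgD; apply: cvgM.
Qed.

Lemma ccvg_sum (I : Type) (r : seq I) (f : I -> T -> R[i]) (l : I -> R[i]) :
  (forall i, ccvg (f i) (l i)) -> ccvg (fun y => \sum_(i <- r) f i y) (\sum_(i <- r) l i).
Proof.
move=> h; elim: r => [|i r IH].
  by rewrite big_nil (_ : (fun=> _) = fun=> 0); [exact: ccvg_cst|apply/funext => y; rewrite big_nil].
rewrite big_cons (_ : (fun=> _) = fun y => f i y + \sum_(j <- r) f j y); first exact: ccvgD.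
by apply/funext => y; rewrite big_cons.
Qed.

Lemma ccvg_prod (I : Type) (r : seq I) (f : I -> T -> R[i]) (l : I -> R[i]) :
  (forall i, ccvg (f i) (l i)) -> ccvg (fun y => \prod_(i <- r) f i y) (\prod_(i <- r) l i).
Proof.
move=> h; elim: r => [|i r IH].
  by rewrite big_nil (_ : (fun=> _) = fun=> 1); [exact: ccvg_cst|apply/funext => y; rewrite big_nil].
rewrite big_cons (_ : (fun=> _) = fun y => f i y * \prod_(j <- r) f j y); first exact: ccvgM.
by apply/funext => y; rewrite big_cons.
Qed.

Lemma ccvg_det_cplx (F : T -> 'M[R]_(n, n + n)) F0 : mxcvg (Fi := Fi) F F0 ->
  ccvg (fun y => \det (cplx_mx (F y))) (\det (cplx_mx F0)).
Proof.
move=> cF; apply: ccvg_sum => s; apply: ccvgM; first exact: ccvg_cst.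
apply: ccvg_prod => i.
have E j : ccvg (fun y => cplx_mx (F y) i j) (cplx_mx F0 i j); last exact: E.
rewrite mxE (_ : (fun=> _) = fun y => Complex (F y i (lshift n j)) (F y i (rshift n j))).
  by split; apply: cF.
by apply/funext => y; rewrite mxE.
Qed.

End ComplexConvergence.

Lemma pairl_continuous (T U : topologicalType) (u : U) : continuous (fun t : T => (t, u)).
Proof.
move=> t A [[P Q] [/= nP /nbhs_singleton Qu] PQ].
by apply: filterS (nP : nbhs t P) => r Pr; apply: PQ.
Qed.

Lemma pairr_continuous (T U : topologicalType) (t : T) : continuous (fun u : U => (t, u)).
Proof.
move=> u A [[P Q] [/= /nbhs_singleton Pt nQ] PQ].
by apply: filterS (nQ : nbhs u Q) => r Qr; apply: PQ.
Qed.

(** * Homotopy invariance through the phase *)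

Section Homotopy.
Context {R : realType} {n : nat}.
Implicit Types (W : 'M[R]_(n + n)) (A V : {vspace 'rV[R]_(n + n)}).

Lemma spans_frames k m (F F' : 'M[R]_(k, m)) (V : {vspace 'rV[R]_m}) : row_free F -> spans F V -> spans F' V ->
  exists2 C, C \in unitmx & F = C *m F'.
Proof.
move=> fF sF sF'; have : (F <= F')%MS.
  by apply/row_subP => i; apply/sF'; exact: spans_row.
move=> /submxP[C FE]; exists C => //; rewrite -row_free_unit /row_free eqn_leq rank_leq_row /=.
by move: fF; rewrite /row_free FE => /eqP {1}<-; apply: mxrankM_maxl.
Qed.

Lemma angles_framer W (F G G' E : 'M[R]_(n, n + n)) alpha V :
  row_free G -> spans G V -> spans G' V -> angles W F G E alpha -> angles W F G' E alpha.
Proof.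
move=> fG sG sG' [EA EO al [B uB EB]]; split=> //.
have [C uC GE] := spans_frames fG sG sG'.
by exists (B *m C); rewrite ?unitmx_mul ?uB // EB GE mulmxA.
Qed.

Lemma angles_framel W (F F' G E : 'M[R]_(n, n + n)) alpha V :
  row_free F -> spans F V -> spans F' V -> angles W F G E alpha -> angles W F' G E alpha.
Proof.
move=> fF sF sF' [[A uA EA] EO al EB]; split=> //.
have [C uC FE] := spans_frames fF sF sF'.
by exists (A *m C); rewrite ?unitmx_mul ?uA // EA FE mulmxA.
Qed.

(** The difference of the two lifts is continuous with values in 2 pi Z. *)
Lemma expi_lift_constant (f g : R -> R) (a b : R) : a <= b ->
  {within `[a, b], continuous f} -> {within `[a, b], continuous g} ->
  (forall x, x \in `[a, b] -> expi (f x) = expi (g x)) -> f b - f a = g b - g a.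
Proof.
move=> ab /within_cvgP cf /within_cvgP cg fg; have p0 : 2 * @pi R != 0.
  by rewrite mulf_neq0 // gt_eqF // pi_gt0.
have : (f a - g a) / (2 * pi) = (f b - g b) / (2 * pi).
  apply: (@int_valued_constant R (fun x => (f x - g x) / (2 * pi)) a b ab) => [|x xab].
    apply/within_cvgP => x xab; apply: cvgM; last exact: cvg_cst.
    by apply: cvgB; [exact: cf | exact: cg].
  have [k ->] := expi_inj (fg x xab); exists k.
  by rewrite [_ + _ - _]addrC addKr mulrC mulrA mulVf ?mul1r.
move/(mulIf (invr_neq0 p0)); lra.
Qed.

Lemma within_comp (T U V : topologicalType) (A : set T) (B : set U) (f : T -> U) (g : U -> V) :
  {within A, continuous f} -> (forall x, A x -> B (f x)) -> {within B, continuous g} ->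
  {within A, continuous (fun x => g (f x))}.
Proof.
move=> /within_cvgP cf AB /within_cvgP cg; apply/within_cvgP => x Ax S nS.
have h1 : \forall y \near f x, B y -> S (g y) := cg _ (AB x Ax) _ nS.
have h2 : \forall y \near x, A y -> B (f y) -> S (g (f y)) := cf _ Ax _ h1.
suff : \forall y \near x, A y -> S (g (f y)) by [].
by apply: filterS h2 => y h Ay; apply: h => //; apply: AB.
Qed.

(** Any n vectors of V are a real matrix times F, so their volume is a real multiple of that of F.
    This is the converse of [Det2_polar]. *)
Lemma Det2_frame (a : R[i]) (F : 'M[R]_(n, n + n)) V r psi : spans F V ->
  nform a F = r%:C%C * expi psi -> Det2 (nform a) V (expi (2 * psi)).
Proof.
move=> sF aF; exists psi; split=> // F' F'V.
have /submxP[C ->] : (F' <= F)%MS by apply/row_subP => i; apply/sF.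
have -> : nform a (C *m F) = (\det C)%:C%C * nform a F.
  by rewrite /nform cplx_mx_mull det_mulmx det_map_mx mulrCA.
by rewrite aF mulrCA (mulrCA (expi _)) -expiD addNr expi0 mulr1 /= mul0r mulr0 addr0.
Qed.

(** Besides the total change of phase, the formula for a regular path involves only the end points.
    The homotopy fixes the end points, so it suffices that the change of phase agrees for the two
    paths. *)
Lemma RS_index_formula W A (F0 G : 'M[R]_(n, n + n)) (lam : R -> {vspace 'rV[R]_(n + n)})
    (a : R[i]) (theta : R -> R) mu E alpha :
  hermitian_form W -> lagframe W F0 -> spans F0 A -> a != 0 -> lam 0 = A ->
  {within `[0, 1], continuous theta} ->
  (forall t, t \in `[0, 1] -> Det2 (nform a) (lam t) (expi (2 * pi * theta t))) ->
  row_free G -> spans G (lam 1) -> angles W F0 G E alpha -> RS_index W A lam mu ->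
  mu = theta 1 - theta 0 - 2 * (\sum_j alpha j) + (n%:R - (\dim (A :&: lam 1))%:R) / 2.
Proof.
move=> hW lF sF a0 lamA cth det2 fG sG ang.
move=> [lam' [[H [F [/within_cvgP cF frF Hlam Hend]]]]].
move=> [G' [cr [sg [[dG frG] ucr crP sgP ->]]]].
have in0 : (0 : R) \in `[0, 1] by rewrite in_itv /= lexx ler01.
have in1 : (1 : R) \in `[0, 1] by rewrite in_itv /= lexx ler01.
pose h z : R[i] := nform a (F z).
pose K : set (R * R) := `[0, 1] `*` `[0, 1].
have ch (z : R * R) : K z -> ccvg (Fi := within K (nbhs z)) h (h z).
  move=> Kz; apply: ccvgM; first exact: ccvg_cst.
  apply: ccvg_det_cplx => i j.
  exact: (cvg_comp _ _ (cF z Kz) (@coord_continuous _ _ _ i j _)).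
have h0 (z : R * R) : K z -> 0 < complex.Re (h z) ^+ 2 + complex.Im (h z) ^+ 2.
  case: z => r t [/= r01 t01]; have [fr lag] := frF r t r01 t01; have [fF sF'] := is_frame_spans fr.
  have : h (r, t) != 0 by rewrite mulf_neq0 // (det_cplx_neq0 hW (lagrangian_lagframe fF sF' lag)).
  case: (h (r, t)) => x y; rewrite eq_complex /= negb_and => xy.
  by rewrite lt_neqAle eq_sym paddr_eq0 ?sqr_ge0 // !sqrf_eq0 negb_and xy addr_ge0 ?sqr_ge0.
have [g [cg hg]] := rectangle_lift ler01 ler01 ((within_cvgP _ _).2 (fun z Kz => (ch z Kz).1))
  ((within_cvgP _ _).2 (fun z Kz => (ch z Kz).2)) h0.
have {}hg (r t : R) : r \in `[0, 1] -> t \in `[0, 1] ->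
    exists2 rho, 0 < rho & h (r, t) = rho%:C%C * expi (g (r, t)).
  move=> r01 t01; have [rho [rho0 hr hi]] := hg (r, t) (conj r01 t01); exists rho => //.
  by apply/eqP; rewrite eq_complex /= hr hi !mul0r subr0 addr0 !eqxx.
have uniq_phase (r t x : R) : r \in `[0, 1] -> t \in `[0, 1] ->
    Det2 (nform a) (H r t) (expi x) -> expi x = expi (2 * g (r, t)).
  move=> r01 t01 D; have [rho rho0 hr] := hg r t r01 t01.
  have [fr _] := frF r t r01 t01; have [_ sF'] := is_frame_spans fr.
  exact: (Det2_polar D (spans_row sF') hr rho0).
have cst_edge : forall f : R -> R, {within `[0, 1], continuous f} ->
    {within `[0, 1], continuous (fun x => 2 * f x)}.
  by move=> f /within_cvgP cf; apply/within_cvgP => x x01; apply: cvgM; [exact: cvg_cst | exact: cf].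
have edge (i : R -> R * R) : continuous i -> (forall t, t \in `[0, 1] -> K (i t)) ->
    {within `[0, 1], continuous (fun t => 2 * g (i t))}.
  move=> ci Ki; apply: cst_edge; apply: within_comp cg => //.
  exact: continuous_subspaceT.
have c1 (r : R) : continuous (fun t : R => (r, t)) by exact: pairr_continuous.
have c2 (t : R) : continuous (fun r : R => (r, t)) by exact: pairl_continuous.
have E0 : 2 * pi * theta 1 - 2 * pi * theta 0 = 2 * g (0, 1) - 2 * g (0, 0).
  apply: (@expi_lift_constant (fun t => 2 * pi * theta t) (fun t => 2 * g (0, t)) 0 1 ler01).
  - by apply/within_cvgP => x x01; apply: cvgM; [exact: cvg_cst | exact: (within_cvgP _ _).1 cth x x01].
  - by apply: edge.
  - by move=> t t01; apply: uniq_phase => //; rewrite (Hlam t t01).1; apply: det2.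
(* Along these two sides of the square the Lagrangian is constant, hence so is the lifted argument
   of [Det2]. *)
have E1 (t : R) : t = 0 \/ t = 1 -> 2 * g (1, t) - 2 * g (0, t) = 0.
  move=> tE; have t01 : t \in `[0, 1] by case: tE => ->.
  have HtE (r : R) : r \in `[0, 1] -> H r t = lam t.
    by move=> /Hend [e0 e1]; case: tE => ->.
  rewrite -[RHS](subrr (2 * pi * theta t)).
  apply/esym/(@expi_lift_constant (fun=> 2 * pi * theta t) (fun r => 2 * g (r, t)) 0 1 ler01).
  - by apply/within_cvgP => x x01; exact: cvg_cst.
  - by apply: edge.
  - by move=> r r01; apply: uniq_phase => //; rewrite HtE //; apply: det2.
have pi0 : 0 < @pi R by apply: pi_gt0.
(* The argument of [Det2] is twice that of the volume, so a phase in full turns is 2 g / (2 pi). *)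
pose theta' (t : R) := pi^-1 * g (1, t).
have th'E (t : R) : 2 * pi * theta' t = 2 * g (1, t) by rewrite /theta' -mulrA mulVKf // gt_eqF.
have H0 : H 1 0 = A by rewrite (Hend 1 in1).1.
have H1 : H 1 1 = lam 1 by rewrite (Hend 1 in1).2.
have lamE (t : R) : t \in `[0, 1] -> lam' t = H 1 t by move=> /Hlam[].
have frG' (t : R) : t \in `[0, 1] -> is_frame (G' t) (H 1 t) by move=> t01; rewrite -lamE //; apply: frG.
have cth' : {within `[0, 1], continuous theta'}.
  apply/within_cvgP => t t01; apply: cvgM; first exact: cvg_cst.
  exact: (within_cvgP _ _).1 (within_comp (continuous_subspaceT (c1 1)) (fun t t01 => conj in1 t01) cg) t t01.
have det2' (t : R) : t \in `[0, 1] -> Det2 (nform a) (H 1 t) (expi (2 * pi * theta' t)).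
  move=> t01; have [rho _ hr] := hg 1 t in1 t01; have [fr _] := frF 1 t in1 t01.
  by rewrite th'E; apply: (Det2_frame (is_frame_spans fr).2 hr).
have crP' (t : R) : (t \in cr) <-> (t \in `[0, 1]) /\ (H 1 t :&: A)%VS <> 0%VS.
  by rewrite crP; split=> -[t01]; rewrite lamE.
have [fG1 sG1] := is_frame_spans (frG' 1 in1); rewrite -H1 in sG.
have ang1 := angles_framer fG sG sG1 ang.
rewrite (@regular_index_formula R n W A F0 (H 1) a theta' G' cr sg hW lF sF a0
  (fun t t01 => (frF 1 t in1 t01).2) H0 cth' det2' (fun i j t => (dG i j).1 t) frG' ucr crP' sgP
  _ _ ang1) H1; congr (_ - _ + _).
have e0 := E1 0 (or_introl erefl); have e1 := E1 1 (or_intror erefl).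
apply: (@mulfI _ (2 * pi)); first by rewrite mulf_neq0 // gt_eqF.
rewrite !mulrBr !th'E; lra.
Qed.

End Homotopy.

(** * Clean intersections *)

Section AbsoluteIndex.
Context {R : realType} {n : nat}.
Local Notation J := (@Jmx R n).
Implicit Types (W : 'M[R]_(n + n)) (V K M : {vspace 'rV[R]_(n + n)}).

Lemma metricE W (v w : 'rV[R]_(n + n)) : metric W v w = (v *m (W *m J^T) *m w^T) 0 0.
Proof. by rewrite /metric /Defs.form trmx_mul !mulmxA. Qed.

Lemma metric_spans W k (F : 'M[R]_(k, n + n)) K v : spans F K ->
  (forall w, w \in K -> metric W v w = 0) <-> v *m (W *m J^T) *m F^T = 0.
Proof.
move=> sF; split=> [h|h w /sF /submxP[b ->]].
  apply/rowP => i; have := h _ (spans_row sF i); rewrite metricE => e.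
  rewrite [RHS]mxE -[RHS]e [LHS]mxE [RHS]mxE; apply: eq_bigr => j _.
  by rewrite !mxE.
by rewrite metricE (trmx_mul b) [_ *m (_ *m b^T)]mulmxA h mul0mx mxE.
Qed.

Lemma orthocomplementP W K M v :
  v \in orthocomplement W K M <-> v \in M /\ forall k, k \in K -> metric W v k = 0.
Proof.
apply: (vspace_ofP (P := fun v => v \in M /\ forall k, k \in K -> metric W v k = 0)).
have [F [_ sF]] := spans_basis K.
have [V sV] := spans_exists (kermx ((W *m J^T) *m F^T)).
exists (M :&: V)%VS => w; rewrite memv_cap; split.
  move=> /andP[wM /sV]; rewrite sub_kermx mulmxA => /eqP h; split=> //.
  exact/(metric_spans W w sF).
move=> [-> /(metric_spans W w sF)] /= h; apply/sV.
by rewrite sub_kermx mulmxA h.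
Qed.

(** Orthogonal projection to K. It shows that adding K back to the end points of a path in the
    complement N recovers the tangent spaces of the two Lagrangians. *)
Lemma orthocomplement_split W K V M : hermitian_form W -> (K <= V)%VS -> (V <= M)%VS ->
  (V :&: orthocomplement W K M + K)%VS = V.
Proof.
move=> hW KV VM; have [F [fF sF]] := spans_basis K.
have [A uA AE] := orthonormal_frame hW fF.
apply/eqP; rewrite eqEsubv subv_add capvSl KV /=; apply/subvP => v vV.
(* The orthogonal projection of v to K, by the orthonormal frame A F. *)
pose w := v *m (W *m J^T) *m (A *m F)^T *m (A *m F).
have wK : w \in K by apply/sF; rewrite /w [X in (X <= _)%MS]mulmxA submxMl.
have vw : v - w \in (V :&: orthocomplement W K M)%VS.
  have vwV : v - w \in V by rewrite memvB // (subvP KV).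
  rewrite memv_cap vwV; apply/orthocomplementP; split; first exact: (subvP VM).
  apply/(metric_spans W _ sF); apply: (row_free_inj (A := A^T)).
    by rewrite row_free_unit unitmx_tr.
  rewrite mul0mx -[LHS]mulmxA -trmx_mul !mulmxBl /w.
  move: AE; move: (W *m J^T) (A *m F) => P Q QE; have -> : v *m P *m Q^T *m Q *m P *m Q^T =
    v *m P *m Q^T *m (Q *m P *m Q^T) by rewrite !mulmxA.
  by rewrite QE mulmx1 subrr.
by rewrite -(subrK w v); apply: memv_add.
Qed.

Context {X : calabi_yau R n}.
Implicit Types (L S : set X).

Lemma lagrangian_tangent_frame L x : lagrangian_submanifold L -> L x ->
  exists F, [/\ row_free F, spans F (tangent_space L x) & lagframe (omega x) F].
Proof.
move=> lagL Lx; have [_ lag] := lagL x Lx; have [_ dn2 _] := lag.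
have dn : \dim (tangent_space L x) = n.
  by move: dn2; rewrite dimvf /dim /= mul1n => dn2; lia.
have [F [fF sF]] : exists F : 'M[R]_(n, n + n), row_free F /\ spans F (tangent_space L x).
  by have := spans_basis (tangent_space L x); rewrite dn.
by exists F; split=> //; apply: lagrangian_lagframe fF sF lag.
Qed.

Definition angle_data L0 L1 (x : X) (alpha : 'I_n -> R) : Prop :=
  exists F G E, [/\ row_free F /\ row_free G, spans F (tangent_space L0 x),
    spans G (tangent_space L1 x) & angles (omega x) F G E alpha].

Lemma angle_data_exists L0 L1 x : lagrangian_submanifold L0 -> lagrangian_submanifold L1 ->
  L0 x -> L1 x -> exists alpha, angle_data L0 L1 x alpha.
Proof.
move=> lag0 lag1 L0x L1x; have [F [fF sF lF]] := lagrangian_tangent_frame lag0 L0x.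
have [G [fG sG lG]] := lagrangian_tangent_frame lag1 L1x.
have [E [alpha ang]] := angles_exist (omega_hermitian x) lF lG.
by exists alpha, F, G, E.
Qed.

Lemma angle_data_frames L0 L1 x F G alpha : row_free F -> row_free G ->
  spans F (tangent_space L0 x) -> spans G (tangent_space L1 x) ->
  angle_data L0 L1 x alpha -> exists E, angles (omega x) F G E alpha.
Proof.
move=> fF fG sF sG [F' [G' [E [[fF' fG'] sF' sG' ang]]]]; exists E.
exact: angles_framel fF' sF' sF (angles_framer fG' sG' sG ang).
Qed.

Lemma angle_data_sum L0 L1 x alpha alpha' : lagrangian_submanifold L0 -> L0 x ->
  angle_data L0 L1 x alpha -> angle_data L0 L1 x alpha' ->
  \sum_j alpha j = \sum_j alpha' j.
Proof.
move=> lag0 L0x [F [G [E [[fF fG] sF sG ang]]]] /(angle_data_frames fF fG sF sG)[E' ang'].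
have lF := lagrangian_lagframe fF sF (lag0 x L0x).2.
exact: angles_sum_uniq (omega_hermitian x) lF fG ang ang'.
Qed.

Lemma rotate_frame L0 L1 x E alpha : lagrangian_submanifold L1 -> L1 x ->
  positive_definite_path (omega x) (tangent_space L0 x) (tangent_space L1 x) E alpha ->
  [/\ row_free E, spans E (tangent_space L0 x), row_free (rotate E alpha 1),
      spans (rotate E alpha 1) (tangent_space L1 x) &
      angles (omega x) E (rotate E alpha 1) E alpha].
Proof.
move=> lag1 L1x [fr orth al _ rE]; have [fE sE] := is_frame_spans fr.
have sR : spans (rotate E alpha 1) (tangent_space L1 x) by move=> v; rewrite -rE mem_rowspace.
have [G [fG sG _]] := lagrangian_tangent_frame lag1 L1x.
have fR : row_free (rotate E alpha 1).
  by rewrite /row_free (spans_rank sR sG).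
split=> //; split=> //.
- by exists 1%:M; rewrite ?unitmx1 ?mul1mx.
- apply/matrixP => i j; have := orth i j; rewrite metricE => e.
  rewrite [RHS]mxE -[RHS]e -row_mul [LHS]mxE [RHS]mxE; apply: eq_bigr => k _.
  by rewrite [row i _ _ _]mxE !mxE.
- by exists 1%:M; rewrite ?unitmx1 ?mul1mx.
Qed.

Lemma path_angle_data L0 L1 x E alpha : lagrangian_submanifold L1 -> L1 x ->
  positive_definite_path (omega x) (tangent_space L0 x) (tangent_space L1 x) E alpha ->
  angle_data L0 L1 x alpha.
Proof.
by move=> lag1 L1x /(rotate_frame lag1 L1x)[fE sE fR sR ang]; exists E, (rotate E alpha 1), E.
Qed.

Lemma bwd_line_cvg c x (w : 'rV[R]_(n + n)) (t : R) : (fwd c @` dom c) (fwd c x + t *: w) ->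
  line c x w @ t --> (line c x w t : X).
Proof.
move=> h; have aff : (fun t : R => fwd c x + t *: w) @ t --> fwd c x + t *: w; last first.
  exact: (cvg_comp _ _ aff (bwd_continuous h)).
apply: cvg_rV => j.
rewrite (_ : (fun y => _) = fun y => fwd c x 0 j + y * w 0 j); last by apply/funext => y; rewrite !mxE.
by rewrite !mxE; apply: cvgD; [exact: cvg_cst | apply: cvgM; [exact: cvg_id | exact: cvg_cst]].
Qed.

(** The image of the segment from -|t| to |t| is a connected subset of S through x, hence lies in
    the component of x. *)
Lemma component_line S x k c (w : 'rV[R]_(n + n)) : dom c x -> slice c S k -> S x ->
  (forall i : 'I_(n + n), (k <= i)%N -> w 0 i = 0) ->
  \forall t \near (0 : R), connected_component S x (line c x w t).
Proof.
move=> cx sl Sx w0; have l0 := line0 w cx.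
have imx : \forall t \near (0 : R), (fwd c @` dom c) (fwd c x + t *: w).
  have h1 : \forall t \near (0 : R), (fwd c @` dom c) (fwd c x + t *: w) /\
      fwd c (bwd c (fwd c x + t *: w)) = fwd c x + t *: w := @affine_cvg _ _ _ w _ (near_img cx).
  by apply: filterS h1 => t [].
have both : \forall t \near (0 : R), (fwd c @` dom c) (fwd c x + t *: w) /\ S (line c x w t).
  by apply: filterS2 imx (slice_line cx sl Sx w0).
move/nbhs_ballP: both => [d /= d0 hd]; apply/nbhs_ballP; exists d => // t td.
have sub (s : R) : `|s| <= `|t| -> ball (0 : R) d s.
  by move=> st; move: td; rewrite /ball /= !sub0r !normrN; apply: le_lt_trans.
have cI := connected_continuous_connected (@segment_connected R (- `|t|) `|t|).
have {}cI : connected (line c x w @` `[- `|t|, `|t|]).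
  apply: cI; apply/within_cvgP => s /=; rewrite in_itv /= -ler_norml => st.
  have [h _] := hd s (sub s st); apply: cvg_trans (bwd_line_cvg h).
  by apply: cvg_app; apply: cvg_within.
apply: (@connected_component_max _ _ (line c x w @` `[- `|t|, `|t|])) => //.
- by exists 0; rewrite ?l0 //= in_itv /= -ler_norml normr0.
- by move=> _ [s /= st <-]; move: st; rewrite in_itv /= -ler_norml => /sub/hd[].
- by exists t => //=; rewrite in_itv /= -ler_norml.
Qed.

(** The same slice frame spans both. This links the dimension of the component, in the absolute
    index, to the whole intersection, of which cleanness speaks. *)
Lemma tangent_component S x k : submanifold_at S x k -> S x ->
  tangent_space (connected_component S x) x = tangent_space S x.
Proof.
move=> [kn [c [cx cc sl]]] Sx.
have h := tangent_spaceP kn cx cc sl (@subset_refl _ S) Sx (fun w => slice_line cx sl Sx).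
have h' := tangent_spaceP kn cx cc sl (@connected_component_sub _ S x) Sx
  (fun w => component_line cx sl Sx).
exact: spans_uniq h' h.
Qed.

(** By cleanness K is the intersection of the tangent spaces, so the term (n - dim)/2 of the
    definition cancels the one in [RS_index_formula] and leaves - D(x). *)
Lemma absolute_index_formula L0 L1 (theta0 theta1 : X -> R) Rh m :
  lagrangian_submanifold L0 -> lagrangian_submanifold L1 -> clean_intersection L0 L1 ->
  component (L0 `&` L1) Rh -> absolute_index L0 L1 theta0 theta1 Rh m ->
  exists2 x, Rh x & forall alpha, angle_data L0 L1 x alpha ->
    m = theta0 x - theta1 x + 2 * (\sum_j alpha j).
Proof.
move=> lag0 lag1 cl [y Sy ->] [x [xR [lam [theta [mu]]]]].
set A := tangent_space L0 x; set B := tangent_space L1 x.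
set K := tangent_space (L0 `&` L1) x; set N := orthocomplement _ _ _.
move=> [[_ l0 l1] [cth th0 th1] det2 RS ->].
have [L0x L1x] : (L0 `&` L1) x by apply: connected_component_sub xR.
have [[k sub] KE] := cl x (conj L0x L1x).
have -> : tangent_space (connected_component (L0 `&` L1) y) x = K.
  by rewrite (same_connected_component xR) (tangent_component sub).
exists x => // alpha [F [G [E [[fF fG] sF sG ang]]]].
have hW := omega_hermitian x.
have AE : (lam (0 : R)%R + K)%VS = A.
  by rewrite l0; apply: orthocomplement_split => //; rewrite ?addvSl // /K KE capvSl.
have BE : (lam (1 : R)%R + K)%VS = B.
  by rewrite l1; apply: orthocomplement_split => //; rewrite ?addvSr // /K KE capvSr.
have lF : lagframe (omega x) F by apply: lagrangian_lagframe fF sF (lag0 x L0x).2.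
have sG' : spans G (lam (1 : R)%R + K)%VS by rewrite BE.
have a0 := Omega_nonvanishing x.
rewrite (RS_index_formula hW lF sF a0 AE cth det2 fG sG' ang RS) BE th0 th1.
rewrite /K KE -/A -/B; lra.
Qed.


Lemma lagframe_coord (W T : 'M[R]_(n + n)) F : T \in unitmx -> lagframe W F ->
  lagframe (invmx T *m W *m (invmx T)^T) (F *m T).
Proof.
move=> uT [fF FW]; split; first by rewrite /row_free mxrankMfree // row_free_unit.
by rewrite trmx_mul !mulmxA mulmxK // -(mulmxA _ (invmx T)^T) -trmx_mul mulmxV // trmx1 mulmx1.
Qed.

Lemma rotate_mulr E (T : 'M[R]_(n + n)) alpha t : J *m T = T *m J ->
  rotate (E *m T) alpha t = rotate E alpha t *m T.
Proof. by move=> JT; rewrite !rotateE mulmxDl -!mulmxA -JT. Qed.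

Lemma angles_change (W T : 'M[R]_(n + n)) F G E alpha : T \in unitmx -> J *m T = T *m J ->
  angles W F G E alpha ->
  angles (invmx T *m W *m (invmx T)^T) (F *m T) (G *m T) (E *m T) alpha.
Proof.
move=> uT JT [[A uA EA] EO al [B uB EB]]; split=> //.
- by exists A; rewrite // EA mulmxA.
- rewrite -EO; have JT' : J^T *m T^T = T^T *m J^T by rewrite -!trmx_mul JT.
  have TT : (invmx T)^T *m T^T = 1%:M by rewrite -trmx_mul mulmxV // trmx1.
  have TT' : (invmx T)^T *m J^T *m T^T = J^T.
    by rewrite -mulmxA JT' mulmxA TT mul1mx.
  by rewrite trmx_mul !mulmxA mulmxK // -(mulmxA _ (invmx T)^T) -(mulmxA _ ((invmx T)^T *m _)) TT'.
- by exists B; rewrite // rotate_mulr // EB mulmxA.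
Qed.

(** * The integer defect along a component of the intersection *)

Section Component.
Variables (L0 L1 : set X) (theta0 theta1 : X -> R) (al : X -> 'I_n -> R).
Hypotheses (lag0 : lagrangian_submanifold L0) (lag1 : lagrangian_submanifold L1).
Hypotheses (gr0 : grading L0 theta0) (gr1 : grading L1 theta1).
Hypothesis clean : clean_intersection L0 L1.
Hypothesis alP : forall x, (L0 `&` L1) x -> angle_data L0 L1 x (al x).

Let D x := theta1 x - theta0 x - 2 * (\sum_j al x j).

Let phase x E F G alpha : (L0 `&` L1) x -> row_free F -> spans F (tangent_space L0 x) ->
  spans G (tangent_space L1 x) -> angles (omega x) F G E alpha ->
  exists k : int, theta1 x - theta0 x - 2 * (\sum_j alpha j) = k%:~R.
Proof.
move=> [L0x L1x] fF sF sG ang; have lF := lagrangian_lagframe fF sF (lag0 L0x).2.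
apply: (angles_phase (omega_hermitian x) (Omega_nonvanishing x) lF ang).
- exact: spans_row sF.
- exact: spans_row sG.
- exact: gr0.2.
- exact: gr1.2.
Qed.

(** By cleanness the number of zero angles is the dimension of the intersection, which is constant
    near x. The zeros then fill the whole cluster at 0, no angle is near 1/2, and [index_near] gives
    no jump. *)
Lemma defect_locally_constant x : (L0 `&` L1) x ->
  \forall y \near x, (L0 `&` L1) y -> D y = D x.
Proof.
move=> Sx; have [L0x L1x] := Sx; set S := L0 `&` L1 in Sx *.
have [[n0 [c0 [c0x cc0 sl0]]] _] := lag0 L0x.
have [[n1 [c1 [c1x cc1 sl1]]] _] := lag1 L1x.
have [[k [kn [c [cx cc sl]]]] _] := clean Sx.
(* All nearby tangent spaces and forms are expressed in this one chart, in which they depend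
   continuously on the point. *)
pose d := chart_at x; have ad : atlas d by apply: chart_at_atlas.
have dx : dom d x by apply: chart_at_dom.
pose F y := pid_mx n *m jac (transition c0 d) (fwd c0 y) : 'M[R]_(n, n + n).
pose G y := pid_mx n *m jac (transition c1 d) (fwd c1 y) : 'M[R]_(n, n + n).
have nearD (e : chart R (n + n) X) : dom e x -> nbhs x (dom e).
  by move=> ex; apply: open_nbhs_nbhs; split => //; exact: dom_open.
have FE y : dom c0 y -> dom d y -> F y = slice_frame c0 n y *m tangent_coord y d.
  by move=> c0y dy; rewrite slice_frame_coord.
have GE y : dom c1 y -> dom d y -> G y = slice_frame c1 n y *m tangent_coord y d.
  by move=> c1y dy; rewrite slice_frame_coord.
have sF y : dom c0 y -> L0 y -> spans (slice_frame c0 n y) (tangent_space L0 y).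
  move=> c0y L0y; apply: (tangent_spaceP n0 c0y cc0 sl0 (@subset_refl _ L0) L0y) => w.
  exact: slice_line.
have sG y : dom c1 y -> L1 y -> spans (slice_frame c1 n y) (tangent_space L1 y).
  move=> c1y L1y; apply: (tangent_spaceP n1 c1y cc1 sl1 (@subset_refl _ L1) L1y) => w.
  exact: slice_line.
(* One slice chart c of the intersection serves all nearby points, so the dimension k is the same
   for all of them. *)
have dimS y alpha : dom c y -> S y -> angle_data L0 L1 y alpha ->
    #|[pred j | alpha j == 0%R]| = k.
  move=> cy Sy [F' [G' [E' [[fF' fG'] sF' sG' ang]]]].
  have lF' := lagrangian_lagframe fF' sF' (lag0 Sy.1).2.
  have [<- _] := rank_angles (omega_hermitian y) lF' fG' ang.
  rewrite -(spans_dim (spans_cap sF' sG')) -(clean Sy).2.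
  have h := tangent_spaceP kn cy cc sl (@subset_refl _ S) Sy (fun w => slice_line cy sl Sy).
  by rewrite (spans_dim h); apply/eqP/slice_frame_free.
have data y alpha : dom c0 y -> dom c1 y -> dom d y -> S y -> angle_data L0 L1 y alpha ->
    [/\ hermitian_form (omega_at d y), lagframe (omega_at d y) (F y),
      exists E, angles (omega_at d y) (F y) (G y) E alpha &
      exists k : int, theta1 y - theta0 y - 2 * (\sum_j alpha j) = k%:~R].
  move=> c0y c1y dy [L0y L1y] hal; have [uT JT] := tangent_coord_unit ad dy.
  have fF := slice_frame_free n0 c0y cc0; have fG := slice_frame_free n1 c1y cc1.
  have [E ang] := angle_data_frames fF fG (sF y c0y L0y) (sG y c1y L1y) hal.
  have lF := lagrangian_lagframe fF (sF y c0y L0y) (lag0 L0y).2.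
  split; first exact: omega_at_hermitian.
  - by rewrite FE //; apply: lagframe_coord.
  - by exists (E *m tangent_coord y d); rewrite FE // GE //; apply: angles_change.
  - exact: phase fF (sF y c0y L0y) (sG y c1y L1y) ang.
have [hW lF [E ang] ph] := data x (al x) c0x c1x dx Sx (alP Sx).
have [_ _ b0 _] := ang.
(* An e below this bound satisfies 4 n e < 1, also for n = 0. *)
have n1' : 0 < (4 * n.+1%:R)^-1 :> R by rewrite invr_gt0 mulr_gt0.
have [e sep en] := well_separated_exists b0 n1'; have [e0 e4 _ _ _] := sep.
have ne : 4 * (n%:R * e) < 1.
  have h : e * (4 * n.+1%:R) < 1 by rewrite -ltr_pdivlMr ?mulr_gt0 // div1r.
  have : n%:R * e <= n.+1%:R * e by rewrite ler_wpM2r ?ler_nat // ltW.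
  lra.
pose Fi := within S (nbhs x).
have wi m p (Q : X -> 'M[R]_(m, p)) Q0 : mxcvg (Fi := nbhs x) Q Q0 -> mxcvg (Fi := Fi) Q Q0.
  by move=> h i j; apply: cvg_trans (h i j); apply: cvg_app; apply: cvg_within.
have cW := wi _ _ _ _ (omega_at_cvg ad dx).
have cF : mxcvg (Fi := Fi) F (F x).
  apply: wi; apply: mxcvgM; first exact: mxcvg_cst.
  by apply: smooth_jac_cvg => //; exact: (cc0 d ad).1.
have cG : mxcvg (Fi := Fi) G (G x).
  apply: wi; apply: mxcvgM; first exact: mxcvg_cst.
  by apply: smooth_jac_cvg => //; exact: (cc1 d ad).1.
have cth (L : set X) (theta : X -> R) : S `<=` L -> L x -> {within L, continuous theta} ->
    theta @ Fi --> theta x.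
  move=> SL Lx /within_cvgP h A nA.
  have h1 : \forall z \near x, L z -> A (theta z) := h x Lx A nA.
  suff : \forall z \near x, S z -> A (theta z) by [].
  by apply: filterS h1 => z zA /SL.
have cD : (fun y => theta1 y - theta0 y) @ Fi --> theta1 x - theta0 x.
  apply: cvgB; [apply: (cth L1) | apply: (cth L0)] => //; try by move=> ? [].
    exact: gr1.1.
  exact: gr0.1.
have near1 := @index_near R n X Fi _ (omega_at d) F G (omega_at d x) (F x) (G x) E (al x)
  cW cF cG hW lF ang _ _ cD ph e sep ne.
do 6?[move: near1 => /(_ _) near1].
rewrite near_withinE in near1.
have near2 : \forall y \near x, [/\ dom c0 y, dom c1 y, dom d y & dom c y].
  apply: filterS2 (filterI (nearD c0 c0x) (nearD c1 c1x)) (filterI (nearD d dx) (nearD c cx)).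
  by move=> y [? ?] [].
apply: filterS2 near1 near2 => y h [c0y c1y dy cy] Sy.
have [hWy lFy [E' ang'] ph'] := data y (al y) c0y c1y dy Sy (alP Sy).
have [DE cE] := h Sy hWy lFy E' (al y) ang' ph'.
rewrite /D DE.
suff -> : #|[pred j | (2^-1 - e < al y j)%R]| = 0%N by rewrite subr0.
move: cE; rewrite (dimS x _ cx Sx (alP Sx)) -(dimS y _ cy Sy (alP Sy)) => cE.
apply: eq_card0 => j; rewrite !inE; apply/negbTE/negP => aj.
have sub : [pred j | al y j == 0%R] \subset [pred j | (al y j < e)%R || (2^-1 - e < al y j)%R].
  by apply/fintype.subsetP => i; rewrite !inE => /eqP ->; rewrite e0.
have := subset_cardP (esym cE) sub j; rewrite !inE aj orbT => /eqP h0.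
by move: aj; rewrite h0; lra.
Qed.

Lemma defect_component Rh x y : component (L0 `&` L1) Rh -> Rh x -> Rh y -> D x = D y.
Proof.
move=> [z Sz ->] xR yR.
apply: (connected_locally_constant (@component_connected _ (L0 `&` L1) z)) xR yR => w wR.
have wS := connected_component_sub wR.
by apply: filterS (defect_locally_constant wS) => v h /connected_component_sub.
Qed.

End Component.

End AbsoluteIndex.

(** * Strips *)

Section Strip.
Context {R : realType}.

(** Distances on the extended line are measured after contraction to [-1, 1], so this map is an
    isometry there. *)
Lemma expand_continuous : {within `[-1, 1], continuous (@expand R)}.
Proof.
apply/within_cvgP => s; rewrite /= in_itv /= -ler_norml => s1 A /nbhs_ballP[e /= e0 eA].
suff : \forall r \near s, r \in `[-1, 1] -> A (expand r) by [].
apply/nbhs_ballP; exists e => // r sr; rewrite in_itv /= -ler_norml => r1.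
by apply: eA; rewrite /ball /= /ereal_ball !expandK.
Qed.

Context {n : nat}.
Local Notation J := (@Jmx R n).

Lemma nform_trivialized (a : R[i]) (Phi : 'M[R]_(n + n)) F : Phi \in unitmx ->
  J *m Phi = Phi *m J -> nform a F = a * detC Phi * trivialized_nform Phi F.
Proof.
move=> uP JP; rewrite /nform /trivialized_nform /detC.
have -> : cplx_mx F = cplx_mx (F *m invmx Phi) *m cplx_mx (usubmx Phi).
  by rewrite -cplx_mx_mulr // mulmxKV.
rewrite det_mulmx.
by rewrite -mulrA; congr (_ * _); rewrite mulrC.
Qed.

(** The volume with respect to Omega is the trivialized volume times the coefficient of Omega in the
    trivialization, so the two phases differ by twice the argument gamma of this coefficient. *)
Lemma trivialized_phase (a : R[i]) (Phi : 'M[R]_(n + n)) F (V : {vspace 'rV[R]_(n + n)}) r psi rho gamma x :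
  Phi \in unitmx -> J *m Phi = Phi *m J -> (forall i, row i F \in V) ->
  nform a F = r%:C%C * expi psi -> 0 < r ->
  a * detC Phi = rho%:C%C * expi gamma -> 0 < rho ->
  Det2 (trivialized_nform Phi) V (expi x) -> expi x = expi (2 * psi - 2 * gamma).
Proof.
move=> uP JP FV aF r0 aP rho0 D; rewrite -mulrBr.
apply: (Det2_polar (r := r / rho) D FV); last by rewrite divr_gt0.
have nz : rho%:C%C * expi gamma != 0 :> R[i].
  by rewrite mulf_neq0 ?expi_neq0 // eq_complex /= eqxx andbT gt_eqF.
apply: (mulfI nz); rewrite -aP -nform_trivialized // aF aP mulrACA -expiD -rmorphM /=.
by rewrite (mulrC rho) divfK ?gt_eqF // (addrC gamma) subrK.
Qed.

Context {X : calabi_yau R n}.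

(** * The argument of the volume form in a trivialization *)

Section Trivialization.
Variables (w : \bar R * R -> X) (Phi : \bar R * R -> 'M[R]_(n + n)).
Hypothesis cw : {within @closed_strip R, continuous w}.
Hypothesis tr : trivialization w Phi.

(** The product is Omega evaluated on the trivializing frame. Neither factor need be continuous,
    because both refer to the chart chosen at the moving point; rewritten in one fixed chart, both
    factors are. *)
Lemma trivialized_Omega_cvg z : closed_strip z ->
  ccvg (Fi := within (@closed_strip R) (nbhs z)) (fun z => Omega (w z) * detC (Phi z))
    (Omega (w z) * detC (Phi z)).
Proof.
move=> Sz; pose d := chart_at (w z); have ad : atlas d by apply: chart_at_atlas.
have dz : dom d (w z) by apply: chart_at_dom.
have cwz : w @ within (@closed_strip R) (nbhs z) --> w z by exact: (within_cvgP _ _).1 cw z Sz.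
have near_d : \forall y \near within (@closed_strip R) (nbhs z), dom d (w y).
  by apply: cwz; apply: open_nbhs_nbhs; split => //; exact: dom_open.
pose M y := Phi y *m tangent_coord (w y) d.
have cM : mxcvg (Fi := within (@closed_strip R) (nbhs z)) M (M z).
  move=> i j A nA; have := (within_cvgP _ _).1 (tr.2 d ad) z (conj Sz dz) _ (@coord_continuous _ _ _ i j _ A nA).
  move=> h; have h1 : \forall y \near z, (closed_strip y /\ dom d (w y)) -> A (M y i j) := h.
  have h2 : \forall y \near z, closed_strip y -> dom d (w y) := near_d.
  suff : \forall y \near z, closed_strip y -> A (M y i j) by [].
  by apply: filterS2 h1 h2 => y q1 q2 Sy; apply: q1; split => //; apply: q2.
have cdet : ccvg (Fi := within (@closed_strip R) (nbhs z)) (fun y => detC (M y)) (detC (M z)).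
  apply: ccvg_det_cplx => i j; rewrite mxE (_ : (fun y => _) = fun y => M y (lshift n i) j).
    exact: cM.
  by apply/funext => y; rewrite mxE.
pose O y := Omega_in_chart (@Omega R n X) d (fwd d (w y)).
(* The change of coordinates enters [M] and, inversely, [O]; complex determinants are multiplicative
   on matrices commuting with J, so it cancels. *)
have E y : closed_strip y -> dom d (w y) -> O y * detC (M y) = Omega (w y) * detC (Phi y).
  move=> Sy dy; have [uT JT] := tangent_coord_unit ad dy; have [uP JP] := tr.1 y Sy.
  rewrite /O /Omega_in_chart fwdK // /nform -/(detC (invmx _)) detCM //.
  have TT : detC (invmx (tangent_coord (w y) d)) * detC (tangent_coord (w y) d) = 1.
    by rewrite -detCM // mulVmx // detC1.
  by rewrite (mulrC (detC (Phi y))) mulrA -(mulrA (Omega _)) TT mulr1.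
have cO : ccvg (Fi := within (@closed_strip R) (nbhs z)) O (O z).
  have [h1 h2] := Omega_smooth (c := d) ad.
  have imz : (fwd d @` dom d) (fwd d (w z)) by exists (w z).
  have cf : (fun y => fwd d (w y)) @ within (@closed_strip R) (nbhs z) --> fwd d (w z).
    exact: cvg_comp cwz (fwd_continuous dz).
  split.
    exact: cvg_comp cf ((h1 0%N).1 _ imz).
  exact: cvg_comp cf ((h2 0%N).1 _ imz).
have [c1 c2] := ccvgM cO cdet; rewrite -(E z Sz dz); split.
- apply: cvg_near_eq c1; move: near_d; rewrite !near_withinE.
  by apply: filterS => y q Sy; rewrite (E y Sy (q Sy)).
- apply: cvg_near_eq c2; move: near_d; rewrite !near_withinE.
  by apply: filterS => y q Sy; rewrite (E y Sy (q Sy)).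
Qed.

(* The strip is parametrized by expand : [-1, 1] -> [-oo, +oo]. *)
Lemma trivialization_lift : exists gamma : R * R -> R,
  {within `[-1, 1] `*` `[0, 1], continuous gamma} /\
  forall s t, s \in `[-1, 1] -> t \in `[0, 1] -> exists2 rho, 0 < rho &
    Omega (w (expand s, t)) * detC (Phi (expand s, t)) = rho%:C%C * expi (gamma (s, t)).
Proof.
pose K : set (R * R) := `[-1, 1] `*` `[0, 1].
pose e (z : R * R) : \bar R * R := (expand z.1, z.2).
pose g z := Omega (w z) * detC (Phi z).
have ce : {within K, continuous e}.
  apply/within_cvgP => -[s t] [/= s1 t1] A [[P Q] [/= nP nQ] PQ].
  have h1 : \forall r \near s, r \in `[-1, 1] -> P (expand r).
    exact: (within_cvgP _ _).1 expand_continuous s s1 P nP.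
  suff : \forall z \near (s, t), K z -> A (e z) by [].
  exists ([set r | r \in `[-1, 1] -> P (expand r)], Q); first by split.
  by move=> [r x] [/= Pr Qx] [/= r1 _]; apply: PQ; split=> //=; apply: Pr.
have Ke z : K z -> closed_strip (e z) by case: z => s t [/= _ t1]; split.
have cg1 : {within @closed_strip R, continuous (fun z => complex.Re (g z))}.
  by apply/within_cvgP => z Sz; have [] := trivialized_Omega_cvg Sz.
have cg2 : {within @closed_strip R, continuous (fun z => complex.Im (g z))}.
  by apply/within_cvgP => z Sz; have [] := trivialized_Omega_cvg Sz.
have g0 (z : R * R) : K z -> 0 < complex.Re (g (e z)) ^+ 2 + complex.Im (g (e z)) ^+ 2.
  move=> Kz; have [uP JP] := tr.1 _ (Ke z Kz).
  have : g (e z) != 0.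
    rewrite mulf_neq0 ?Omega_nonvanishing //; apply/eqP => P0.
    have := detCM (invmx (Phi (e z))) JP; rewrite mulVmx // detC1 P0 mulr0.
    by move/eqP; rewrite oner_eq0.
  case: (g (e z)) => x y; rewrite eq_complex /= negb_and => xy.
  by rewrite lt_neqAle eq_sym paddr_eq0 ?sqr_ge0 // !sqrf_eq0 negb_and xy addr_ge0 ?sqr_ge0.
have m11 : (-1 : R) <= 1 by lra.
have [gam [cg hg]] := rectangle_lift m11 ler01 (within_comp ce Ke cg1) (within_comp ce Ke cg2) g0.
exists gam; split=> // s t s1 t1; have [rho [rho0 h1 h2]] := hg (s, t) (conj s1 t1).
exists rho => //; apply/eqP; rewrite -/(g (e (s, t))) eq_complex /= h1 h2.
by rewrite !mul0r subr0 addr0 !eqxx.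
Qed.

End Trivialization.

(** On each edge the given lift changes as the phase relative to Omega minus the correction 2 gamma.
    Since gamma is one function on the whole closed strip, its contributions cancel around the
    boundary; the gradings remain on the horizontal edges and the angles on the vertical ones. *)
Lemma strip_maslov_formula (L0 L1 : set X) (theta0 theta1 : X -> R) Rh Rh' u p q k alphap alphaq :
  lagrangian_submanifold L0 -> lagrangian_submanifold L1 ->
  grading L0 theta0 -> grading L1 theta1 -> (L0 `&` L1) p -> (L0 `&` L1) q ->
  is_strip L0 L1 Rh Rh' u p q -> strip_maslov L0 L1 u p q k ->
  angle_data L0 L1 p alphap -> angle_data L0 L1 q alphaq ->
  k%:~R = (theta0 q - theta1 q + 2 * (\sum_j alphaq j)) -
          (theta0 p - theta1 p + 2 * (\sum_j alphap j)).
Proof.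
move=> lag0 lag1 gr0 gr1 [L0p L1p] [L0q L1q] [_ _ cw L0u L1u].
move=> [Ep [ap [Eq [aq [pdp pdq [Phi [fb [ft [fl [fr [tr [cfb cft cfl cfr] hbt hlr kE]]]]]]]]]]] dp dq.
rewrite -(angle_data_sum lag0 L0p (path_angle_data lag1 L1p pdp) dp).
rewrite -(angle_data_sum lag0 L0q (path_angle_data lag1 L1q pdq) dq) {dp dq}.
set w := compactify u p q in cw tr hbt hlr.
have w0 s : L0 (w (s, 0)) by case: s => [r||]; [exact: L0u | exact: L0q | exact: L0p].
have w1 s : L1 (w (s, 1)) by case: s => [r||]; [exact: L1u | exact: L1q | exact: L1p].
have [gam [cg hg]] := trivialization_lift cw tr.
have in0 : (0 : R) \in `[0, 1] by rewrite in_itv /= lexx ler01.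
have in1 : (1 : R) \in `[0, 1] by rewrite in_itv /= lexx ler01.
have m11 : (-1 : R) <= 1 by lra.
have inm : (-1 : R) \in `[-1, 1] by rewrite in_itv /= lexx m11.
have inp : (1 : R) \in `[-1, 1] by rewrite in_itv /= lexx m11.
have pi0 := @pi_gt0 R.
have e1 : expand (1 : R) = +oo%E by rewrite expand1.
have em1 : expand (-1 : R) = -oo%E by rewrite expandN1.
have scale (f : R -> R) (a b c : R) : {within `[a, b], continuous f} ->
    {within `[a, b], continuous (fun x => c * f x)}.
  by move=> /within_cvgP cf; apply/within_cvgP => x xab; apply: cvgM; [exact: cvg_cst | exact: cf].
have sub (f g : R -> R) (a b : R) : {within `[a, b], continuous f} -> {within `[a, b], continuous g} ->
    {within `[a, b], continuous (fun x => f x - g x)}.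
  move=> /within_cvgP cf /within_cvgP cg'; apply/within_cvgP => x xab.
  by apply: cvgB; [exact: cf | exact: cg'].
(* On a horizontal edge the grading along the Lagrangian is a continuous lift of the phase relative
   to Omega. *)
have hor (L : set X) theta (f : \bar R -> R) (t : R) : lagrangian_submanifold L -> grading L theta ->
    t \in `[0, 1] -> (forall s, L (w (s, t))) -> continuous f ->
    (forall s, Det2 (trivialized_nform (Phi (s, t))) (tangent_space L (w (s, t)))
       (expi (2 * pi * f s))) ->
    2 * pi * f +oo%E - 2 * pi * f -oo%E =
    (2 * pi * theta (w (+oo%E, t)) - 2 * gam (1, t)) -
    (2 * pi * theta (w (-oo%E, t)) - 2 * gam (-1, t)).
  move=> lagL [cth gth] t1 Lw cf hf; rewrite -e1 -em1.
  have cet : {within `[-1, 1], continuous (fun s : R => (expand s, t))}.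
    have hc : continuous (fun y : \bar R => (y, t)) by exact: pairl_continuous.
    have h := within_comp (B := setT) (g := fun y : \bar R => (y, t)) expand_continuous
      (fun _ _ => I) (continuous_subspaceT hc).
    exact: h.
  have cst : {within `[-1, 1], continuous (fun s : R => (s, t))}.
    by apply: continuous_subspaceT; exact: pairl_continuous.
  apply: (@expi_lift_constant R (fun s => 2 * pi * f (expand s))
    (fun s => 2 * pi * theta (w (expand s, t)) - 2 * gam (s, t)) (-1) 1 m11).
  - apply: scale; exact: (within_comp (B := setT) expand_continuous (fun _ _ => I)
      (continuous_subspaceT cf)).
  - have cwt := within_comp cet (fun s _ => conj I t1) cw.
    have cgt := within_comp cst (fun s s1 => conj s1 t1) cg.
    exact: sub (scale _ _ _ _ (within_comp cwt (fun s _ => Lw (expand s)) cth)) (scale _ _ _ _ cgt).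
  - move=> s s1; set z := (expand s, t); have Sz : closed_strip z by split.
    have [F [fF sF lF]] := lagrangian_tangent_frame lagL (Lw (expand s)).
    have [uP JP] := tr.1 z Sz; have [rho rho0 hz] := hg s t s1 t1.
    have [r [psi [r0 aF]]] : exists r psi, 0 < r /\ nform (Omega (w z)) F = r%:C%C * expi psi.
      apply: polar; rewrite mulf_neq0 ?Omega_nonvanishing //.
      exact: det_cplx_neq0 (omega_hermitian _) lF.
    rewrite (trivialized_phase uP JP (spans_row sF) aF r0 hz rho0 (hf _)).
    by rewrite !expiD (Det2_polar (gth _ (Lw _)) (spans_row sF) aF r0).
(* On a vertical edge the point is fixed and the frame rotates, so the phase relative to Omega grows
   linearly in t, at twice the speed of the determinant. *)
have ver (x : X) E alpha (f : R -> R) (s : R) : s \in `[-1, 1] ->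
    (forall t, w (expand s, t) = x) -> lagframe (omega x) E ->
    {within `[0, 1], continuous f} ->
    (forall t, t \in `[0, 1] -> Det2 (trivialized_nform (Phi (expand s, t)))
       (rowspace (rotate E alpha t)) (expi (2 * pi * f t))) ->
    2 * pi * f 1 - 2 * pi * f 0 =
    (2 * (2 * pi * (\sum_j alpha j)) * 1 - 2 * gam (s, 1)) -
    (2 * (2 * pi * (\sum_j alpha j)) * 0 - 2 * gam (s, 0)).
  move=> s1 wx lE cf hf.
  have [r [psi [r0 aE]]] : exists r psi, 0 < r /\ nform (Omega x) E = r%:C%C * expi psi.
    apply: polar; rewrite mulf_neq0 ?Omega_nonvanishing //.
    exact: det_cplx_neq0 (omega_hermitian _) lE.
  have cst : {within `[0, 1], continuous (fun t : R => (s, t))}.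
    by apply: continuous_subspaceT; exact: pairr_continuous.
  (* The initial argument psi of the frame is a constant and drops out of the differences. *)
  have := @expi_lift_constant R (fun t => 2 * pi * f t - 2 * psi)
    (fun t => 2 * (2 * pi * (\sum_j alpha j)) * t - 2 * gam (s, t)) 0 1 ler01 _ _ _.
  move=> h; rewrite -h; first lra.
  - apply: sub; first exact: scale.
    by apply/within_cvgP => x' _; exact: cvg_cst.
  - have cgs := within_comp cst (fun t t1 => conj s1 t1) cg.
    apply: sub; last exact: scale cgs.
    by apply: scale; apply/within_cvgP => x' _; apply: cvg_within.
  - move=> t t1; set z := (expand s, t); have Sz : closed_strip z by split.
    have [uP JP] := tr.1 z Sz; have [rho rho0 hz] := hg s t s1 t1.
    have aR : nform (Omega (w z)) (rotate E alpha t) =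
        r%:C%C * expi (psi + 2 * pi * (\sum_j alpha j) * t).
      rewrite wx /nform det_rotate mulrCA -/(nform (Omega x) E) aE mulrCA expiD.
      by congr (_ * _); rewrite mulrC.
    have rV : forall i, row i (rotate E alpha t) \in rowspace (rotate E alpha t).
      by move=> i; rewrite mem_rowspace row_sub.
    rewrite expiD (trivialized_phase uP JP rV aR r0 hz rho0 (hf t t1)) -expiD.
    by congr expi; ring.
have [fEp sEp _ _ _] := rotate_frame lag1 L1p pdp.
have [fEq sEq _ _ _] := rotate_frame lag1 L1q pdq.
have lEp := lagrangian_lagframe fEp sEp (lag0 p L0p).2.
have lEq := lagrangian_lagframe fEq sEq (lag0 q L0q).2.
have hb : 2 * pi * fb +oo%E - 2 * pi * fb -oo%E =
    (2 * pi * theta0 q - 2 * gam (1, 0)) - (2 * pi * theta0 p - 2 * gam (-1, 0)) := hor L0 theta0 fb 0 lag0 gr0 in0 w0 cfb (fun s => (hbt s).1).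
have ht : 2 * pi * ft +oo%E - 2 * pi * ft -oo%E =
    (2 * pi * theta1 q - 2 * gam (1, 1)) - (2 * pi * theta1 p - 2 * gam (-1, 1)) := hor L1 theta1 ft 1 lag1 gr1 in1 w1 cft (fun s => (hbt s).2).
have hl : 2 * pi * fl 1 - 2 * pi * fl 0 =
    (2 * (2 * pi * (\sum_j ap j)) * 1 - 2 * gam (-1, 1)) -
    (2 * (2 * pi * (\sum_j ap j)) * 0 - 2 * gam (-1, 0)).
  apply: (ver p Ep ap fl (-1) inm) => // [t|t t1]; first by rewrite em1.
  by rewrite em1; apply: (hlr t t1).1.
have hr : 2 * pi * fr 1 - 2 * pi * fr 0 =
    (2 * (2 * pi * (\sum_j aq j)) * 1 - 2 * gam (1, 1)) -
    (2 * (2 * pi * (\sum_j aq j)) * 0 - 2 * gam (1, 0)).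
  apply: (ver q Eq aq fr 1 inp) => // [t|t t1]; first by rewrite e1.
  by rewrite e1; apply: (hlr t t1).2.
rewrite kE.
have p2 : 2 * @pi R != 0 by rewrite mulf_neq0 // gt_eqF.
move: (gam (1, 0)) (gam (-1, 0)) (gam (1, 1)) (gam (-1, 1)) hb ht hl hr => g1 g2 g3 g4.
move: (fb _) (fb _) (ft _) (ft _) (fl _) (fl _) (fr _) (fr _) => b1 b2 t1 t2 l1 l2 r1 r2.
move: (theta0 p) (theta0 q) (theta1 p) (theta1 q) (\sum_j ap j) (\sum_j aq j).
move: (2 * pi) p2 => c c0 x1 x2 x3 x4 s1 s2 hb ht hl hr.
apply: (mulfI c0). lra.
Qed.

End Strip.

(** * The index formula for a strip *)

Theorem lemma4p12 (R : realType) (n : nat) (X : calabi_yau R n)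
    (L0 L1 : set X) (theta0 theta1 : X -> R)
    (lag0 : lagrangian_submanifold L0) (lag1 : lagrangian_submanifold L1)
    (gr0 : grading L0 theta0) (gr1 : grading L1 theta1)
    (clean : clean_intersection L0 L1)
    (Rh Rh' : set X)
    (comp : component (L0 `&` L1) Rh) (comp' : component (L0 `&` L1) Rh')
    (u : R -> R -> X) (p q : X) (strip : is_strip L0 L1 Rh Rh' u p q)
    (mu_u : int) (Hmu : strip_maslov L0 L1 u p q mu_u) :
  (forall mu_h mu_h' : R,
     absolute_index L0 L1 theta0 theta1 Rh mu_h ->
     absolute_index L0 L1 theta0 theta1 Rh' mu_h' ->
     mu_u%:~R = mu_h' - mu_h) /\
  (constant_phase L0 theta0 -> constant_phase L1 theta1 ->
   forall a_h a_h' : R,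
     angle L0 L1 Rh a_h -> angle L0 L1 Rh' a_h' ->
     mu_u%:~R = 2 * (a_h' - a_h)).
Proof.
have [Rp Rq _ _ _] := strip.
have sub (S : set X) x : component (L0 `&` L1) S -> S x -> (L0 `&` L1) x.
  by move=> [y _ ->]; apply: connected_component_sub.
have Sp := sub _ _ comp Rp; have Sq := sub _ _ comp' Rq.
have /choice[al alP] : forall x, exists al, (L0 `&` L1) x -> angle_data L0 L1 x al.
  move=> x; have [[L0x L1x]|h] := pselect ((L0 `&` L1) x); last by exists (fun=> 0).
  by have [al h] := angle_data_exists lag0 lag1 L0x L1x; exists al.
have muE := strip_maslov_formula lag0 lag1 gr0 gr1 Sp Sq strip Hmu (alP p Sp) (alP q Sq).
have defect S x y := @defect_component R n X L0 L1 theta0 theta1 al lag0 lag1 gr0 gr1 clean alP S x y.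
split=> [m m' hm hm'|cst0 cst1 a a'].
  have [x xR mE] := absolute_index_formula lag0 lag1 clean comp hm.
  have [x' xR' mE'] := absolute_index_formula lag0 lag1 clean comp' hm'.
  (* The absolute indices are computed at points x and x' that need not be the ends p and q of the
     strip; constancy of the defect moves them there. *)
  have := defect _ _ _ comp xR Rp; have := defect _ _ _ comp' xR' Rq.
  rewrite muE (mE _ (alP x (sub _ _ comp xR))) (mE' _ (alP x' (sub _ _ comp' xR'))).
  lra.
move=> [x [E [alpha [xR pd ->]]]] [x' [E' [alpha' [xR' pd' ->]]]].
have [L0x L1x] := sub _ _ comp xR; have [L0x' L1x'] := sub _ _ comp' xR'.
rewrite -(angle_data_sum lag0 L0x (alP x (conj L0x L1x)) (path_angle_data lag1 L1x pd)).
rewrite -(angle_data_sum lag0 L0x' (alP x' (conj L0x' L1x')) (path_angle_data lag1 L1x' pd')).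
have := defect _ _ _ comp xR Rp; have := defect _ _ _ comp' xR' Rq.
(* With constant phases all gradings are evaluated at p, so they cancel between the two ends, and
   the constancy of the defect becomes that of the sum of the angles. *)
rewrite muE (cst0 x p) ?(cst0 x' p) ?(cst0 q p) ?(cst1 x p) ?(cst1 x' p) ?(cst1 q p) //;
  try exact: Sp.1; try exact: Sp.2; try exact: Sq.1; try exact: Sq.2.
lra.
Qed.
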